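(* Let $\mathrm{Sym}\,L$ be the symmetry algebra of a $\mathrm{gl}$-regular, algebraically generic Nijenhuis operator $L$ on a manifold of dimension $n$. Consider an arbitrary basis $M_1,\dots,M_n$ of $\mathrm{Sym}\,L$ and the corresponding collection $K_1=\mathrm{Id},K_2,\dots,K_n$ of Killing $(1,1)$-tensors constructed from this basis (see context). Then the quasilinear system $$u_{t_i}=K_iu_x,\quad i=1,\dots,n,\ x=t_1,$$ can (locally) be linearised by a suitable reciprocal transformation, i.e. transformed by a reciprocal transformation into a system $u_{\tau_i}=\widetilde K_iu_x$, $i=1,\dots,n$, $x=\tau_1$, such that in suitable local coordinates all matrices $\widetilde K_i$ are constant.
   Context: All constructions are local and smooth. An operator field is a $(1,1)$-tensor field; it is Nijenhuis if $L^2[\xi,\eta]+[L\xi,L\eta]-L[L\xi,\eta]-L[\xi,L\eta]=0$ for all vector fields. $L$ is $\mathrm{gl}$-regular if $\mathrm{Id},L,\dots,L^{n-1}$ are linearly independent at each point; it is algebraically generic if its eigenvalues have constant multiplicities. $\mathrm{Sym}\,L$ is the algebra of operator fields $M$ with $LM=ML$ and $\langle L,M\rangle=0$, where $\langle L,M\rangle(\xi,\eta)=LM[\xi,\eta]+[L\xi,M\eta]-L[\xi,M\eta]-M[L\xi,\eta]$; a basis of it means $n$ elements linearly independent at each point. Killing tensors of a basis: let $\mathrm d f$ be a conservation law of $L$ (i.e. $\mathrm d(L^*\mathrm d f)=0$, $(L^*\alpha)(\xi)=\alpha(L\xi)$) which is regular ($\mathrm d f,L^*\mathrm d f,\dots,(L^*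 )^{n-1}\mathrm d f$ are linearly independent), let $u^k$ be local coordinates with $\mathrm d u^k=(L^* )^{k-1}\mathrm d f$, $p_k$ the canonical momenta, and $\check P=p_1\mathrm{Id}+p_2L+\dots+p_nL^{n-1}$. Define $\bar h_1,\dots,\bar h_n$ on the cotangent bundle by $\sum_i\bar h_iM_i=\check P^2$. These are quadratic forms in $p$; $\bar h_1$ is assumed non-degenerate, $\bar h_1=\frac12\bar g(p,p)$ with $\bar g$ a contravariant metric, and $K_i$ is defined by $\bar h_i=\frac12\bar g(K_i^*p,p)$ with $K_i$ $\bar g$-self-adjoint ($K_i$ does not depend on the choice of $\mathrm d f$). Reciprocal transformation: given operator fields $B_1=\mathrm{Id},B_2,\dots,B_n$ with system $u_{t_i}=B_iu_x$ and common conservation laws $\mathrm d g^1,\dots,\mathrm d g^n$ of all $B_j$, choose functions $c^i_j$ with $B_j^*\mathrm d g^i=\mathrm d c^i_j$ (each defined up to an additive constant) such that $\mathcal C=(c^i_j)$ is invertible; let $\mathcal C^{-1}=(\widetilde c\,^i_j)$ and $R_i=\sum_j\widetilde c\,^j_iB_j$, with $R_1$ invertible. The reciprocal transform of the system is $u_{\tau_i}=\widetilde B_iu_x$ with $\widetilde B_i=R_iR_1^{-1}$, $x=\tau_1$. (On solutions it acts by the change of independent variables $\mathrm d\tau_i=\sum_jc^i_j(u(t))\,\mathrm d t_j$.) *)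

(* Defs.v *)
From mathcomp Require Import all_boot all_order all_algebra.
From mathcomp Require Import all_classical all_reals all_analysis.
From mathcomp Require Import complex.

Set Implicit Arguments.
Unset Strict Implicit.
Unset Printing Implicit Defensive.

Import Order.TTheory GRing.Theory Num.Theory.
Import numFieldNormedType.Exports.

Local Open Scope classical_set_scope.
Local Open Scope ring_scope.

(* Everything is local, so the manifold is an open set U of R^(n+1).  Points and
   tangent vectors are columns, covectors are rows: an operator A acts on
   vectors by A *m xi and its dual A^* acts on covectors by alpha *m A.
   Fields are total functions of which only the values on U matter.  The
   mathematical index i = 1, ..., dim is i : 'I_n.+1, shifted by one, so that
   ord0 is the index written 1. *)

Section Smoothness.
Context {R : realType} {V W : normedModType R}.

Fixpoint Ck (k : nat) (U : set V) (f : V -> W) : Prop :=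
  match k with
  | 0 => forall x, U x -> {for x, continuous f}
  | k'.+1 => (forall x, U x -> differentiable f x) /\
             (forall v, Ck k' U (fun x => 'D_v f x))
  end.

Definition smooth (U : set V) (f : V -> W) : Prop := forall k, Ck k U f.

End Smoothness.

Section Tensors.
Context {R : realType} {n : nat}.

Definition vfield : Type := 'cV[R]_n.+1 -> 'cV[R]_n.+1.
Definition form1 : Type := 'cV[R]_n.+1 -> 'rV[R]_n.+1.
Definition opfield : Type := 'cV[R]_n.+1 -> 'M[R]_n.+1.

Implicit Types (U V : set 'cV[R]_n.+1) (L M A : opfield) (xi eta : vfield).

Definition lie (xi eta : vfield) : vfield :=
  fun x => 'D_(xi x) eta x - 'D_(eta x) xi x.

Definition app (A : opfield) (xi : vfield) : vfield := fun x => A x *m xi x.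

Definition nijenhuis U L : Prop :=
  forall xi eta : vfield, smooth U xi -> smooth U eta -> forall x, U x ->
    app L (app L (lie xi eta)) x + lie (app L xi) (app L eta) x
      - app L (lie (app L xi) eta) x - app L (lie xi (app L eta)) x = 0.

Definition gl_regular U L : Prop :=
  forall x, U x -> free [tuple L x ^+ k | k < n.+1].

(* The eigenvalues are the complex ones. *)
Definition algebraically_generic U L : Prop :=
  exists (s : nat) (m : 'I_s -> nat) (lam : 'I_s -> 'cV[R]_n.+1 -> R[i]),
    (forall a, (0 < m a)%N) /\
    forall x, U x ->
      injective (fun a => lam a x) /\
      char_poly (map_mx (real_complex R) (L x)) =
        \prod_(a < s) ('X - (lam a x)%:P) ^+ m a.

(* The bracket <L, M> is tensorial in xi and eta when LM = ML. *)
Definition sym_bracket L M (xi eta : vfield) : vfield := fun x =>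
  app L (app M (lie xi eta)) x + lie (app L xi) (app M eta) x
    - app L (lie xi (app M eta)) x - app M (lie (app L xi) eta) x.

Definition in_Sym U L M : Prop :=
  [/\ smooth U M,
      forall x, U x -> L x *m M x = M x *m L x
    & forall xi eta : vfield, smooth U xi -> smooth U eta ->
        forall x, U x -> sym_bracket L M xi eta x = 0].

Definition Sym_basis U L (M : 'I_n.+1 -> opfield) : Prop :=
  (forall i, in_Sym U L (M i)) /\
  (forall x, U x -> free [tuple M i x | i < n.+1]).

Definition d0 (f : 'cV[R]_n.+1 -> R) : form1 :=
  fun x => \row_j 'D_(delta_mx j 0) f x.

Definition d1 (alpha : form1) (x v w : 'cV[R]_n.+1) : R :=
  ('D_v alpha x *m w - 'D_w alpha x *m v) 0 0.

Definition closed_form U (alpha : form1) : Prop :=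
  forall x, U x -> forall v w, d1 alpha x v w = 0.

Definition conservation_law U A (f : 'cV[R]_n.+1 -> R) : Prop :=
  smooth U f /\ closed_form U (fun x => d0 f x *m A x).

Definition regular_conservation_law U L (f : 'cV[R]_n.+1 -> R) : Prop :=
  conservation_law U L f /\
  (forall x, U x -> free [tuple d0 f x *m L x ^+ k | k < n.+1]).

(* Row k is the differential of the k-th component of phi. *)
Definition jac (phi : 'cV[R]_n.+1 -> 'cV[R]_n.+1) (x : 'cV[R]_n.+1) :
    'M[R]_n.+1 :=
  \matrix_(k < n.+1) d0 (fun y => phi y k 0) x.

Definition coordinates U (phi : 'cV[R]_n.+1 -> 'cV[R]_n.+1) : Prop :=
  [/\ smooth U phi,
      {in U &, injective phi}
    & forall x, U x -> jac phi x \in unitmx].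

Definition metric U (g : opfield) : Prop :=
  [/\ smooth U g,
      forall x, U x -> (g x)^T = g x
    & forall x, U x -> g x \in unitmx].

Definition pairing (g : 'M[R]_n.+1) (p q : 'rV[R]_n.+1) : R :=
  (p *m g *m q^T) 0 0.

(* A covector at x with canonical momenta p_k is \sum_k p_k du^k(x), so that
   h_i, a function on the cotangent bundle, is evaluated there. *)
Definition Killing_data U L (M K : 'I_n.+1 -> opfield)
    (f : 'cV[R]_n.+1 -> R) (u : 'cV[R]_n.+1 -> 'cV[R]_n.+1)
    (h : 'I_n.+1 -> 'cV[R]_n.+1 -> 'rV[R]_n.+1 -> R) (g : opfield) : Prop :=
  [/\ regular_conservation_law U L f,
      coordinates U u /\
        (forall (k : 'I_n.+1) x, U x ->
           d0 (fun y => u y k 0) x = d0 f x *m L x ^+ k),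
      forall x, U x -> forall p : 'I_n.+1 -> R,
        \sum_i h i x (\sum_k p k *: d0 (fun y => u y k 0) x) *: M i x =
        (\sum_(k < n.+1) p k *: L x ^+ k) ^+ 2,
      metric U g /\
        (forall x, U x -> forall p, h ord0 x p = 2^-1 * pairing (g x) p p)
    & forall i x, U x ->
        (forall p, h i x p = 2^-1 * pairing (g x) (p *m K i x) p) /\
        (forall p q, pairing (g x) (p *m K i x) q =
                     pairing (g x) p (q *m K i x))].

(* f, and hence the coordinates u and the metric, need only exist near each
   point; the K_i do not depend on the choice of f. *)
Definition Killing_tensors U L (M K : 'I_n.+1 -> opfield) : Prop :=
  (forall i, smooth U (K i)) /\
  (forall x, U x -> exists2 V, [/\ open V, V x & V `<=` U] &
     exists f u h g, Killing_data V L M K f u h g).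

(* C = (c^i_j) has row index i and column index j, and R_i = \sum_j
   (C^-1)_{ji} B_j. *)
Definition reciprocal_ops (B : 'I_n.+1 -> opfield)
    (C : 'cV[R]_n.+1 -> 'M[R]_n.+1) (i : 'I_n.+1) : opfield :=
  fun x => \sum_j (invmx (C x)) j i *: B j x.

(* The system u_(t_i) = B_i u_x is represented by the operator fields B_i. *)
Definition reciprocal_transform U (B Bt : 'I_n.+1 -> opfield) : Prop :=
  [/\ (forall i, smooth U (B i)),
      (forall x, U x -> B ord0 x = 1%:M)
    & exists (gl : 'I_n.+1 -> 'cV[R]_n.+1 -> R) (C : 'cV[R]_n.+1 -> 'M[R]_n.+1),
      [/\ forall i j, conservation_law U (B j) (gl i),
          smooth U C /\
            (forall i j x, U x -> d0 (gl i) x *m B j x = d0 (fun y => C y i j) x),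
          forall x, U x -> C x \in unitmx,
          forall x, U x -> reciprocal_ops B C ord0 x \in unitmx
        & forall i x, U x ->
            Bt i x = reciprocal_ops B C i x *m invmx (reciprocal_ops B C ord0 x)]].

(* The matrix of A at x in the coordinates phi. *)
Definition in_coordinates (phi : 'cV[R]_n.+1 -> 'cV[R]_n.+1) A
    (x : 'cV[R]_n.+1) : 'M[R]_n.+1 :=
  jac phi x *m A x *m invmx (jac phi x).

End Tensors.

Arguments opfield : clear implicits.

(* Main.v *)
(** Everything happens near [x0]; write [a = df]. The germs at [x0] of smooth complex functions form a
    local ring [O] with commuting derivations, and the bracket [<L, .>] obeys the Leibniz rule on operators
    commuting with [L]. Each eigenvalue of [L] is a simple root of a derivative of the characteristic
    polynomial, hence lies in [O], and the spectral projectors of [L] belong to Sym L. On a generalised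
    eigenspace an explicit coordinate change, computed in truncated power series in the nilpotent part of [L],
    produces a nilpotent element of Sym L. Hence there is [L'] in Sym L with [L'(x0) = L(x0)] that is
    annihilated by the constant polynomial [chi = char_poly (L x0)]. The forms [a L'^k] are closed, and
    their potentials are coordinates in which [L'] is the companion matrix of [chi].

    Write [L'^(n-i) = \sum_j c^i_j M_j]. The definition of the Killing tensors says that
    [XY = \sum_j (1/2) g(a X K_j, a Y) M_j] for [X], [Y] commuting with [L], and applying [<L, .>] to the
    first identity then gives [dc^i_j = dc^i_1 K_j]. So [C = (c^i_j)] defines a reciprocal transformation. Its
    operators [R_i] form the basis dual to the [L'^(n-i)] for the form [(1/2) g(a X, a Y)]; Horner's scheme
    for [chi] yields [R_i = H_i(L') R_1], and [R_i R_1^-1 = H_i(L')] is constant together with [L']. *)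

(* The obstacle is that the eigenvalues of [L] are in general not constant. Subtracting an
   eigenvalue [la] from [L] on its block then leaves Sym [L], since the bracket of [L] with [la Id]
   contains the derivatives of [la]. The nilpotent part has to be corrected before the eigenvalues
   can be frozen at their values at [x0]. The data are only smooth and the eigenvalues may be
   complex, so holomorphic coordinates are out of reach; the correction is a polynomial in the
   nilpotent part whose coefficients are found algebraically, and analysis enters only through
   potentials of closed forms and through roots of functions equal to 1 at [x0]. For this reason the
   algebra is carried out over an abstract ring with derivations, an evaluation that detects units,
   potentials and such roots; germs instantiate it later. Conjugation is carried along because the
   operator must finally be real. The powers [L'^(n-i)] decrease with [i] so that the first Horner
   polynomial is 1, in agreement with the first transformed operator being [Id]. *)
From HB Require Import structures.
Require Import Defs.
From mathcomp Require Import all_boot all_order all_algebra all_fingroup.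
From mathcomp Require Import all_classical all_reals all_analysis.
From mathcomp Require Import complex ring lra zify.

Set Implicit Arguments.
Unset Strict Implicit.
Unset Printing Implicit Defensive.

Import Order.TTheory GRing.Theory Num.Theory.
Import numFieldNormedType.Exports.

Local Open Scope ring_scope.

(** * Brackets, closed forms and cyclic covectors over a differential ring *)

Ltac mxabel := apply/matrixP => ? ?; rewrite ?mxE; ring.

Section Brackets.
Context {n : nat} {O : comUnitRingType} (d : 'I_n.+1 -> {additive O -> O}).
Hypothesis dM : forall j x y, d j (x * y) = d j x * y + x * d j y.

Definition dmx {p q} j (A : 'M[O]_(p, q)) : 'M[O]_(p, q) := map_mx (d j) A.

Definition grad (h : O) : 'rV[O]_n.+1 := \row_j d j h.

(** The Jacobian matrix of the vector field [L e_j], the j-th column of [L]. *)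
Definition gmx (L : 'M[O]_n.+1) j : 'M[O]_n.+1 := \matrix_(r, k) d k (L r j).

(** Directional derivative along the vector field [L e_j]. *)
Definition dalong {p q} (L : 'M[O]_n.+1) j (A : 'M[O]_(p, q)) : 'M[O]_(p, q) :=
  \sum_k L k j *: dmx k A.

(* Column k of [symop L j M] is <L, M>(e_j, e_k) for M commuting with L. *)
Definition symop (L : 'M[O]_n.+1) j (M : 'M[O]_n.+1) : 'M[O]_n.+1 :=
  dalong L j M - L *m dmx j M + M *m gmx L j - gmx L j *m M.

(* Vanishing of [lawop L j al] for all j and a closed form al means that al L is
   closed; it passes from al to al M for M in Sym L. *)
Definition lawop (L : 'M[O]_n.+1) j (al : 'rV[O]_n.+1) : 'rV[O]_n.+1 :=
  dalong L j al - dmx j al *m L - al *m dmx j L + al *m gmx L j.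

Lemma dmx_mul {p q r} j (A : 'M[O]_(p, q)) (B : 'M[O]_(q, r)) :
  dmx j (A *m B) = dmx j A *m B + A *m dmx j B.
Proof.
apply/matrixP => i k; rewrite !mxE raddf_sum -big_split /=.
by apply: eq_bigr => l _; rewrite dM !mxE.
Qed.

Lemma dmx_scale {p q} j h (A : 'M[O]_(p, q)) :
  dmx j (h *: A) = d j h *: A + h *: dmx j A.
Proof. by apply/matrixP => i k; rewrite !mxE dM. Qed.

Lemma dalong_mul {p q r} L j (A : 'M[O]_(p, q)) (B : 'M[O]_(q, r)) :
  dalong L j (A *m B) = dalong L j A *m B + A *m dalong L j B.
Proof.
rewrite /dalong mulmx_suml mulmx_sumr -big_split /=; apply: eq_bigr => k _.
by rewrite -scalemxAl -scalemxAr -scalerDr dmx_mul.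
Qed.

Lemma dalongD {p q} L j (A B : 'M[O]_(p, q)) :
  dalong L j (A + B) = dalong L j A + dalong L j B.
Proof.
rewrite /dalong -big_split /=; apply: eq_bigr => k _.
by rewrite -scalerDr /dmx map_mxD.
Qed.

Lemma dalong_scale {p q} L j h (A : 'M[O]_(p, q)) :
  dalong L j (h *: A) = h *: dalong L j A + (grad h *m L) 0 j *: A.
Proof.
rewrite /dalong scaler_sumr mxE scaler_suml -big_split /=; apply: eq_bigr => k _.
by rewrite dmx_scale scalerDr !scalerA !mxE addrC mulrC; congr (_ + _ *: _); rewrite mulrC.
Qed.

Lemma symopM L j M N : L *m M = M *m L ->
  symop L j (M *m N) = symop L j M *m N + M *m symop L j N.
Proof.
move=> LM; rewrite /symop dalong_mul dmx_mul.
rewrite !(mulmxDl, mulmxDr, mulNmx, mulmxN) !mulmxA LM.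
mxabel.
Qed.

Lemma symopD L j M N : symop L j (M + N) = symop L j M + symop L j N.
Proof.
rewrite /symop dalongD /dmx map_mxD !(mulmxDl, mulmxDr); mxabel.
Qed.

Lemma symop0 L j : symop L j 0 = 0.
Proof.
have := symopD L j 0 0; rewrite addr0 => h.
by rewrite -[LHS](addrK (symop L j 0)) -h subrr.
Qed.

Lemma symopN L j M : symop L j (- M) = - symop L j M.
Proof. by apply/eqP; rewrite -addr_eq0 -symopD addNr symop0. Qed.

Lemma symop1 L j : symop L j 1%:M = 0.
Proof.
have h : symop L j 1%:M = symop L j 1%:M + symop L j 1%:M.
  by rewrite -{1}[1%:M]mulmx1 symopM ?mulmx1 ?mul1mx.
by rewrite -[LHS](addrK (symop L j 1%:M)) -h subrr.
Qed.

(** The two extra terms are what the bracket with [L] sees of a function [h]. They vanish for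
    constant [h]; their vanishing in a sum is how equations between differentials arise, such as
    [dla L = la dla] and [dc_j = dc_1 K_j]. *)
Lemma symop_scale L j h M : symop L j (h *: M) =
  h *: symop L j M + ((grad h *m L) 0 j *: M - d j h *: (L *m M)).
Proof.
rewrite /symop dalong_scale dmx_scale mulmxDr -!scalemxAr -!scalemxAl.
move: ((grad h *m L) 0 j) => e.
mxabel.
Qed.

(** The bridge between closed forms and Sym [L]. Differentiating [LM = ML] lets [dM L] be replaced
    by [dL M + L dM - M dL]; the rest cancels. *)
Lemma lawopM L j al M : L *m M = M *m L ->
  lawop L j (al *m M) = lawop L j al *m M + al *m symop L j M.
Proof.
move=> LM; rewrite /lawop /symop dalong_mul.
have dLM : dmx j M *m L = dmx j L *m M + L *m dmx j M - M *m dmx j L.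
  by apply/eqP; rewrite eq_sym subr_eq -!dmx_mul LM.
rewrite dmx_mul !(mulmxDl, mulmxDr, mulNmx, mulmxN) -!mulmxA dLM -!LM.
rewrite !(mulmxDl, mulmxDr, mulNmx, mulmxN).
mxabel.
Qed.

End Brackets.

Section Krylov.
Context {n : nat} {O : comUnitRingType}.
Implicit Types (L M : 'M[O]_n.+1) (a : 'rV[O]_n.+1).

Definition krylov a L : 'M[O]_n.+1 := \matrix_(k < n.+1) (a *m L ^+ k).

(** Since [a L^k M = a M L^k], an operator commuting with [L] is determined by the single covector
    [a M]. *)
Lemma krylov_inj a L (M N : 'M[O]_n.+1) : krylov a L \in unitmx ->
  M * L = L * M -> N * L = L * N -> a *m M = a *m N -> M = N.
Proof.
move=> aL cM cN aMN.
have pw (X : 'M[O]_n.+1) k : X * L = L * X -> a *m L ^+ k *m X = a *m X *m L ^+ k.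
  by move=> /commr_sym cX; rewrite -!mulmxA !mulmxE -(commrX k (commr_sym cX)).
have eq : krylov a L *m M = krylov a L *m N.
  apply/row_matrixP => k; rewrite !row_mul !rowK.
  by rewrite pw // [RHS]pw // aMN.
by rewrite -[M](mulKmx aL) eq mulKmx.
Qed.

(* With [xi] dual to the last row of the Krylov matrix of [a], the pairing of the
   two Krylov bases is unitriangular. *)
Lemma cyclic_vector a L : krylov a L \in unitmx ->
  exists xi : 'cV[O]_n.+1, \matrix_(i, k) ((L ^+ (n - k) *m xi) i 0) \in unitmx.
Proof.
move=> aL; pose xi : 'cV[O]_n.+1 := invmx (krylov a L) *m delta_mx ord_max 0.
exists xi.
have axi k : (k <= n)%N -> a *m L ^+ k *m xi = (k == n)%:R%:M.
  move=> kn; have kn' : (k < n.+1)%N by rewrite ltnS.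
  have -> : a *m L ^+ k = row (Ordinal kn') (krylov a L) by rewrite rowK.
  rewrite -row_mul mulKVmx //; apply/matrixP => i j.
  by rewrite !mxE !ord1 /= -val_eqE /= eqxx andbT mulr1n.
set X := (X in X \in unitmx).
have colX k : col k X = L ^+ (n - k) *m xi.
  by apply/matrixP => i j; rewrite !mxE !ord1.
have tri : is_trig_mx (krylov a L *m X).
  apply/is_trig_mxP => i k ik.
  have -> : (krylov a L *m X) i k = (row i (krylov a L) *m col k X) 0 0.
    by rewrite !mxE; apply: eq_bigr => l _; rewrite !mxE.
  rewrite colX rowK mulmxA -(mulmxA a) mulmxE -exprD axi; last by have := ltn_ord k; have := ltn_ord i; move: ik; lia.
  by rewrite mxE /=; case: eqP => [|_]; [have := ltn_ord k; lia | rewrite mulr0n].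
suff : krylov a L *m X \in unitmx by rewrite unitmx_mul aL.
rewrite unitmxE det_trig // big1 ?unitr1 // => i _.
have -> : (krylov a L *m X) i i = (row i (krylov a L) *m col i X) 0 0.
  by rewrite !mxE; apply: eq_bigr => l _; rewrite !mxE.
rewrite colX rowK mulmxA -(mulmxA a) mulmxE -exprD axi; last by have := ltn_ord i; lia.
by rewrite mxE /=; case: eqP => [_ //|]; have := ltn_ord i; lia.
Qed.

(** Pairing [al] with the cyclic basis [L^(n-k) xi] gives [la^(n-k) (al xi)], so [al xi] determines
    [al]. Left eigenvectors for the same eigenvalue are thus proportional over [O], without dividing
    by a component that might vanish. *)
Lemma left_eigenvector L (la : O) (xi : 'cV[O]_n.+1) :
  \matrix_(i, k) ((L ^+ (n - k) *m xi) i 0) \in unitmx ->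
  exists ell : 'rV[O]_n.+1, forall al, al *m L = la *: al -> al = (al *m xi) 0 0 *: ell.
Proof.
set X := (X in X \in unitmx) => Xu.
exists ((\row_k la ^+ (n - k)) *m invmx X) => al alL.
have pw k : al *m L ^+ k = la ^+ k *: al.
  elim: k => [|k IHk]; first by rewrite !expr0 mulmx1 scale1r.
  by rewrite exprSr -mulmxE mulmxA IHk -scalemxAl alL scalerA exprSr.
apply: (can_inj (mulmxK Xu)); rewrite -scalemxAl mulmxKV //.
apply/rowP => k; rewrite mxE [RHS]mxE mxE; under eq_bigr do rewrite mxE.
have -> : \sum_j al 0 j * (L ^+ (n - k) *m xi) j 0 = (al *m (L ^+ (n - k) *m xi)) 0 0.
  by rewrite !mxE.
by rewrite mulmxA pw -scalemxAl mxE mulrC.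
Qed.

(** The coefficients of [p] are the coordinates of [a M] in the Krylov basis; [M] and [p(L)] commute
    with [L] and agree on [a]. *)
Lemma comm_horner_mx_ex a L M : krylov a L \in unitmx -> L *m M = M *m L ->
  exists p, M = horner_mx L p.
Proof.
move=> aL LM; pose x := a *m M *m invmx (krylov a L).
exists (\sum_(k < n.+1) x 0 k *: 'X^k).
have cH : comm_mx L (horner_mx L (\sum_(k < n.+1) x 0 k *: 'X^k)).
  by apply: comm_mx_horner.
apply: (krylov_inj aL); [by rewrite -!mulmxE LM | by rewrite -!mulmxE; exact/esym |].
have <- : x *m krylov a L = a *m M by rewrite mulmxKV.
rewrite mulmx_sum_row raddf_sum mulmx_sumr; apply: eq_bigr => k _.
by rewrite rowK /= linearZ /= rmorphXn /= horner_mx_X -scalemxAr.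
Qed.

Lemma comm_cyclic a L M N : krylov a L \in unitmx ->
  L *m M = M *m L -> L *m N = N *m L -> M *m N = N *m M.
Proof.
move=> aL /(comm_horner_mx_ex aL)[p ->] /(comm_horner_mx_ex aL)[r ->].
by rewrite !mulmxE -!rmorphM mulrC.
Qed.

Lemma krylov_poly_eq0 a L (p : {poly O}) : krylov a L \in unitmx ->
  (size p <= n.+1)%N -> horner_mx L p = 0 -> p = 0.
Proof.
move=> aL sp pL.
have e : (\row_(k < n.+1) p`_k) *m krylov a L = a *m horner_mx L p.
  rewrite mulmx_sum_row -{2}[p](coefK p) poly_def raddf_sum mulmx_sumr.
  rewrite [RHS](big_ord_widen_cond n.+1 xpredT (fun k => a *m horner_mx L (p`_k *: 'X^k)) sp).
  rewrite [RHS]big_mkcond; apply: eq_bigr => k _ /=; rewrite rowK !mxE.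
  case: ltnP => [_|le]; last by rewrite nth_default // scale0r.
  by rewrite linearZ /= rmorphXn /= horner_mx_X -scalemxAr.
rewrite pL mulmx0 in e.
have r0 : \row_(k < n.+1) p`_k = 0 by rewrite -[LHS](mulmxK aL) e mul0mx.
apply/polyP => k; rewrite coef0; case: (ltnP k n.+1) => [kn|le].
  by move/rowP: r0 => /(_ (Ordinal kn)); rewrite !mxE.
by rewrite nth_default // (leq_trans sp).
Qed.

End Krylov.

Section ClosedForms.
Context {n : nat} {O : comUnitRingType} (d : 'I_n.+1 -> {additive O -> O}).
Hypothesis dM : forall j x y, d j (x * y) = d j x * y + x * d j y.
Hypothesis natU : forall k, k.+1%:R \is a @GRing.unit O.
Implicit Types (L M N : 'M[O]_n.+1) (a al : 'rV[O]_n.+1).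

Definition closed al := forall i j, d i (al 0 j) = d j (al 0 i).

(** The derivatives of [L] are absorbed: up to sign the difference is a component of [d(al L)], and
    the sum is [d al] contracted with [L e_j]. *)
Lemma lawop_entry L j k al : lawop d L j al 0 k =
  d k ((al *m L) 0 j) - d j ((al *m L) 0 k)
  + \sum_l L l j * (d l (al 0 k) - d k (al 0 l)).
Proof.
rewrite /lawop /dalong !mxE summxE !raddf_sum /=.
rewrite -!big_split /=; apply: eq_bigr => l _; rewrite !mxE.
by rewrite !dM; ring.
Qed.

Lemma lawop0 L al : closed al -> closed (al *m L) -> forall j, lawop d L j al = 0.
Proof.
move=> cal calL j; apply/rowP => k; rewrite lawop_entry calL subrr add0r !mxE.
by rewrite big1 // => l _; rewrite cal subrr mulr0.
Qed.

(** Let [S] be the matrix of [d al]. The hypothesis makes [L^T S] skew, so [L] is self-adjoint for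
    the skew form [S] and [S(L^i xi, L^k xi) = S(xi, L^(i+k) xi)] equals its own negative. A skew
    form for which a cyclic operator is self-adjoint is therefore zero. *)
Lemma closed_lawop0 a L al : krylov a L \in unitmx ->
  (forall j, lawop d L j al = 0) -> closed al.
Proof.
move=> /cyclic_vector[xi]; set X := (X in X \in unitmx) => Xu E0.
pose S : 'M[O]_n.+1 := \matrix_(i, j) (d i (al 0 j) - d j (al 0 i)).
have ST : S^T = - S by apply/matrixP => i j; rewrite !mxE opprB.
have LS : L^T *m S = S *m L.
  suff h : L^T *m S + (L^T *m S)^T = 0.
    by apply/eqP; rewrite -subr_eq0 -[S *m L]opprK -mulNmx -ST -{2}[L]trmxK -trmx_mul opprK h.
  apply/matrixP => j k; rewrite !mxE.
  have -> : \sum_l L^T j l * S l k = d j ((al *m L) 0 k) - d k ((al *m L) 0 j).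
    have := congr1 (fun A : 'rV__ => A 0 k) (E0 j); rewrite lawop_entry [RHS]mxE => /eqP.
    rewrite addr_eq0 => /eqP h; rewrite -opprB h opprK.
    by apply: eq_bigr => l _; rewrite !mxE.
  have -> : \sum_l L^T k l * S l j = d k ((al *m L) 0 j) - d j ((al *m L) 0 k).
    have := congr1 (fun A : 'rV__ => A 0 j) (E0 k); rewrite lawop_entry [RHS]mxE => /eqP.
    rewrite addr_eq0 => /eqP h; rewrite -opprB h opprK.
    by apply: eq_bigr => l _; rewrite !mxE.
  by ring.
have LTX k : (L ^+ k)^T *m S = S *m L ^+ k.
  elim: k => [|k IHk]; first by rewrite !expr0 trmx1 mul1mx mulmx1.
  by rewrite exprSr -mulmxE trmx_mul -mulmxA IHk mulmxA LS -!mulmxA !mulmxE -exprS -exprSr.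
have s0 k : xi^T *m S *m L ^+ k *m xi = 0.
  set s := LHS.
  have sT : s^T = - s.
    rewrite /s !trmx_mul trmxK ST !mulmxA mulmxN mulNmx; congr (- (_ *m _)).
    by rewrite -!mulmxA; congr (_ *m _); rewrite LTX.
  have s00 : s 0 0 = - s 0 0 by move/matrixP: sT => /(_ 0 0); rewrite !mxE.
  apply/matrixP => i j; rewrite !ord1 [RHS]mxE.
  (* [natU 1] is the invertibility of 2. *)
  by apply: (mulrI (natU 1)); rewrite mulr0 mulr_natl mulr2n {1}s00 addNr.
have XSX : X^T *m S *m X = 0.
  apply/matrixP => i k.
  have -> : (X^T *m S *m X) i k = ((col i X)^T *m S *m col k X) 0 0.
    by rewrite tr_col -!row_mul !mxE; apply: eq_bigr => l _; rewrite !mxE.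
  have colX l : col l X = L ^+ (n - l) *m xi by apply/matrixP => p q; rewrite !mxE !ord1.
  by rewrite !colX trmx_mul -(mulmxA xi^T) LTX !mulmxA -(mulmxA (xi^T *m S)) mulmxE -exprD s0 !mxE.
have S0 : S = 0.
  apply: (can_inj (mulmxK Xu)); apply: (can_inj (mulKmx (_ : X^T \in unitmx))).
    by rewrite unitmx_tr.
  by rewrite mul0mx mulmx0 mulmxA.
move=> i j; apply/eqP; rewrite -subr_eq0.
by move/matrixP: S0 => /(_ i j); rewrite !mxE => ->.
Qed.

Lemma symop_comm L M j : symop d L j L = 0 -> L *m M = M *m L ->
  L *m symop d L j M = symop d L j M *m L.
Proof.
move=> DL LM.
have := symopM dM j L LM; rewrite -LM symopM // DL mul0mx mulmx0 add0r addr0.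
by [].
Qed.

(** Converse of [closed_symop0]: closedness of [a N] and [a N L] makes [a] annihilate the bracket of
    [L] and [N]; the bracket commutes with [L], so the cyclic covector detects it. Membership in Sym
    [L] is thus tested on two closed forms. *)
Lemma symop_eq0 a L N j : krylov a L \in unitmx -> symop d L j L = 0 ->
  closed a -> closed (a *m L) -> L *m N = N *m L ->
  closed (a *m N) -> closed (a *m N *m L) -> symop d L j N = 0.
Proof.
move=> aL DL ca caL LN caN caNL.
apply: (krylov_inj aL); rewrite -?mulmxE; [|by rewrite mul0mx mulmx0|].
  by rewrite (symop_comm DL LN).
have := lawopM dM j a LN; rewrite (lawop0 caN caNL) (lawop0 ca caL) mul0mx add0r.
by rewrite mulmx0 => <-.
Qed.

Lemma closed_symop0 a L M : krylov a L \in unitmx ->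
  closed a -> closed (a *m L) -> L *m M = M *m L ->
  (forall j, symop d L j M = 0) -> closed (a *m M).
Proof.
move=> aL ca caL LM DM; apply: (closed_lawop0 aL) => j.
by rewrite (lawopM dM) // (lawop0 ca caL) DM mul0mx mulmx0 addr0.
Qed.

Lemma symopX L M j k : L *m M = M *m L -> M *m symop d L j M = symop d L j M *m M ->
  symop d L j (M ^+ k.+1) = k.+1%:R *: (M ^+ k *m symop d L j M).
Proof.
move=> LM MD; elim: k => [|k IHk]; first by rewrite expr1 expr0 mul1mx scale1r.
rewrite exprS -mulmxE (symopM dM) // IHk -scalemxAr mulmxA mulmxE -exprS -[k.+2%:R]natr1 scalerDl.
rewrite scale1r addrC; congr (_ + _).
by apply: commrX; rewrite /GRing.comm -mulmxE.
Qed.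

Lemma symopX0 L M j k : L *m M = M *m L -> symop d L j M = 0 -> symop d L j (M ^+ k) = 0.
Proof.
move=> LM DM; case: k => [|k]; first by rewrite expr0 symop1.
by rewrite symopX // DM ?mulmx0 ?mul0mx ?scaler0.
Qed.

(** Write [D] for the bracket. Differentiating [P P = P] gives [D = 2 P D]; multiplying by [P] gives
    [P D = 2 P D], so [P D] and then [D] vanish. *)
Lemma symop_idem L P j : symop d L j L = 0 -> L *m P = P *m L ->
  P *m symop d L j P = symop d L j P *m P -> P *m P = P -> symop d L j P = 0.
Proof.
move=> DL LP DP PP.
have e : symop d L j P = P *m symop d L j P + P *m symop d L j P.
  by rewrite -{1}PP (symopM dM) // DP.
have e2 : P *m symop d L j P = 0.
  by move: (congr1 (mulmx P) e); rewrite mulmxDr mulmxA PP => /eqP; rewrite -subr_eq subrr eq_sym => /eqP.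
by rewrite e e2 addr0.
Qed.

End ClosedForms.

(** * Derivations and antiderivatives on polynomials *)

Section PolyDerivation.
Context {S : comNzRingType} (D : {additive S -> S}).
Hypothesis DM : forall x y, D (x * y) = D x * y + x * D y.

Lemma map_derivationM (p r : {poly S}) :
  map_poly D (p * r) = map_poly D p * r + p * map_poly D r.
Proof.
apply/polyP => i; rewrite coefD !coefM coef_map /= coefM raddf_sum -big_split /=.
by apply: eq_bigr => j _; rewrite DM !coef_map.
Qed.

Lemma derivation1 : D 1 = 0.
Proof. by have := DM 1 1; rewrite !mulr1 mul1r => /eqP; rewrite -subr_eq subrr eq_sym => /eqP. Qed.

Lemma derivationX x k : D (x ^+ k) = k%:R * x ^+ k.-1 * D x.
Proof.
elim: k => [|k IHk]; first by rewrite expr0 derivation1 !mul0r.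
rewrite exprS DM IHk; case: k {IHk} => [|k] /=; first by rewrite expr0; ring.
by rewrite exprS -[k.+2%:R]natr1; ring.
Qed.

Lemma map_derivation_polyC x : map_poly D x%:P = (D x)%:P.
Proof. exact: map_polyC. Qed.

Lemma map_derivation_polyX : map_poly D 'X = 0.
Proof.
apply/polyP => i; rewrite coef_map coefX coef0 /=.
by case: (i == 1)%N; rewrite ?raddf0 ?derivation1.
Qed.

Lemma derivation_horner (p : {poly S}) y :
  D p.[y] = (map_poly D p).[y] + p^`().[y] * D y.
Proof.
elim/poly_ind: p => [|p c IHp]; first by rewrite map_poly0 deriv0 !horner0 raddf0 mul0r addr0.
rewrite hornerMXaddC raddfD DM IHp raddfD /= map_derivationM map_derivation_polyX mulr0 addr0.
rewrite map_derivation_polyC derivMXaddC !hornerE; ring.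
Qed.

Lemma deriv_map_derivation (p : {poly S}) : (map_poly D p)^`() = map_poly D p^`().
Proof. by apply/polyP => i; rewrite coef_deriv !coef_map /= coef_deriv raddfMn. Qed.

End PolyDerivation.

Lemma horner_add_taylor (S : comNzRingType) (p : {poly S}) x h :
  exists s, p.[x + h] = p.[x] + h * p^`().[x] + h ^+ 2 * s.
Proof.
elim/poly_ind: p => [|p c [s IHp]]; first by exists 0; rewrite deriv0 !horner0; ring.
exists (p^`().[x] + (x + h) * s); rewrite derivMXaddC !hornerE IHp; ring.
Qed.

Section Antiderivative.
Context {O : comUnitRingType}.
Hypothesis natU : forall k, k.+1%:R \is a @GRing.unit O.

Lemma natU_gt0 k : (0 < k)%N -> k%:R \is a @GRing.unit O.
Proof. by case: k. Qed.

Lemma deriv_inj0 (p r : {poly {poly O}}) :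
  p^`() = r^`() -> p`_0 = r`_0 -> p = r.
Proof.
move=> pr pr0; apply/polyP => -[//|i].
have := congr1 (fun p : {poly _} => p`_i) pr; rewrite !coef_deriv => h.
apply/polyP => j; have := congr1 (fun p : {poly _} => p`_j) h.
by rewrite !coefMn => e; apply: (mulrI (natU i)); rewrite !mulr_natl.
Qed.

Definition anti (p : {poly {poly O}}) : {poly {poly O}} :=
  \poly_(i < (size p).+1) (if i is j.+1 then (j.+1%:R^-1)%:P * p`_j else 0).

Lemma anti0 p : (anti p)`_0 = 0.
Proof. by rewrite coef_poly. Qed.

Lemma deriv_anti p : (anti p)^`() = p.
Proof.
apply/polyP => i; rewrite coef_deriv coef_poly ltnS.
case: ltnP => [ilt|ige]; last by rewrite mul0rn nth_default.
rewrite -[_ *+ _]mulr_natl mulrA -[_%:R]polyC_natr -polyCM mulrV //.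
exact: mul1r.
Qed.

End Antiderivative.

(** * The nilpotent part of an eigenvalue block *)

Section Jets.
Context {O : comUnitRingType} (q : nat) (c : nat -> O).
Hypothesis natU : forall k, k.+1%:R \is a @GRing.unit O.

(* In the model L = la(z) + eps over O[eps]/(eps^(q+2)), with z = w + eps y and c
   the jet of the function la at w, one has nu = eps (1 + jet.[y]). *)
Definition jet : {poly {poly O}} :=
  \sum_(j < q.+1) ((c j.+1 / (factorial j.+1)%:R)%:P * 'X^j : {poly O})%:P * 'X ^+ j.+1.

(** Integral of [(1 + jet)^k] from 0 in the outer variable [y]. The [dy] part of [nuhat^k dZ] is
    [eps^(k+1) (1 + jet)^k dy]; its coefficient of [eps^(q+1)] integrates to the coefficient of
    [eps^(q-k)] here, which will be required to equal a given potential [V k]. These equations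
    determine [y]. *)
Definition moment k : {poly {poly O}} := anti ((1 + jet) ^+ k).

(** ['X] is [eps]. This is the truncated expansion of [la(w + eps y) + eps - la(w)], the image of
    [L - la] in the model. *)
Definition nuhat (y : {poly O}) : {poly O} := 'X * (1 + jet.[y]).

Lemma factU k : (factorial k)%:R \is a @GRing.unit O.
Proof. by rewrite natU_gt0 // fact_gt0. Qed.

Lemma jet0 : jet.[0] = 0.
Proof. by rewrite horner_sum big1 // => j _; rewrite !hornerE expr0n /= mulr0. Qed.

Lemma jet_coef0 y : (jet.[y])`_0 = c 1 * y`_0.
Proof.
rewrite -horner_coef0 /jet !horner_sum big_ord_recl big1 => [|j _]; last first.
  by rewrite /bump /= !hornerE /= expr0n /= !(mulr0, mul0r).
by rewrite addr0 factS fact0 divr1 expr0 expr1 mulr1 !hornerE horner_coef0.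
Qed.

Lemma moment_at0 k : (moment k).[0] = 0.
Proof. by rewrite horner_coef0 anti0. Qed.

Section Derivation.
Context (D : {additive O -> O}) (dw : O).
Hypothesis DM : forall x y, D (x * y) = D x * y + x * D y.
Hypothesis Dc : forall j, D (c j.+1) = c j.+2 * dw.

Notation D1 := (map_poly D : {additive {poly O} -> {poly O}}).
Notation D2 := (map_poly D1 : {additive {poly {poly O}} -> {poly {poly O}}}).

Lemma D_natV k x : D (x / k.+1%:R) = D x / k.+1%:R.
Proof.
apply: (mulIr (natU k)) => /=; rewrite (divrK (natU k)).
by rewrite mulr_natr -raddfMn -[_ *+ k.+1]mulr_natr (divrK (natU k)).
Qed.

Lemma D1M x y : map_poly D (x * y) = map_poly D x * y + x * map_poly D y.
Proof. exact: map_derivationM. Qed.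

Lemma D2M x y : map_poly (map_poly D) (x * y) =
  map_poly (map_poly D) x * y + x * map_poly (map_poly D) y.
Proof. exact: (@map_derivationM _ D1 D1M). Qed.

Lemma D2C x : map_poly (map_poly D) x%:P = (map_poly D x)%:P.
Proof. exact: (map_polyC D1). Qed.

Lemma D1Xn k : map_poly D 'X^k = 0.
Proof. by rewrite (@derivationX _ D1 D1M) /= (map_derivation_polyX DM) mulr0. Qed.

Lemma D2Xn k : map_poly (map_poly D) 'X^k = 0.
Proof. by rewrite (@derivationX _ D2 D2M) /= (@map_derivation_polyX _ D1 D1M) mulr0. Qed.

(** Up to truncation [jet] is [(la(w + eps y) - la(w)) / eps]. Its [w]-derivative times [eps] is
    [la'(w + eps y) - la'(w)], and [la'(w + eps y)] is also its [y]-derivative. The error stems from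
    the last term kept in [jet]. *)
Lemma D2_jet : exists r, 'X%:P * map_poly (map_poly D) jet =
  dw%:P%:P * (jet^`() - (c 1)%:P%:P) + ('X^(q.+1))%:P * r.
Proof.
exists ((dw * c q.+2 / (factorial q.+1)%:R)%:P%:P * 'X ^+ q.+1).
have -> : jet^`() = \sum_(j < q.+1) ((c j.+1 / (factorial j)%:R)%:P * 'X^j : {poly O})%:P * 'X ^+ j.
  rewrite /jet raddf_sum /=; apply: eq_bigr => j _.
  rewrite deriv_mulC derivXn /= mulrnAr -mulrnAl -raddfMn /=; congr (polyC _ * _).
  rewrite -mulrnAl -raddfMn /=; congr (polyC _ * _).
  by rewrite -[LHS]mulr_natr factS natrM invrM ?factU ?natU // !mulrA divrK ?natU.
have -> : map_poly (map_poly D) jet = \sum_(j < q.+1) ((dw * c j.+2 / (factorial j.+1)%:R)%:P * 'X^j : {poly O})%:P * 'X ^+ j.+1.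
  rewrite /jet raddf_sum /=; apply: eq_bigr => j _.
  rewrite D2M D2Xn mulr0 addr0 D2C D1M D1Xn mulr0 addr0.
  rewrite map_polyC /=; have := fact_gt0 j.+1; case: (factorial j.+1) => // k _.
  by rewrite D_natV Dc [dw * _]mulrC.
rewrite big_ord_recr /= big_ord_recl /= fact0 divr1 !expr0 !mulr1 addrAC subrr add0r.
rewrite mulrDr !mulr_sumr; congr (_ + _).
  apply: eq_bigr => j _; rewrite /bump /= add1n !exprS !polyCM; ring.
by rewrite !exprS !polyCM; ring.
Qed.

(** Both sides vanish at [y = 0] and have the same [y]-derivative by [D2_jet]. For [k = 0] the
    multiplicity [k] kills the terms in which [k.-1] is a default value. *)
Lemma D2_moment k : exists r, 'X%:P * map_poly (map_poly D) (moment k) =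
  dw%:P%:P * ((1 + jet) ^+ k - 1 - ((c 1)%:P%:P * moment k.-1) *+ k)
  + ('X^(q.+1))%:P * r *+ k.
Proof.
have [r0 jetE] := D2_jet.
exists (anti ((1 + jet) ^+ k.-1 * r0)).
apply: (deriv_inj0 natU).
  have d1 : (1 : {poly {poly O}})^`() = 0 by rewrite -[1]/(1%:P) derivC.
  rewrite !(derivD, derivN, derivM, derivC, derivMn, deriv_exp, d1, mul0r, add0r, subr0, oppr0).
  rewrite (@deriv_map_derivation _ D1) !(deriv_anti natU) (@derivationX _ D2 D2M) /=.
  rewrite raddfD /= (@derivation1 _ D2 D2M) add0r mulrCA jetE; ring.
have m0 l : (moment l).[0] = 0 by rewrite horner_coef0 anti0.
rewrite [LHS]coefCM coef_map anti0 /= raddf0 mulr0.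
rewrite coefD coefMn !coefCM anti0 mulr0 mul0rn addr0 !(coefD, coefN, coefMn, coefCM) anti0.
by rewrite -!horner_coef0 !hornerE jet0 addr0 expr1n ?mulr0 ?mul0rn ?subr0 subrr ?mulr0.
Qed.

Section Solution.
Context (y : {poly O}) (V A : nat -> O) (dla : O).
Hypothesis momentV : forall k, (k <= q)%N -> ((moment k).[y])`_(q - k) = V k.
Hypothesis DV : forall k, (k <= q)%N -> D (V k) = A k - V k.-1 * dla *+ k.
Hypothesis dlaE : dla = c 1 * dw.
Hypothesis dwE : dw = A q.+1 - V q * dla *+ q.+1.
Hypothesis y0E : (1 + c 1 * y`_0) ^+ q.+1 = 1 + c 1 * V q *+ q.+1.

(* With Z = w + eps y, the (q+1)-st coefficient of nu^k dZ. *)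
Lemma dlaw_nuhat k : (k <= q.+1)%N ->
  A k = (nuhat y ^+ k * (dw%:P + 'X * D1 y))`_q.+1.
Proof.
have coef_nuhat r j : (nuhat y ^+ j * r)`_q.+1 =
    if (q.+1 < j)%N then 0 else ((1 + jet.[y]) ^+ j * r)`_(q.+1 - j).
  by rewrite /nuhat exprMn -mulrA coefXnM.
rewrite leq_eqVlt => /predU1P[->|].
  (* For the top power only the constant coefficients of [dZ] and of [(1 + jet)^(q+1)] survive, and
     the claim becomes [y0E]. *)
  rewrite coef_nuhat ltnn subnn coefM big_ord1 subn0 coefD coefC coefXM addr0 /=.
  rewrite -horner_coef0 horner_exp hornerD hornerC.
  have -> : (jet.[y]).[0] = c 1 * y`_0.
    by rewrite horner_coef0 jet_coef0.
  have -> : A q.+1 = dw + V q * dla * q.+1%:R by rewrite mulr_natr {1}dwE subrK.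
  by rewrite y0E dlaE -[_ *+ q.+1]mulr_natr; ring.
rewrite ltnS => kq.
rewrite coef_nuhat ltnNge ltnW //= mulrDr coefD mulrC coefCM mulrCA coefXM subSn //=.
have DVk : A k - V k.-1 * dla *+ k =
    ((map_poly D1 (moment k)).[y])`_(q - k) + (((1 + jet.[y]) ^+ k) * D1 y)`_(q - k).
  rewrite -DV // -momentV // -coefD.
  have -> : (D ((moment k).[y])`_(q - k)) = (D1 (moment k).[y])`_(q - k) by rewrite coef_map.
  by rewrite (@derivation_horner _ D1 D1M) (deriv_anti natU) !hornerE.
have [r momE] := D2_moment k.
have := congr1 (fun p : {poly {poly O}} => (p.[y])`_(q - k).+1) momE.
rewrite hornerM hornerC coefXM /= => DmE.
have {}DmE : (map_poly (map_poly D) (moment k)).[y]`_(q - k) =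
    (dw%:P * ((1 + jet.[y]) ^+ k - 1 - ((c 1)%:P * (moment k.-1).[y]) *+ k)
     + 'X^(q.+1) * r.[y] *+ k)`_(q - k).+1.
  by rewrite DmE hornerD hornerMn !hornerM !hornerC !hornerD !hornerN hornerMn hornerM !hornerC horner_exp hornerD -[1]/(1%:P) hornerC.
rewrite DmE !(coefD, coefMn, coefCM) coefXnM in DVk.
have -> : A k = A k - V k.-1 * dla *+ k + V k.-1 * dla *+ k by rewrite subrK.
rewrite {}DVk.
have Vk : (moment k.-1).[y]`_(q - k).+1 *+ k = V k.-1 *+ k.
  by case: k kq {DmE momE r} => // k kq; rewrite /= -momentV ?(ltnW kq) // subnSK.
have X0 : (if ((q - k).+1 < q.+1)%N then 0 else (r.[y])`_((q - k).+1 - q.+1)) *+ k = 0.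
  by case: k kq {DmE momE Vk} => // k kq; rewrite ifT ?mul0rn //; lia.
rewrite X0 coefN coef1 /= dlaE.
move: Vk; rewrite -[LHS]mulr_natr -[RHS]mulr_natr => Vk.
have -> : V k.-1 * (c 1 * dw) *+ k = c 1 * dw * ((moment k.-1).[y]`_(q - k).+1 * k%:R).
  by rewrite Vk -[LHS]mulr_natr; ring.
rewrite coefN coefMn coefCM -[_ *+ k]mulr_natr; ring.
Qed.

End Solution.

(** In the model [nuhat + la(w) = la(Z) + eps] with [Z = w + eps y], whose derivative is
    [la'(Z) dZ]; the derivative of [jet] at [y] is [la'(Z)]. *)
Lemma derivation_nuhat (y : {poly O}) : exists r,
  map_poly D (nuhat y) =
  jet^`().[y] * (dw%:P + 'X * map_poly D y) - (c 1 * dw)%:P + 'X^(q.+1) * r.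
Proof.
have [r jetE] := D2_jet; exists r.[y].
have := congr1 (fun p : {poly {poly O}} => p.[y]) jetE; rewrite /= !hornerE => {}jetE.
rewrite /nuhat D1M (@map_derivation_polyX _ D DM) mul0r add0r raddfD /= (@derivation1 _ D1 D1M) add0r.
by rewrite (@derivation_horner _ D1 D1M) mulrDr jetE polyCM; ring.
Qed.

End Derivation.

Section Solve.
Context {C : comNzRingType} (e : {rmorphism O -> C}).

Lemma map_coefp0M (p : {poly O}) j :
  map_poly (coefp 0) (p%:P * 'X^j) = (p`_0)%:P * 'X^j.
Proof.
apply/polyP => l; rewrite coef_map /= !coefCM !coefXn.
by case: (l == j); rewrite ?mulr1 ?mulr0 ?coef0.
Qed.

(** At [eps = 0] the polynomial [jet] is [c 1 * y], and integrating [(1 + c 1 y)^q] gives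
    [((1 + c 1 y)^(q+1) - 1) / ((q+1) c 1)]. Factoring [r - 1] out of the difference of powers
    removes the division by [c 1], which is 0 for a constant eigenvalue. *)
Lemma moment_lead : exists g : {poly O}, map_poly (coefp 0) (moment q) = g /\
  forall r y0, c 1 * y0 = r - 1 -> q.+1%:R * g.[y0] = y0 * \sum_(i < q.+1) r ^+ i.
Proof.
exists (map_poly (coefp 0) (moment q)); split => // r y0 cy0.
pose s : {poly O} := 1 + (c 1)%:P * 'X.
have -> : map_poly (coefp 0) (moment q) = (q.+1%:R^-1)%:P * ('X * \sum_(i < q.+1) s ^+ i).
  apply/polyP => -[|i].
    by rewrite coefCM coefXM mulr0 coef_map anti0 /= coef0.
  apply: (mulrI (natU i)); rewrite mulr_natl -coef_deriv mulr_natl -coef_deriv.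
  congr (_`_i).
  rewrite (_ : (map_poly _ _)^`() = map_poly (coefp 0) (moment q)^`()); last first.
    by apply/polyP => j; rewrite coef_deriv !coef_map coef_deriv /= coefMn.
  rewrite (deriv_anti natU) rmorphXn rmorphD rmorph1 /=.
  have -> : map_poly (coefp 0) jet = (c 1)%:P * 'X.
    rewrite /jet rmorph_sum.
    rewrite (eq_bigr (fun j : 'I_q.+1 => (((c j.+1 / (factorial j.+1)%:R)%:P * 'X^j)`_0)%:P * 'X^(j.+1))); last first.
      by move=> j _; exact: map_coefp0M.
    rewrite big_ord_recl big1 => [|j _]; last by rewrite coefCM coefXn /= mulr0 mul0r.
    by rewrite addr0 coefCM coefXn mulr1 factS fact0 divr1 expr1.
  have tele k : ('X * \sum_(i < k) s ^+ i)^`() = k%:R * s ^+ k.-1.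
    elim: k => [|k IHk]; first by rewrite big_ord0 mulr0 deriv0 mul0r.
    rewrite big_ord_recr /= mulrDr derivD IHk derivM derivX mul1r deriv_exp.
    have -> : s^`() = (c 1)%:P by rewrite derivD deriv_mulC derivX mulr1 -[1]/(1%:P) derivC add0r.
    case: k {IHk} => [|k] /=; first by rewrite expr0; ring.
    have -> : 'X * ((c 1)%:P * s ^+ k *+ k.+1) = (s - 1) * s ^+ k *+ k.+1 by rewrite /s; ring.
    by rewrite -[k.+2%:R]natr1 exprS; ring.
  have nC : (q.+1%:R : {poly O}) = (q.+1%:R)%:P by rewrite polyC_natr.
  rewrite deriv_mulC tele mulrA nC -polyCM mulVr ?natU //.
  by rewrite mul1r.
rewrite hornerM hornerC hornerM hornerX horner_sum mulVKr ?natU //; congr (_ * _).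
apply: eq_bigr => i _; rewrite horner_exp /s !hornerE cy0.
by rewrite addrC subrK.
Qed.

(** A triangular system, solved for the coefficients of [y] in increasing degree. The equation of
    index [q] fixes the constant coefficient through the root [r]; the equation of index [q - l],
    with [l > 0], is affine in the coefficient of degree [l], with the unit [r^(q-l)] as slope. *)
Lemma moment_solve (V : nat -> O) (r : O) :
  r \is a GRing.unit -> \sum_(i < q.+1) r ^+ i \is a GRing.unit ->
  r ^+ q.+1 = 1 + c 1 * V q *+ q.+1 -> (forall k, e (V k) = 0) ->
  exists y : {poly O}, [/\ forall k, (k <= q)%N -> (moment k).[y]`_(q - k) = V k,
     1 + c 1 * y`_0 = r & map_poly e y = 0].
Proof.
move=> rU sU rE eV; set sg := \sum_(i < _) _ in sU.
suff h l : (l <= q)%N -> exists y : {poly O},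
    [/\ forall j, (j <= l)%N -> (moment (q - j)).[y]`_j = V (q - j)%N,
     1 + c 1 * y`_0 = r & map_poly e y = 0].
  have [y [yV yr ye]] := h q (leqnn q); exists y; split=> // k kq.
  by have := yV (q - k)%N (leq_subr _ _); rewrite subKn.
elim: l => [|l IHl] lq.
  (* This stands for [(r - 1) / c 1]: since [r^(q+1) - 1 = (r - 1) sg], it makes sense even when
     [c 1] is not a unit. *)
  pose y0 := q.+1%:R * V q / sg.
  have cy0 : c 1 * y0 = r - 1.
    apply: (mulIr sU) => /=; rewrite /y0 mulrA mulrVK //.
    have -> : (r - 1) * sg = r ^+ q.+1 - 1 by rewrite subrX1.
    by rewrite rE; ring.
  exists y0%:P; split=> [j|  |].
  - rewrite leqn0 => /eqP->; rewrite subn0.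
    have [g [gE gP]] := moment_lead.
    have -> : (moment q).[y0%:P]`_0 = g.[y0].
      rewrite -[LHS]/(coefp 0 (moment q).[y0%:P]) -horner_map /= gE.
      by rewrite coefC.
    apply: (mulrI (natU q)); rewrite (gP r) // /y0 -/sg mulrVK //.
  - by rewrite coefC /= cy0 addrC subrK.
  - by rewrite map_polyC /= /y0 !rmorphM /= eV mulr0 mul0r.
have [y [yV yr ye]] := IHl (ltnW lq).
(* The quadratic Taylor remainder starts in degree [2(l+1)], so up to degree [l + 1] the change is
   linear in [z]. *)
have mm z j : (j <= l.+1)%N -> forall k,
    (moment k).[y + z%:P * 'X^(l.+1)]`_j =
    (moment k).[y]`_j + (if j == l.+1 then z * r ^+ k else 0).
  move=> jl k; have [s ->] := horner_add_taylor (moment k) y (z%:P * 'X^(l.+1)).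
  rewrite (deriv_anti natU) !coefD -addrA; congr (_ + _).
  have -> : ((z%:P * 'X^(l.+1)) ^+ 2 * s)`_j = 0.
    have -> : (z%:P * 'X^(l.+1)) ^+ 2 * s = 'X^(l.+1 + l.+1) * (z%:P ^+ 2 * s).
      by rewrite exprMn exprD; ring.
    by rewrite coefXnM ifT // ; lia.
  rewrite addr0 -mulrA coefCM coefXnM; case: ltngtP jl => // [_|-> _]; first by rewrite mulr0.
  rewrite subnn -!horner_coef0 !hornerE.
  have -> : (jet.[y]).[0] = c 1 * y`_0.
    by rewrite horner_coef0 jet_coef0.
  by rewrite yr.
pose k := (q - l.+1)%N.
pose z := (V k - (moment k).[y]`_l.+1) / r ^+ k.
have rkU : r ^+ k \is a GRing.unit by rewrite unitrX.
exists (y + z%:P * 'X^(l.+1)); split=> [j|  |].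
- rewrite leq_eqVlt => /predU1P[->|jl].
    by rewrite mm // eqxx -/k /z mulrVK // addrC subrK.
  by rewrite mm ?ltn_eqF // ?addr0; [exact: yV | exact: ltnW].
- by rewrite coefD coefCM coefXn mulr0 addr0.
- rewrite rmorphD rmorphM /= map_polyC /= ye add0r.
  have -> : e z = 0.
    rewrite /z rmorphM rmorphB eV /= sub0r.
    have -> : e (moment k).[y]`_l.+1 = (map_poly e (moment k).[y])`_l.+1 by rewrite coef_map.
    rewrite -[map_poly e _]horner_map /= ye.
    rewrite -[0 in X in X `_ _](rmorph0 (map_poly e)) horner_map moment_at0 rmorph0 coef0.
    by rewrite oppr0 mul0r.
  by rewrite mul0r.
Qed.

Lemma nuhat_ev y : map_poly e y = 0 -> map_poly e (nuhat y) = 'X.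
Proof.
move=> ye; rewrite /nuhat rmorphM rmorphD rmorph1 /= map_polyX -[map_poly e _]horner_map /= ye.
by rewrite -[0 in X in _ + X](rmorph0 (map_poly e)) horner_map jet0 rmorph0 addr0 mulr1.
Qed.

(** Inverse series modulo ['X^(q.+2)]. As [nuhat] starts with the unit [r] times ['X], the lowest
    coefficient of a remainder divisible by ['X^j] can be removed by a multiple of [nuhat^j],
    leaving a remainder divisible by ['X^(j.+1)]; in [step] the exponent is [j = q + 2 - k]. *)
Lemma nuhat_inverse (y : {poly O}) r : 1 + c 1 * y`_0 = r -> r \is a GRing.unit -> map_poly e y = 0 ->
  exists (rho s : {poly O}), [/\ rho \Po nuhat y = 'X + 'X^(q.+2) * s, rho`_0 = 0 &
    exists s', map_poly e rho = 'X + 'X^(q.+2) * s'].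
Proof.
move=> yr rU ye.
have g0 : (1 + jet.[y])`_0 = r.
  by rewrite coefD coef1 jet_coef0 yr.
have step k (p : {poly O}) : exists rho s : {poly O},
    (rho * 'X^(q.+2 - k)) \Po nuhat y = 'X^(q.+2 - k) * p + 'X^(q.+2) * s.
  elim: k p => [|k IHk] p.
    exists 0, (- p); rewrite mul0r comp_poly0 subn0; ring.
  case: (ltnP k q.+2) => [kq|qk]; last first.
    have -> : (q.+2 - k.+1 = q.+2 - k)%N by lia.
    exact: IHk.
  set j := (q.+2 - k.+1)%N.
  have jS : (q.+2 - k = j.+1)%N by rewrite /j; lia.
  pose a := p`_0 / r ^+ j.
  have rjU : r ^+ j \is a GRing.unit by rewrite unitrX.
  have [t tE] : exists t, p - a%:P * (1 + jet.[y]) ^+ j = 'X * t.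
    exists (\poly_(i < size (p - a%:P * (1 + jet.[y]) ^+ j)) (p - a%:P * (1 + jet.[y]) ^+ j)`_i.+1).
    apply/polyP => -[|i]; rewrite coefXM /=.
      have gj : ((1 + jet.[y]) ^+ j)`_0 = r ^+ j by rewrite -horner_coef0 horner_exp horner_coef0 g0.
      by rewrite coefB coefCM gj /a mulrVK // subrr.
    rewrite coef_poly; case: ltnP => // le.
    by rewrite nth_default // (leq_trans le).
  have [rho [s rhoE]] := IHk t.
  rewrite jS in rhoE.
  exists (rho * 'X + a%:P), s.
  rewrite mulrDl -mulrA -exprS comp_polyD rhoE comp_polyM comp_polyC comp_Xn_poly.
  have -> : p = 'X * t + a%:P * (1 + jet.[y]) ^+ j by rewrite -tE subrK.
  by rewrite /nuhat exprMn exprS; ring.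
have [rho [s rhoE]] := step q.+1 1.
have q1 : (q.+2 - q.+1 = 1)%N by lia.
rewrite q1 expr1 mulr1 in rhoE.
exists (rho * 'X), s; split=> //; first by rewrite coefMX.
exists (map_poly e s).
have := congr1 (map_poly e) rhoE.
by rewrite map_comp_poly nuhat_ev // comp_polyXr rmorphD rmorphM /= map_polyX map_polyXn.
Qed.

End Solve.
End Jets.

(** * One eigenvalue block, over a ring with evaluation, potentials and roots *)

Section Block.
Context {C : numFieldType} {n : nat} {O : comUnitRingType}.
Context (d : 'I_n.+1 -> {additive O -> O}) (ev : {rmorphism O -> C}).
Hypothesis dM : forall j x y, d j (x * y) = d j x * y + x * d j y.
Hypothesis dC : forall i j x, d i (d j x) = d j (d i x).
Hypothesis unitO : forall x, ev x != 0 -> x \is a GRing.unit.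
Hypothesis poincare : forall al : 'rV[O]_n.+1, closed d al ->
  exists U, ev U = 0 /\ grad d U = al.
Hypothesis roots : forall k T, ev T = 1 -> exists r, r ^+ k.+1 = T /\ ev r = 1.

Lemma natO k : k.+1%:R \is a @GRing.unit O.
Proof. by apply: unitO; rewrite rmorph_nat pnatr_eq0. Qed.
Hint Resolve natO : core.

Lemma unitmx_map_ev m (A : 'M[O]_m) : A \in unitmx -> map_mx ev A \in unitmx.
Proof. by rewrite !unitmxE det_map_mx => /(rmorph_unit ev). Qed.

Lemma map_ev_neq0 m p (A : 'M[O]_(m, p)) : map_mx ev A != 0 ->
  exists i k, A i k \is a GRing.unit.
Proof. by move=> /matrix0Pn[i [k]]; rewrite mxE => /unitO; exists i, k. Qed.

Lemma potentials (al : nat -> 'rV[O]_n.+1) : (forall k, closed d (al k)) ->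
  exists U : nat -> O, forall k, ev (U k) = 0 /\ grad d (U k) = al k.
Proof.
move=> cal.
have ex k : exists U, (ev U == 0) && (grad d U == al k).
  by have [U [U0 UE]] := poincare (cal k); exists U; rewrite U0 UE !eqxx.
exists (fun k => xchoose (ex k)) => k.
by have /andP[/eqP ? /eqP ?] := xchooseP (ex k).
Qed.

Section Eigenvalue.
Context (L P : 'M[O]_n.+1) (a : 'rV[O]_n.+1) (la : O) (q : nat).
Hypothesis DL : forall j, symop d L j L = 0.
Hypothesis ca : closed d a.
Hypothesis caL : closed d (a *m L).
Hypothesis aL : krylov a L \in unitmx.
Hypothesis LP : L *m P = P *m L.
Hypothesis PP : P *m P = P.

Let W := L - la%:M.
Let nu := W *m P.

Lemma LW : L *m W = W *m L.
Proof. by rewrite /W mulmxBr mulmxBl scalar_mxC. Qed.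

Lemma comm_pow (A B : 'M[O]_n.+1) k : A *m B = B *m A -> A *m B ^+ k = B ^+ k *m A.
Proof. by move=> AB; rewrite mulmxE; apply: commrX. Qed.

Lemma LWk k : L *m W ^+ k = W ^+ k *m L. Proof. exact: comm_pow LW. Qed.

Lemma PW : P *m W = W *m P. Proof. exact: comm_cyclic aL LP LW. Qed.

Lemma PWk k : P *m W ^+ k = W ^+ k *m P. Proof. exact: comm_pow PW. Qed.

Lemma nu_pow k : nu ^+ k.+1 = W ^+ k.+1 *m P.
Proof.
elim: k => [|k IHk]; first by rewrite !expr1.
rewrite exprS IHk -mulmxE /nu -!mulmxA (mulmxA P) PWk -!mulmxA PP !mulmxA mulmxE -exprS.
by [].
Qed.

Lemma symop_projector j : symop d L j P = 0.
Proof.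
apply: (symop_idem dM) => //.
exact: comm_cyclic aL LP (symop_comm dM (DL j) LP).
Qed.

Lemma symop_scalar j h : symop d L j h%:M = ((grad d h *m L) 0 j)%:M - d j h *: L.
Proof.
have -> : h%:M = h *: 1%:M :> 'M[O]_n.+1 by rewrite scalemx1.
by rewrite (symop_scale dM) (symop1 dM) scaler0 add0r mulmx1 scalemx1.
Qed.

Hypothesis nu0 : nu ^+ q.+1 = 0.
Hypothesis nuq : map_mx ev (W ^+ q *m P) != 0.

(* D(nu^(q+1)) = 0 leaves (dla L - la dla)(e_j) nu^q = 0. *)
Lemma eigenvalue_law : grad d la *m L = la *: grad d la.
Proof.
apply/rowP => j; rewrite [RHS]mxE; apply/eqP; rewrite -subr_eq0.
have Dnu : symop d L j nu = (d j la *: L - ((grad d la *m L) 0 j)%:M) *m P.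
  rewrite (symopM dM) ?LW // symop_projector mulmx0 addr0 /W.
  rewrite symopD symopN.
  by rewrite DL sub0r symop_scalar opprB.
have LnuC : L *m nu = nu *m L.
  by rewrite /nu mulmxA LW -mulmxA LP mulmxA.
have Dc : nu *m symop d L j nu = symop d L j nu *m nu.
  exact: comm_cyclic aL LnuC (symop_comm dM (DL j) LnuC).
have D0 : q.+1%:R *: (nu ^+ q *m symop d L j nu) = 0.
  rewrite -(symopX dM) // nu0.
  exact: symop0.
have {}D0 : nu ^+ q *m symop d L j nu = 0.
  by rewrite -[LHS]scale1r -(mulVr (natO q)) -scalerA D0 scaler0.
have E : nu ^+ q *m symop d L j nu =
    - ((grad d la *m L) 0 j - la * d j la) *: (W ^+ q *m P).
  have WqP : W ^+ q.+1 *m P = 0 by rewrite -nu_pow.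
  have nuqP : nu ^+ q *m P = W ^+ q *m P.
    case: (q) => [|k]; first by rewrite !expr0.
    by rewrite nu_pow -mulmxA PP.
  have LE : L = W + la%:M by rewrite subrK.
  rewrite Dnu -(comm_cyclic aL LP) ?mulmxA ?nuqP; last first.
    by rewrite mulmxBr mulmxBl -scalemxAr -scalemxAl scalar_mxC.
  rewrite mulmxBr -scalemxAr {1}LE mulmxDr -mulmxA PW mulmxA mulmxE -exprSr -mulmxE WqP add0r.
  by rewrite !mul_mx_scalar scalerA -scalerBl opprB mulrC.
rewrite E in D0.
have [i [k ne]] := map_ev_neq0 nuq.
have := congr1 (fun A : 'M[O]_n.+1 => A i k) D0; rewrite mxE [RHS]mxE => e.
have /eqP := mulIr ne (etrans e (esym (mul0r _))); rewrite oppr_eq0 => h.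
by rewrite [grad d la 0 j]mxE.
Qed.

End Eigenvalue.

Section NilpotentPart.
Context (L P : 'M[O]_n.+1) (a : 'rV[O]_n.+1) (la : O) (q : nat).
Hypothesis DL : forall j, symop d L j L = 0.
Hypothesis ca : closed d a.
Hypothesis caL : closed d (a *m L).
Hypothesis aL : krylov a L \in unitmx.
Hypothesis LP : L *m P = P *m L.
Hypothesis PP : P *m P = P.

Let W := L - la%:M.
Let nu := W *m P.

Hypothesis nu0 : nu ^+ q.+2 = 0.
Hypothesis nuq : map_mx ev (W ^+ q.+1 *m P) != 0.

Lemma closed_PL k : closed d (a *m P *m L ^+ k).
Proof.
rewrite -mulmxA; apply: (closed_symop0 dM natO aL ca caL).
  by rewrite mulmxA LP -!mulmxA; congr (_ *m _); rewrite !mulmxE -exprS exprSr.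
move=> j; rewrite (symopM dM) // (symop_projector DL aL LP PP) mul0mx add0r.
by rewrite (symopX0 dM) ?mulmx0.
Qed.

(** With [dU_j = a P L^j], [V k] is the binomial expansion of [(L - la)^k] in which [L^j] is
    replaced by [U_j]. Differentiating the powers of [-la] adds [-k V_(k-1) dla], by
    [(k-j) C(k,j) = k C(k-1,j)]. *)
Lemma binomial_potentials : exists V : nat -> O, (forall k, ev (V k) = 0) /\
  forall k, grad d (V k) = a *m P *m W ^+ k - (V k.-1 *+ k) *: grad d la.
Proof.
have [U UE] := potentials closed_PL.
exists (fun k => \sum_(j < k.+1) (- la) ^+ (k - j) * U j *+ 'C(k, j)); split=> k.
  rewrite rmorph_sum big1 // => j _.
  by rewrite rmorphMn rmorphM /= (UE j).1 mulr0 mul0rn.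
apply/rowP => i; rewrite mxE raddf_sum /=.
have -> : a *m P *m W ^+ k = \sum_(j < k.+1) ((- la) ^+ (k - j) *+ 'C(k, j)) *: grad d (U j).
  rewrite /W addrC exprDn_comm; last first.
    by rewrite /GRing.comm -!mulmxE -raddfN /= scalar_mxC.
  rewrite mulmx_sumr; apply: eq_bigr => j _; rewrite (UE j).2.
  have -> : (- la%:M) ^+ (k - j) = ((- la) ^+ (k - j))%:M :> 'M[O]_n.+1 by rewrite -rmorphN -rmorphXn.
  by rewrite -mulmxE mul_scalar_mx scalerMnl -scalemxAr.
have dterm (j : 'I_k.+1) : d i ((- la) ^+ (k - j) * U j *+ 'C(k, j)) =
   (((- la) ^+ (k - j) *+ 'C(k, j)) *: grad d (U j)) 0 i
   - (- la) ^+ (k - j).-1 * U j * d i la *+ ((k - j) * 'C(k, j)).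
  rewrite raddfMn dM (derivationX (dM i)) raddfN !mxE.
  rewrite -[_ *+ 'C(k, j)]mulr_natr -[_ *+ 'C(k, j) in RHS]mulr_natr -[X in _ - X]mulr_natr natrM.
  by ring.
rewrite (eq_bigr _ (fun j _ => dterm j)) sumrB [RHS]mxE summxE; congr (_ + _).
rewrite !mxE; congr (- _); case: k {dterm} => [|k].
  by rewrite big_ord1 subnn mul0n mulr0n mulr0n mul0r.
rewrite big_ord_recr /= subnn mul0n mulr0n addr0 -mulr_natr mulr_suml mulr_suml.
apply: eq_bigr => j _.
have -> : ((k.+1 - j) * 'C(k.+1, j) = k.+1 * 'C(k, j))%N by rewrite -mul_bin_down.
rewrite subSn -1?ltnS //= -[LHS]mulr_natr natrM -[_ *+ 'C(k, j)]mulr_natr; ring.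
Qed.

Let cLW : L *m W = W *m L := LW L la.
Let cPW : P *m W = W *m P := PW la aL LP.

Lemma WP_nil k : W ^+ (q.+2 + k) *m P = 0.
Proof. by rewrite addnC exprD -mulmxE -mulmxA -(nu_pow la aL LP PP) nu0 mulmx0. Qed.

Lemma WP_nil0 : W ^+ q.+2 *m P = 0.
Proof. by have := WP_nil 0; rewrite addn0. Qed.

(** At the base point [a] is still cyclic, so it cannot annihilate a non-zero operator commuting
    with [L]. *)
Lemma aPW_neq0 : map_mx ev (a *m P *m W ^+ q.+1) != 0.
Proof.
apply: contra nuq => /eqP h; apply/eqP.
have e0 : map_mx ev a *m map_mx ev (W ^+ q.+1 *m P) = map_mx ev a *m 0.
  rewrite mulmx0 -map_mxM -h; congr (map_mx ev _).
  by rewrite -(PWk la aL LP) mulmxA.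
have evL : map_mx ev (krylov a L) = krylov (map_mx ev a) (map_mx ev L).
  apply/row_matrixP => k; rewrite rowK.
  by rewrite -map_row rowK map_mxM rmorphXn.
apply: (krylov_inj (L := map_mx ev L) _ _ _ e0).
- by rewrite -evL; exact: unitmx_map_ev.
- rewrite -!mulmxE -!map_mxM mulmxA (LWk L la) -!mulmxA LP.
  by [].
- by rewrite mul0r mulr0.
Qed.

Lemma nilpotent_part : exists N, [/\ L *m N = N *m L, N *m P = N, N ^+ q.+2 = 0,
  forall j, symop d L j N = 0 & map_mx ev N = map_mx ev nu].
Proof.
have dlaL := eigenvalue_law DL aL LP PP nu0 nuq.
have [V [V0 dV]] := binomial_potentials.
(* At the base point [dw] equals the top law [a P W^(q+1)], because [V q] vanishes there; in
   particular [dw] is non-zero. *)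
pose w := V q.+1.
have [xi xiP] := cyclic_vector aL.
have [ell ellP] := left_eigenvector la xiP.
have wWE : a *m P *m W ^+ q.+1 *m L = la *: (a *m P *m W ^+ q.+1).
  have LE : L = W + la%:M by rewrite subrK.
  have WW : W ^+ q.+1 *m W = W ^+ q.+2 by rewrite mulmxE -exprSr.
  rewrite [X in _ *m X]LE mulmxDr mul_mx_scalar -[_ *m W]mulmxA WW -[a *m P *m _]mulmxA.
  by rewrite (PWk la aL LP) WP_nil0 mulmx0 add0r.
have dwE : grad d w = a *m P *m W ^+ q.+1 - (V q *+ q.+1) *: grad d la by rewrite /w dV.
have dwL : grad d w *m L = la *: grad d w.
  by rewrite dwE mulmxBl wWE -scalemxAl dlaL scalerBr !scalerA [la * _]mulrC.
pose u := (grad d w *m xi) 0 0.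
have uU : u \is a GRing.unit.
  apply: unitO; apply: contra aPW_neq0 => /eqP u0; apply/eqP.
  have -> : map_mx ev (a *m P *m W ^+ q.+1) = map_mx ev (grad d w).
    rewrite dwE map_mxB map_mxZ rmorphMn /= V0 mul0rn scale0r subr0.
    by [].
  by rewrite (ellP _ dwL) map_mxZ /= -/u u0 scale0r.
(* [c j] is the j-th derivative of [la] with respect to [w]. Both [dla] and [dw] are left
   eigenvectors for [la], hence multiples of [ell], the second by the unit [u]; contraction with
   [xi] reads off the quotient. *)
pose c := fix c j := if j is k.+1 then (grad d (c k) *m xi) 0 0 / u else la.
have dcE j : grad d (c j) = c j.+1 *: grad d w.
  elim: j => [|j IHj].
    rewrite {1}(ellP _ dlaL) [in RHS](ellP _ dwL) scalerA -/u /= divrK //.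
  (* This is [d(c_(j+1) dw) = 0], as [c_(j+1) dw] is the differential of [c_j]; contracting one
     index with [xi] makes the differential of [c_(j+1)] a multiple of [dw]. *)
  have wedge i k : d i (c j.+1) * d k w = d k (c j.+1) * d i w.
    have ei l : d l (c j) = c j.+1 * d l w.
      by have := congr1 (fun A : 'rV[O]_n.+1 => A 0 l) IHj; rewrite !mxE.
    have := dC i k (c j); rewrite !ei !dM (dC i k w) => /addIr; exact.
  have -> : c j.+2 = (grad d (c j.+1) *m xi) 0 0 / u by [].
  move: (c j.+1) wedge => h wedge.
  apply/rowP => i; rewrite mxE [RHS]mxE [grad d w 0 i]mxE; apply: (mulIr uU) => /=.
  rewrite [RHS]mulrAC divrK // /u !mxE mulr_sumr mulr_suml; apply: eq_bigr => k _.
  by rewrite !mxE mulrA wedge; ring.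
have dcE' i j : d i (c j) = c j.+1 * d i w.
  by have := congr1 (fun A : 'rV[O]_n.+1 => A 0 i) (dcE j); rewrite !mxE.
(* [r] will be [1 + c 1 y_0] with [y_0] the constant coefficient of [y]. The radicand is 1 at the
   base point since [V q] vanishes there. *)
have [|r [rE evr]] := @roots q (1 + c 1%N * V q *+ q.+1).
  by rewrite rmorphD rmorph1 rmorphMn rmorphM /= V0 mulr0 mul0rn addr0.
have rU : r \is a GRing.unit by apply: unitO; rewrite evr oner_neq0.
have sU : \sum_(i < q.+1) r ^+ i \is a GRing.unit.
  apply: unitO; rewrite rmorph_sum /=.
  under eq_bigr do rewrite rmorphXn /= evr expr1n.
  by rewrite sumr_const card_ord pnatr_eq0.
have [y [yV yr ye]] := moment_solve natO rU sU rE V0.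
pose nh := nuhat q c y.
pose dZ i : {poly O} := (d i w)%:P + 'X * map_poly (d i) y.
have dVi j i : d i (V j) = (a *m P *m W ^+ j) 0 i - V j.-1 * d i la *+ j.
  have -> : d i (V j) = grad d (V j) 0 i by rewrite mxE.
  by rewrite dV mxE; congr (_ + _); rewrite !mxE -mulrnAl.
have law_pow k i : (a *m P *m W ^+ k) 0 i = (nh ^+ k * dZ i)`_q.+1.
  case: (leqP k q.+1) => kq; last first.
    rewrite -(subnKC kq) -mulmxA (PWk la aL LP) WP_nil mulmx0 mxE.
    by rewrite /nh /nuhat exprMn -mulrA coefXnM ifT // ; lia.
  apply: (@dlaw_nuhat _ q c natO (d i) (d i w) (dM i) _ y V
    (fun k => (a *m P *m W ^+ k) 0 i) (d i la)) => //.
  - by rewrite -[d i la]/(d i (c 0%N)) dcE'.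
  - exact: dVi q.+1 i.
  - by rewrite yr.
(* Dictionary between the block and the model: [W] becomes [nh], and applying [a P] becomes
   multiplication by [dZ] followed by taking the coefficient of [eps^(q+1)]. *)
have law_poly p i : (a *m P *m horner_mx W p) 0 i = ((p \Po nh) * dZ i)`_q.+1.
  rewrite comp_polyE {1}[p](esym (coefK p)) poly_def raddf_sum mulmx_sumr summxE mulr_suml coef_sum.
  apply: eq_bigr => k _; rewrite /= linearZ /= rmorphXn /= horner_mx_X -scalemxAr mxE.
  by rewrite law_pow -scalerAl coefZ.
have [rho [s [rhoE rho0 [s' evrho]]]] := nuhat_inverse q yr rU ye.
have coef_rho p i : ((rho \Po nh) * p * dZ i)`_q.+1 = (p * dZ i)`_q.
  by rewrite rhoE -mulrA mulrDl coefD coefXM -mulrA coefXnM ltnS leqnn addr0.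
(* As [rho] inverts [nh], this operator corresponds to [eps] itself in the model. *)
exists (P *m horner_mx W rho).
have cLN : L *m (P *m horner_mx W rho) = P *m horner_mx W rho *m L.
  rewrite mulmxA LP -!mulmxA; congr (_ *m _).
  exact: comm_mx_horner.
have cPH p : P *m horner_mx W p = horner_mx W p *m P by exact: comm_mx_horner.
have [rho' rhoE'] : exists rho', rho = 'X * rho'.
  exists (\poly_(i < size rho) rho`_i.+1); apply/polyP => -[|i]; rewrite coefXM //=.
  by rewrite coef_poly; case: ltnP => // le; rewrite nth_default // (leq_trans le).
split=> //.
- by rewrite -mulmxA -cPH mulmxA PP.
- rewrite rhoE' rmorphM /= horner_mx_X.
  have -> : P *m (W * horner_mx W rho') = horner_mx W rho' *m nu.
    rewrite -mulmxE mulmxA cPW -mulmxA cPH.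
    rewrite mulmxA /nu mulmxA; congr (_ *m _); exact: comm_mx_horner.
  rewrite mulmxE exprMn_comm ?nu0 ?mulr0 //.
  rewrite /GRing.comm -!mulmxE /nu -[RHS]mulmxA cPH !mulmxA; congr (_ *m _).
  exact/esym/comm_mx_horner.
(* [a N] is the coefficient of [eps^q] in [dZ], a differential. [a N L] is that of [(nh + la) dZ],
   closed because [d(nh + la)] is a multiple of [dZ] up to [eps^(q+1)]. *)
- move=> j; apply: (symop_eq0 dM aL (DL j) ca caL cLN).
    move=> i k; rewrite !mulmxA !law_poly -[rho \Po nh]mulr1 !coef_rho !mul1r /dZ.
    rewrite !coefD !coefC !coefXM; case: (q) => [|q'] /=; first by rewrite !addr0 dC.
    by rewrite !add0r !coef_map /= dC.
  have -> : a *m (P *m horner_mx W rho) *m L = a *m P *m horner_mx W (rho * ('X + la%:P)).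
    rewrite rmorphM rmorphD /= horner_mx_X horner_mx_C -!mulmxA; congr (_ *m (_ *m (_ *m _))).
    by rewrite subrK.
  move=> i k; rewrite !law_poly rmorphM /= !coef_rho comp_polyD comp_polyX comp_polyC.
  have dcoef l (p : {poly O}) : d l p`_q = (map_poly (d l) p)`_q by rewrite coef_map.
  have dnl l : map_poly (d l) (nh + la%:P) = map_poly (d l) nh + (d l la)%:P.
    by rewrite raddfD /= map_polyC.
  rewrite !dcoef !(map_derivationM (dM _)) !dnl.
  have dZC : map_poly (d i) (dZ k) = map_poly (d k) (dZ i).
    rewrite /dZ !raddfD /= !map_polyC /= dC; congr (_ + _).
    rewrite !(map_derivationM (dM _)) !(map_derivation_polyX (dM _)) !mul0r !add0r; congr (_ * _).
    by apply/polyP => l; rewrite !coef_map /= dC.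
  have [r1 E1] := derivation_nuhat q natO (dM i) (c := c) (dw := d i w) (fun j => dcE' i j.+1) y.
  have [r2 E2] := derivation_nuhat q natO (dM k) (c := c) (dw := d k w) (fun j => dcE' k j.+1) y.
  have dla l : d l la = c 1%N * d l w by rewrite -[la]/(c 0%N) dcE'.
  rewrite -/(dZ i) -/nh in E1; rewrite -/(dZ k) -/nh in E2.
  rewrite E1 E2 !dla dZC.
  (* [zi] and [zk] are components of [dZ]. The term [J * zi * zk] is symmetric, which expresses that
     [dZ] wedge [dZ] is zero; the remaining discrepancy carries the factor [x], used with
     ['X^(q.+1)]. *)
  have ringid (J zi zk ci ck x s1 s2 T : {poly O}) :
      (J * zi - ci + x * s1 + ci) * zk + T =
      (J * zk - ck + x * s2 + ck) * zi + T + x * (s1 * zk - s2 * zi) by ring.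
  rewrite (ringid _ _ _ _ (c 1%N * d k w)%:P _ _ r2).
  by rewrite coefD coefXnM ltnSn addr0.
(* At the base point [rho] is ['X] up to a multiple of ['X^(q.+2)], and [W^(q+2) P = 0]. *)
- rewrite map_mxM map_horner_mx evrho rmorphD rmorphM /= horner_mx_X rmorphXn /= horner_mx_X.
  have PW0 : map_mx ev P *m map_mx ev W ^+ q.+2 = 0.
    by rewrite -rmorphXn -map_mxM (PWk la aL LP) WP_nil0 map_mx0.
  by rewrite mulmxDr -mulmxE mulmxA PW0 mul0mx addr0 -map_mxM cPW.
Qed.

End NilpotentPart.
End Block.

(** * The flat operator *)

Section Flat.
Context {C : numFieldType} {n : nat} {O : comUnitRingType}.
Context (d : 'I_n.+1 -> {additive O -> O}) (ev : {rmorphism O -> C}).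
Hypothesis dM : forall j x y, d j (x * y) = d j x * y + x * d j y.
Hypothesis dC : forall i j x, d i (d j x) = d j (d i x).
Hypothesis unitO : forall x, ev x != 0 -> x \is a GRing.unit.
Hypothesis poincare : forall al : 'rV[O]_n.+1, closed d al ->
  exists U, ev U = 0 /\ grad d U = al.
Hypothesis roots : forall k T, ev T = 1 -> exists r, r ^+ k.+1 = T /\ ev r = 1.
Context (cst : {rmorphism C -> O}).
Hypothesis cstK : forall z, ev (cst z) = z.
Hypothesis d_cst : forall j z, d j (cst z) = 0.
Hypothesis reduced : forall x k, x ^+ k = 0 :> O -> x = 0.
Context (cj : {rmorphism O -> O}) (cjC : {rmorphism C -> C}).
Hypothesis d_cj : forall j x, d j (cj x) = cj (d j x).
Hypothesis ev_cj : forall x, ev (cj x) = cjC (ev x).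
Hypothesis cj_cst : forall z, cj (cst z) = cst (cjC z).
Hypothesis cjK : involutive cj.

Context (L : 'M[O]_n.+1) (a : 'rV[O]_n.+1).
Hypothesis DL : forall j, symop d L j L = 0.
Hypothesis ca : closed d a.
Hypothesis caL : closed d (a *m L).
Hypothesis aL : krylov a L \in unitmx.
Context (s : nat) (m : 'I_s -> nat) (la : 'I_s -> O).
Hypothesis m_gt0 : forall b, (0 < m b)%N.
Hypothesis chiE : char_poly L = \prod_(b < s) ('X - (la b)%:P) ^+ m b.
Hypothesis la_inj : injective (fun b => ev (la b)).

Let chi := char_poly L.
Local Notation H := (horner_mx L).

Definition cofactor_poly b : {poly O} := \prod_(i < s | i != b) ('X - (la i)%:P) ^+ m i.

(** Chinese remainder idempotent. The scaled cofactor [u] equals 1 at [la b], so [(1 - u)^(m b)] is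
    divisible by the full factor of [la b], while [1 - (1 - u)^(m b)] is divisible by the
    cofactor. *)
Definition idem_poly b : {poly O} :=
  1 - (1 - ((cofactor_poly b).[la b])^-1 *: cofactor_poly b) ^+ m b.

Definition proj b : 'M[O]_n.+1 := H (idem_poly b).

Lemma Hchi : H chi = 0. Proof. exact: Cayley_Hamilton. Qed.

Lemma chi_cofactor b : chi = ('X - (la b)%:P) ^+ m b * cofactor_poly b.
Proof. by rewrite /chi chiE (bigD1 b). Qed.

Lemma cofactor_unit b : (cofactor_poly b).[la b] \is a GRing.unit.
Proof.
apply: unitO; rewrite horner_prod rmorph_prod; apply/prodf_neq0 => i ib.
rewrite horner_exp hornerXsubC rmorphXn rmorphB /= expf_neq0 // subr_eq0.
by apply: contra ib => /eqP/la_inj->.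
Qed.

Lemma idem_poly_cofactor b : exists q, idem_poly b = cofactor_poly b * q.
Proof.
rewrite /idem_poly; set u := _ *: _.
exists (((cofactor_poly b).[la b])^-1 *: \sum_(i < m b) (1 - u) ^+ i).
rewrite -scalerAr scalerAl -/u.
by have := subrX1 (1 - u) (m b); rewrite addrAC subrr sub0r => /(congr1 -%R); rewrite opprB mulNr opprK.
Qed.

Lemma idem_polyN b : exists q, 1 - idem_poly b = ('X - (la b)%:P) ^+ m b * q.
Proof.
rewrite /idem_poly subKr; set u := _ *: _.
have /factor_theorem[q ->] : root (1 - u) (la b).
  by rewrite /root /u !hornerE mulVr ?cofactor_unit // subrr.
by exists (q ^+ m b); rewrite mulrC exprMn.
Qed.

Lemma comm_H p : L *m H p = H p *m L.
Proof. exact: comm_mx_horner. Qed.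

Lemma comm_proj b : L *m proj b = proj b *m L.
Proof. exact: comm_H. Qed.

Lemma projM b : proj b *m proj b = proj b.
Proof.
have [q1 e1] := idem_poly_cofactor b; have [q2 e2] := idem_polyN b.
apply/eqP; rewrite eq_sym -subr_eq0 -{1}[proj b]mulmx1 -mulmxBr; apply/eqP.
have -> : 1%:M - proj b = H (1 - idem_poly b).
  by rewrite -[1%:M]/(1 : 'M[O]_n.+1) rmorphB rmorph1.
rewrite /proj mulmxE -rmorphM e2 e1.
have -> : cofactor_poly b * q1 * (('X - (la b)%:P) ^+ m b * q2) = chi * (q1 * q2).
  by rewrite (chi_cofactor b); ring.
by rewrite rmorphM /= Hchi mul0r.
Qed.

Lemma proj_orth b c : b != c -> proj b *m proj c = 0.
Proof.
move=> bc.
have [q1 e1] := idem_poly_cofactor b; have [q2 e2] := idem_poly_cofactor c.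
rewrite /proj mulmxE -rmorphM e1 e2.
have -> : cofactor_poly b = ('X - (la c)%:P) ^+ m c *
    \prod_(i < s | (i != b) && (i != c)) ('X - (la i)%:P) ^+ m i.
  by rewrite /cofactor_poly (bigD1 c) //= eq_sym.
set r := \prod_(i < s | _) _.
have -> : ('X - (la c)%:P) ^+ m c * r * q1 * (cofactor_poly c * q2) = chi * (r * q1 * q2).
  by rewrite (chi_cofactor c); ring.
by rewrite rmorphM /= Hchi mul0r.
Qed.

(** The complement [Q] is fixed by every [1 - proj b], hence by their product, which is a multiple
    of [chi] evaluated at [L] and so vanishes. *)
Lemma sum_proj : \sum_b proj b = 1%:M.
Proof.
pose Q := 1%:M - \sum_b proj b.
have PS b : proj b *m (\sum_c proj c) = proj b.
  rewrite mulmx_sumr (bigD1 b) //= projM big1 ?addr0 // => c cb.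
  by rewrite proj_orth // eq_sym.
have QP b : (1%:M - proj b) *m Q = Q.
  have PQ : proj b *m Q = 0 by rewrite /Q mulmxBr mulmx1 PS subrr.
  by rewrite mulmxBl mul1mx PQ subr0.
have prodQ : H (\prod_b (1 - idem_poly b)) *m Q = Q.
  rewrite rmorph_prod mulmxE; elim/big_ind: _ => [|x y ex ey|b _].
  - by rewrite mul1r.
  - by rewrite -mulrA ey ex.
  - by rewrite rmorphB rmorph1 -mulmxE; exact: QP.
have [q qE] : exists q, \prod_b (1 - idem_poly b) = chi * q.
  rewrite /chi chiE; elim/big_ind2: _ => [|x y x' y' [q1 ->] [q2 ->]|b _].
  - by exists 1; rewrite mulr1.
  - by exists (q1 * q2); ring.
  - by have [q qE] := idem_polyN b; exists q.
by apply/eqP; rewrite eq_sym -subr_eq0 -/Q -prodQ qE rmorphM /= Hchi mul0r mul0mx.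
Qed.

Lemma comm_scalarB M x : L *m M = M *m L -> L *m (M - x%:M) = (M - x%:M) *m L.
Proof. by move=> LM; rewrite mulmxBr mulmxBl LM scalar_mxC. Qed.

Lemma proj_nil b : (L - (la b)%:M) ^+ m b *m proj b = 0.
Proof.
have -> : L - (la b)%:M = H ('X - (la b)%:P) by rewrite rmorphB /= horner_mx_X horner_mx_C.
have [q qE] := idem_poly_cofactor b.
by rewrite -rmorphXn mulmxE -rmorphM qE mulrA -chi_cofactor rmorphM /= Hchi mul0r.
Qed.

Lemma proj_powE M b x k : L *m M = M *m L ->
  ((M - x%:M) *m proj b) ^+ k.+1 = (M - x%:M) ^+ k.+1 *m proj b.
Proof.
move=> LM; elim: k => [|k IHk]; first by rewrite !expr1.
have cMP := comm_cyclic aL (comm_scalarB x LM) (comm_proj b).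
by rewrite exprSr IHk -mulmxE -!mulmxA (mulmxA (proj b)) -cMP -!mulmxA projM !mulmxA mulmxE -exprSr.
Qed.

Lemma ev_krylov : map_mx ev (krylov a L) = krylov (map_mx ev a) (map_mx ev L).
Proof.
apply/row_matrixP => k; rewrite rowK.
by rewrite -map_row rowK map_mxM rmorphXn.
Qed.

(** Otherwise [h], the quotient of [chi] by ['X - (la b)%:P], would annihilate [L] at the base
    point, since it already vanishes on the other blocks. A monic polynomial of degree [n] cannot do
    so, the Krylov rows being independent. *)
Lemma proj_top b : map_mx ev ((L - (la b)%:M) ^+ (m b).-1 *m proj b) != 0.
Proof.
pose h := ('X - (la b)%:P) ^+ (m b).-1 * cofactor_poly b.
have hchi : h * ('X - (la b)%:P) = chi.
  by rewrite (chi_cofactor b) /h -[in RHS](prednK (m_gt0 b)) exprS; ring.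
have hsize : size (map_poly ev h) = n.+1.
  have hm : h \is monic.
    rewrite /h rpredM ?rpredX ?monicXsubC // /cofactor_poly.
    by apply: monic_prod => i _; rewrite rpredX ?monicXsubC.
  have := congr1 (fun p : {poly O} => size p) hchi.
  rewrite (size_monicM hm) ?polyXsubC_eq0 // size_XsubC addn2 /= size_char_poly => -[<-].
  by rewrite size_map_poly_id0 // (monicP hm) rmorph1 oner_neq0.
have hP : H h = H (cofactor_poly b) *m ((L - (la b)%:M) ^+ (m b).-1 *m proj b).
  rewrite -[LHS]mulmx1 -sum_proj mulmx_sumr (bigD1 b) //= big1 ?addr0 => [|c cb].
    have -> : L - (la b)%:M = H ('X - (la b)%:P) by rewrite rmorphB /= horner_mx_X horner_mx_C.
    by rewrite -rmorphXn /= mulmxA; congr (_ *m _); rewrite mulmxE -rmorphM mulrC.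
  have [q qE] := idem_poly_cofactor c.
  rewrite /proj mulmxE -rmorphM qE.
  have -> : h * (cofactor_poly c * q) = chi * (('X - (la b)%:P) ^+ (m b).-1 *
      \prod_(i < s | (i != b) && (i != c)) ('X - (la i)%:P) ^+ m i * q).
    by rewrite (chi_cofactor c) /h {1}/cofactor_poly (bigD1 c) //=; ring.
  by rewrite rmorphM /= Hchi mul0r.
apply/negP => /eqP e0.
have : map_mx ev (H h) = 0 by rewrite hP map_mxM e0 mulmx0.
rewrite map_horner_mx => /(krylov_poly_eq0 (a := map_mx ev a)) h0.
have := h0; rewrite -ev_krylov unitmx_map_ev // hsize leqnn => /(_ isT isT) hz.
by move: hsize; rewrite hz size_poly0.
Qed.

Lemma proj_neq0 b : map_mx ev (proj b) != 0.
Proof. by apply: contra (proj_top b) => /eqP e; rewrite map_mxM e mulmx0. Qed.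

(** A simple eigenvalue has nilpotent part 0; otherwise [m b = q + 2], the shape treated by
    [nilpotent_part]. *)
Lemma nilpotent_block b : exists N, [/\ L *m N = N *m L, N *m proj b = N,
  N ^+ m b = 0, forall j, symop d L j N = 0 &
  map_mx ev N = map_mx ev ((L - (la b)%:M) *m proj b)].
Proof.
have := proj_nil b; have := proj_top b; have := m_gt0 b.
case: (m b) => [//|[|q]] _ /= top nil.
  exists 0; split; rewrite ?mulmx0 ?mul0mx ?expr1 //; first by move=> j; exact: symop0.
  by rewrite -[L - _]expr1 nil.
apply: (nilpotent_part dM dC unitO poincare roots DL ca caL aL (comm_proj b) (projM b) _ top).
by rewrite proj_powE.
Qed.

Let lam b : O := cst (ev (la b)).
(** [chi] with its coefficients evaluated at the base point and put back into [O] as constants. *)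
Let chi0 : {poly O} := map_poly cst (map_poly ev chi).

Lemma chi0E : chi0 = \prod_(b < s) ('X - (lam b)%:P) ^+ m b.
Proof.
rewrite /chi0 /chi chiE !rmorph_prod /=; apply: eq_bigr => b _.
by rewrite !rmorphXn /= !rmorphB /= !map_polyX !map_polyC.
Qed.

Lemma eq_on_blocks (M N : 'M[O]_n.+1) : (forall b, M *m proj b = N *m proj b) -> M = N.
Proof.
by move=> h; rewrite -[M]mulmx1 -[N]mulmx1 -sum_proj !mulmx_sumr; apply: eq_bigr => b _.
Qed.

Lemma chi0_blocks M : L *m M = M *m L ->
  (forall b, ((M - (lam b)%:M) *m proj b) ^+ m b = 0) -> horner_mx M chi0 = 0.
Proof.
move=> LM Mn; apply: eq_on_blocks => b; rewrite mul0mx.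
rewrite chi0E (bigD1 b) //= mulrC rmorphM rmorphXn rmorphB /= horner_mx_X horner_mx_C.
rewrite -mulmxE -mulmxA; have := Mn b; rewrite -(prednK (m_gt0 b)) proj_powE //= => ->.
by rewrite mulmx0.
Qed.

Lemma proj_block_eq0 b (x : O) k : x ^+ k *: proj b = 0 -> x = 0.
Proof.
have [i [j u]] := map_ev_neq0 unitO (proj_neq0 b).
move=> /(congr1 (fun A : 'M[O]_n.+1 => A i j)); rewrite mxE [RHS]mxE => e.
by apply: (reduced (k := k)); apply: (mulIr u) => /=; rewrite mul0r.
Qed.

(* In the block b a matrix commuting with L is a scalar x plus a multiple of the
   nilpotent part; chi0 M = 0 makes x a root of chi0, and x = lam b as ev M = ev L. *)
Lemma block_scalar M b : L *m M = M *m L -> horner_mx M chi0 = 0 ->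
  map_mx ev M = map_mx ev L -> exists h : 'M[O]_n.+1, L *m h = h *m L /\
  (M - (lam b)%:M) *m proj b = (L - (la b)%:M) *m proj b *m h.
Proof.
move=> LM chiM evM.
have [p Mp] := comm_horner_mx_ex aL LM.
pose x := p.[la b].
have /factor_theorem[t tE] : root (p - x%:P) (la b) by rewrite /root !hornerE subrr.
have cLL : L *m L = L *m L by [].
have LlaC := comm_scalarB (la b) cLL.
have Mx : (M - x%:M) *m proj b = (L - (la b)%:M) *m proj b *m H t.
  have -> : M - x%:M = H (p - x%:P) by rewrite rmorphB /= horner_mx_C Mp.
  rewrite tE rmorphM rmorphB /= horner_mx_X horner_mx_C -!mulmxE.
  rewrite (comm_cyclic aL (comm_H t) LlaC) -!mulmxA; congr (_ *m _).
  exact: comm_cyclic aL (comm_H t) (comm_proj b).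
suff xlam : x = lam b by exists (H t); rewrite -xlam; split; [exact: comm_H | exact: Mx].
have cPt : L *m ((L - (la b)%:M) *m proj b) = (L - (la b)%:M) *m proj b *m L.
  by rewrite mulmxA LlaC -!mulmxA comm_proj.
have nilM (h : 'M[O]_n.+1) : L *m h = h *m L ->
    ((L - (la b)%:M) *m proj b *m h) ^+ m b = 0.
  move=> Lh; rewrite mulmxE exprMn_comm; last first.
    by rewrite /GRing.comm -!mulmxE; exact: comm_cyclic aL cPt Lh.
  by rewrite -[(m b)](prednK (m_gt0 b)) proj_powE // prednK // proj_nil mul0r.
have Pk k : proj b ^+ k.+1 = proj b.
  by elim: k => // k IHk; rewrite exprS IHk -mulmxE projM.
have scaleP y (h : 'M[O]_n.+1) : L *m h = h *m L -> y *: proj b = (L - (la b)%:M) *m proj b *m h ->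
    y ^+ m b *: proj b = 0.
  move=> Lh e; have := nilM h Lh; rewrite -e exprZn.
  by rewrite -[X in proj b ^+ X](prednK (m_gt0 b)) Pk.
(* At the base point [M = L], so [x - la b] acts on the block as a nilpotent matrix; being a scalar
   of a field, it is zero. *)
have evx : ev x = ev (la b).
  apply/eqP; rewrite -subr_eq0 -rmorphB.
  pose h := 1%:M - H t.
  have Lh : L *m h = h *m L by rewrite /h mulmxBr mulmxBl mulmx1 mul1mx comm_H.
  have e : (x - la b) *: proj b - (M - L) *m proj b = (L - (la b)%:M) *m proj b *m h.
    rewrite /h mulmxBr mulmx1 -Mx !mulmxBl !mul_scalar_mx scalerBl; mxabel.
  have e2 : map_mx ev ((x - la b) *: proj b) = map_mx ev ((L - (la b)%:M) *m proj b *m h).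
    by rewrite -e map_mxB map_mxM map_mxB evM subrr mul0mx subr0.
  have := nilM h Lh => /(congr1 (map_mx ev)); rewrite rmorphXn /= -e2 map_mxZ exprZn map_mx0.
  have -> : map_mx ev (proj b) ^+ m b = map_mx ev (proj b).
    by case: (m b) (m_gt0 b) => // k _; rewrite -rmorphXn /= Pk.
  move=> /eqP.
  rewrite scaler_eq0 (negPf (proj_neq0 b)) orbF expf_eq0 => /andP[_ //].
(* [chi0 M = 0] exhibits [chi0.[x]] times the projector as a multiple of the nilpotent part; a power
   of [chi0.[x]] therefore vanishes, and [O] is reduced. *)
have chi0x : chi0.[x] = 0.
  have /factor_theorem[T TE] : root (chi0 - chi0.[x]%:P) x by rewrite /root !hornerE subrr.
  have LT : L *m horner_mx M T = horner_mx M T *m L by exact: comm_mx_horner.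
  apply: (@proj_block_eq0 b _ (m b)); apply: (scaleP _ (- (H t *m horner_mx M T))).
    by rewrite mulmxN mulNmx mulmxA comm_H -mulmxA LT mulmxA.
  have e : horner_mx M (chi0 - chi0.[x]%:P) = - chi0.[x]%:M.
    by rewrite rmorphB /= chiM horner_mx_C sub0r.
  have -> : chi0.[x] *: proj b = - (horner_mx M (chi0 - chi0.[x]%:P) *m proj b).
    by rewrite e mulNmx opprK mul_scalar_mx.
  rewrite mulmxN mulmxA -Mx TE rmorphM rmorphB /= horner_mx_X horner_mx_C.
  rewrite -mulmxE -mulmxA; congr (- _).
  apply: (comm_cyclic aL LT); rewrite mulmxA comm_scalarB // -!mulmxA; congr (_ *m _).
  exact: comm_proj.
(* At [x] the factors of the other eigenvalues are units, by [evx] and [la_inj], so a power of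
   [x - lam b] is zero. *)
move: chi0x; rewrite chi0E (bigD1 b) //= hornerM => e.
have uU : (\prod_(i < s | i != b) ('X - (lam i)%:P) ^+ m i).[x] \is a GRing.unit.
  apply: unitO; rewrite horner_prod rmorph_prod; apply/prodf_neq0 => i ib.
  rewrite horner_exp hornerXsubC rmorphXn rmorphB /= /lam cstK evx expf_neq0 // subr_eq0.
  by apply: contra ib => /eqP/la_inj->.
have := mulIr uU (etrans e (esym (mul0r _))); rewrite horner_exp hornerXsubC => /reduced/eqP.
by rewrite subr_eq0 => /eqP.
Qed.

Lemma chi0_block_nil M h b : L *m M = M *m L -> L *m h = h *m L ->
  (M - (lam b)%:M) *m proj b = (L - (la b)%:M) *m proj b *m h ->
  ((M - (lam b)%:M) *m proj b) ^+ m b = 0.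
Proof.
move=> LM Lh ->.
have cLL : L *m L = L *m L by [].
have LlaC := comm_scalarB (la b) cLL.
have cPt : L *m ((L - (la b)%:M) *m proj b) = (L - (la b)%:M) *m proj b *m L.
  by rewrite mulmxA LlaC -!mulmxA comm_proj.
rewrite mulmxE exprMn_comm; last first.
  by rewrite /GRing.comm -!mulmxE; exact: comm_cyclic aL cPt Lh.
by rewrite -[(m b)](prednK (m_gt0 b)) proj_powE // prednK // proj_nil mul0r.
Qed.

(** The eigenvalues are frozen: [lam b *: proj b] lies in Sym [L] because [lam b] is constant, and
    [N b] supplies a nilpotent part with the correct value at the base point. *)
Lemma flat_operator_complex : exists M : 'M[O]_n.+1, [/\ L *m M = M *m L,
  forall j, symop d L j M = 0, horner_mx M chi0 = 0 & map_mx ev M = map_mx ev L].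
Proof.
have /fin_all_exists[N NP] := nilpotent_block.
exists (\sum_b (lam b *: proj b + N b)).
have cM : L *m (\sum_b (lam b *: proj b + N b)) = (\sum_b (lam b *: proj b + N b)) *m L.
  rewrite mulmx_sumr mulmx_suml; apply: eq_bigr => b _.
  have [cN _ _ _ _] := NP b.
  by rewrite mulmxDr mulmxDl -scalemxAr -scalemxAl comm_proj cN.
split=> // [j||].
- elim/big_ind: _ => [|x y ex ey|b _]; first exact: symop0.
    by rewrite symopD ex ey addr0.
  have [_ _ _ DN _] := NP b.
  rewrite symopD DN addr0 (symop_scale dM) (symop_projector dM DL aL (comm_proj b) (projM b)).
  rewrite d_cst scale0r subr0 scaler0 add0r.
  have -> : grad d (lam b) = 0 by apply/rowP => i; rewrite !mxE d_cst.
  by rewrite mul0mx mxE scale0r.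
- apply: chi0_blocks => // b.
  have [_ NPb Nm _ _] := NP b.
  suff -> : (\sum_c (lam c *: proj c + N c) - (lam b)%:M) *m proj b = N b by [].
  rewrite mulmxBl mulmx_suml (bigD1 b) //= big1 => [|c cb].
    by rewrite addr0 mulmxDl -scalemxAl projM NPb mul_scalar_mx addrAC subrr add0r.
  have [_ NPc _ _ _] := NP c.
  by rewrite mulmxDl -scalemxAl -NPc -mulmxA proj_orth // scaler0 mulmx0 addr0.
- rewrite raddf_sum -[in RHS](mulmx1 L) -sum_proj mulmx_sumr [RHS]raddf_sum.
  apply: eq_bigr => b _; have [_ _ _ _ evN] := NP b.
  rewrite /= map_mxD map_mxZ evN map_mxM map_mxB map_scalar_mx /= /lam cstK mulmxBl mul_scalar_mx.
  by rewrite map_mxM addrC subrK.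
Qed.

Lemma symop_cj j M : map_mx cj L = L -> map_mx cj (symop d L j M) = symop d L j (map_mx cj M).
Proof.
move=> cjL.
have dmxc p q (A : 'M[O]_(p, q)) k : dmx d k (map_mx cj A) = map_mx cj (dmx d k A).
  by apply/matrixP => x y; rewrite !mxE d_cj.
have gc : map_mx cj (gmx d L j) = gmx d L j.
  by apply/matrixP => x y; rewrite !mxE -d_cj -[in RHS]cjL mxE.
have dc : map_mx cj (dalong d L j M) = dalong d L j (map_mx cj M).
  rewrite /dalong raddf_sum; apply: eq_bigr => k _ /=.
  by rewrite map_mxZ dmxc -[in RHS]cjL mxE.
by rewrite /symop !(map_mxB, map_mxD) !map_mxM dc gc cjL dmxc.
Qed.

(** The mean of [M] and its conjugate is real, but being annihilated by [chi0] is not a linear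
    condition. [block_scalar] turns it into one: on each block both operators are the same constant
    [lam b] plus a multiple of the nilpotent part of [L], and their mean is again of this form. *)
Theorem flat_operator : map_mx cj L = L -> exists M : 'M[O]_n.+1,
  [/\ L *m M = M *m L, forall j, symop d L j M = 0, horner_mx M chi0 = 0,
     map_mx ev M = map_mx ev L & map_mx cj M = M].
Proof.
move=> cjL; have [M [cM DM chiM evM]] := flat_operator_complex.
pose M' := map_mx cj M.
have cM' : L *m M' = M' *m L by rewrite /M' -{1}cjL -{2}cjL -!map_mxM cM.
have cjchi0 : map_poly cj chi0 = chi0.
  have cjchi : map_poly cj chi = chi by rewrite /chi map_char_poly cjL.
  rewrite /chi0 -[in RHS]cjchi -!map_poly_comp; apply: eq_map_poly => z /=.
  by rewrite cj_cst ev_cj.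
have chiM' : horner_mx M' chi0 = 0.
  by rewrite /M' -{1}cjchi0 -map_horner_mx chiM map_mx0.
have evM' : map_mx ev M' = map_mx ev L.
  rewrite -{1}cjL /M'; apply/matrixP => i j; rewrite !mxE !ev_cj.
  by have /matrixP/(_ i j) := evM; rewrite !mxE => ->.
have U2 : 2%:R \is a @GRing.unit O by apply: unitO; rewrite rmorph_nat pnatr_eq0.
pose Q := 2%:R^-1 *: (M + M').
have cQ : L *m Q = Q *m L by rewrite -scalemxAr -scalemxAl mulmxDr mulmxDl cM cM'.
have half x : 2%:R^-1 * x + 2%:R^-1 * x = x :> O.
  by apply: (mulrI U2); rewrite mulrDr !mulrA mulrV //; ring.
have halfC : 2%:R^-1 = cst 2%:R^-1 :> O.
  by apply: (mulrI U2); rewrite mulrV // -(rmorph_nat cst) -rmorphM divff ?rmorph1 ?pnatr_eq0.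
exists Q; split=> // [j|||].
- rewrite /Q (symop_scale dM) symopD DM -(symop_cj j M cjL) DM map_mx0 addr0 scaler0 add0r.
  rewrite halfC d_cst scale0r subr0.
  have -> : grad d (cst 2%:R^-1) = 0 by apply/rowP => i; rewrite !mxE d_cst.
  by rewrite mul0mx mxE scale0r.
- apply: chi0_blocks => // b.
  have [h [Lh e]] := block_scalar b cM chiM evM.
  have [h' [Lh' e']] := block_scalar b cM' chiM' evM'.
  apply: (chi0_block_nil (h := 2%:R^-1 *: (h + h')) cQ).
    by rewrite -scalemxAr -scalemxAl mulmxDr mulmxDl Lh Lh'.
  rewrite -scalemxAr mulmxDr -e -e' -mulmxDl scalemxAl; congr (_ *m _).
  by apply/matrixP => i j; rewrite !mxE -{1}[lam b *+ _]half; ring.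
- by rewrite /Q map_mxZ map_mxD evM evM'; apply/matrixP => i j; rewrite !mxE -rmorphD -rmorphM mulrDr half.
- have cjh : cj 2%:R^-1 = 2%:R^-1 by rewrite halfC cj_cst fmorphV rmorph_nat.
  rewrite /Q map_mxZ map_mxD cjh /M' addrC.
  suff -> : map_mx cj (map_mx cj M) = M by [].
  by apply/matrixP => i j; rewrite !mxE cjK.
Qed.

End Flat.

Local Open Scope classical_set_scope.
Local Open Scope ring_scope.

(** * Calculus of smooth functions *)

Section CkClosure.
Context {R : realType} {V : normedModType R}.
Implicit Types (U : set V).

Lemma near_open U (P : V -> Prop) x : open U -> U x -> (forall y, U y -> P y) ->
  \forall y \near x, P y.
Proof.
move=> oU Ux UP; have : nbhs x U by exact: open_nbhs_nbhs.
by apply: filterS => y /UP.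
Qed.

(** Turns little-o statements into explicit inequalities for a candidate differential, the form in
    which later estimates arrive. *)
Lemma differentiable_le (W : normedModType R) (f : V -> W) x :
  differentiable f x <-> exists2 l : {linear V -> W}, continuous l &
    forall e, 0 < e -> \forall h \near 0, `|f (h + x) - (f x + l h)| <= e * `|h|.
Proof.
split=> [df|[l lc lE]].
  exists ('d f x); first exact: diff_continuous.
  by move/diff_locallyP: df => [_ /eqaddoP].
have E : f \o shift x = cst (f x) + l +o_ 0 id by apply/eqaddoP.
by apply/diff_locallyP; rewrite (diff_unique lc E).
Qed.

Lemma diff_le (W : normedModType R) (f : V -> W) x (l : {linear V -> W}) :
  continuous l ->
  (forall e, 0 < e -> \forall h \near 0, `|f (h + x) - (f x + l h)| <= e * `|h|) ->
  'd f x = l :> (V -> W).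
Proof. by move=> lc lE; apply: diff_unique => //; apply/eqaddoP. Qed.

Lemma differentiable_near_eq (W : normedModType R) (f g : V -> W) x :
  (\forall y \near x, f y = g y) -> differentiable f x -> differentiable g x.
Proof.
move=> fg /differentiable_le[l lc lE]; apply/differentiable_le; exists l => // e e0.
have fgx : f x = g x by exact: nbhs_singleton fg.
have fg0 : \forall h \near 0, f (h + x) = g (h + x).
  by have := fg; rewrite (near_shift 0) /= subr0.
near=> h; have <- : f (h + x) = g (h + x) by near: h.
by rewrite -fgx; near: h; exact: lE.
Unshelve. all: by end_near. Qed.

Lemma Ck_eq (W : normedModType R) k U (f g : V -> W) : open U ->
  (forall x, U x -> f x = g x) -> Ck k U f -> Ck k U g.
Proof.
move=> oU; elim: k f g => [|k IHk] f g fg /=.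
  move=> fc x Ux; have fgx : \forall y \near x, f y = g y by exact: near_open Ux fg.
  rewrite /prop_for /continuous_at -(fg x Ux); apply: cvg_trans (fc x Ux).
  exact: near_eq_cvg.
move=> [df Cf]; split=> [x Ux|v].
  by apply: differentiable_near_eq (df x Ux); exact: near_open Ux fg.
apply: IHk (Cf v) => x Ux; apply: near_eq_derive.
exact: near_open Ux fg.
Qed.

Lemma Ck_le (W : normedModType R) k U (f : V -> W) : Ck k.+1 U f -> Ck k U f.
Proof.
elim: k f => [|k IHk] f /= [df Cf].
  by move=> x Ux; apply: differentiable_continuous; exact: df.
by split=> // v; apply: IHk.
Qed.

Lemma Ck_sub (W : normedModType R) k U U' (f : V -> W) : U' `<=` U -> Ck k U f -> Ck k U' f.
Proof.
move=> UU; elim: k f => [|k IHk] f /=; first by move=> h x /UU; exact: h.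
by move=> [df Cf]; split=> [x /UU|v]; [exact: df | exact: IHk].
Qed.

Lemma Ck_local (W : normedModType R) k U (f : V -> W) :
  (forall x, U x -> exists U', [/\ U' x & Ck k U' f]) -> Ck k U f.
Proof.
elim: k f => [|k IHk] f /= h.
  by move=> x /h[U' [U'x]]; apply.
split=> [x /h[U' [U'x [df _]]]|v]; first exact: df.
by apply: IHk => x /h[U' [U'x [_ Cf]]]; exists U'.
Qed.

Lemma Ck_cst (W : normedModType R) k U (c : W) : Ck k U (cst c : V -> W).
Proof.
elim: k c => [|k IHk] c /=; first by move=> x _; exact: cvg_cst.
split=> [x _|v]; first exact: differentiable_cst.
have -> : (fun x => 'D_v (cst c : V -> W) x) = cst 0 by apply/funext => x; exact: derive_cst.
exact: IHk.
Qed.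

Lemma CkD (W : normedModType R) k U (f g : V -> W) : open U ->
  Ck k U f -> Ck k U g -> Ck k U (fun x => f x + g x).
Proof.
move=> oU; elim: k f g => [|k IHk] f g /=.
  by move=> cf cg x Ux; apply: cvgD; [exact: cf | exact: cg].
move=> [df Cf] [dg Cg]; split=> [x Ux|v].
  by apply: differentiableD; [exact: df | exact: dg].
apply: (Ck_eq oU _ (IHk _ _ (Cf v) (Cg v))) => x Ux.
by rewrite [RHS]deriveD //; apply: diff_derivable; [exact: df | exact: dg].
Qed.

Lemma Ck_linear (W W' : normedModType R) k U (l : {linear W -> W'}) (f : V -> W) :
  open U -> continuous l -> Ck k U f -> Ck k U (fun x => l (f x)).
Proof.
move=> oU lc; elim: k f => [|k IHk] f /=.
  by move=> cf x Ux; apply: continuous_comp; [exact: cf | exact: lc].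
move=> [df Cf]; split=> [x Ux|v].
  apply: (differentiable_comp (df x Ux)); exact: linear_differentiable.
apply: (Ck_eq oU _ (IHk _ (Cf v))) => x Ux.
have dl : differentiable l (f x) by exact: linear_differentiable.
rewrite [RHS]deriveE; last exact: (differentiable_comp (df x Ux)).
rewrite (deriveE _ (df x Ux)).
have e : 'd (l \o f) x = 'd l (f x) \o 'd f x :> (V -> W') by exact: diff_comp (df x Ux) dl.
have e2 : 'd l (f x) = l :> (W -> W') by exact: diff_lin.
by rewrite -[RHS]/('d (l \o f) x v) e /= e2.
Qed.

Lemma Ck_scale (W : normedModType R) k U (f : V -> R) (w : W) : open U ->
  Ck k U f -> Ck k U (fun x => f x *: w).
Proof.
move=> oU; elim: k f => [|k IHk] f /=.
  by move=> cf x Ux; apply: cvgZr_tmp; exact: cf.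
move=> [df Cf]; split=> [x Ux|v].
  by apply: differentiableZl; exact: df.
apply: (Ck_eq oU _ (IHk _ (Cf v))) => x Ux.
rewrite [RHS]deriveE; last by apply: differentiableZl; exact: df.
by rewrite diffZl ?deriveE //; exact: df.
Qed.

Lemma CkM k U (f g : V -> R) : open U ->
  Ck k U f -> Ck k U g -> Ck k U (fun x => f x * g x).
Proof.
move=> oU; elim: k f g => [|k IHk] f g.
  by move=> cf cg x Ux; apply: cvgM; [exact: cf | exact: cg].
move=> Cf1 Cg1; have Cf0 := Ck_le Cf1; have Cg0 := Ck_le Cg1.
case: Cf1 Cg1 => [df Cf] [dg Cg]; split=> [x Ux|v].
  by apply: differentiableM; [exact: df | exact: dg].
apply: (Ck_eq oU _ (CkD oU (IHk _ _ Cf0 (Cg v)) (IHk _ _ (Cf v) Cg0))) => x Ux.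
rewrite [RHS]deriveM; [|by apply: diff_derivable; exact: df|by apply: diff_derivable; exact: dg].
by rewrite /GRing.scale /= [g x * _]mulrC.
Qed.

Lemma CkV k U (f : V -> R) : open U -> (forall x, U x -> f x != 0) ->
  Ck k U f -> Ck k U (fun x => (f x)^-1).
Proof.
move=> oU f0; elim: k => [|k IHk] /=.
  by move=> cf x Ux; apply: cvgV; [exact: f0 | exact: cf].
move=> Cf1; have Cf0 : Ck k U f by exact: Ck_le Cf1.
case: Cf1 => df Cf; split=> [x Ux|v].
  by apply: differentiableV; [exact: df | exact: f0].
have C2 := CkM oU (CkM oU (IHk Cf0) (IHk Cf0)) (CkM oU (Ck_cst k U (-1 : R)) (Cf v)).
apply: (Ck_eq oU _ C2) => x Ux.
rewrite [RHS]deriveV ?f0 //; last by apply: diff_derivable; exact: df.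
by rewrite /GRing.scale /= expr2 invfM /cst mulN1r mulrN mulNr.
Qed.

End CkClosure.

Section MatrixFunctions.
Context {R : realType} {V : normedModType R} {p q : nat}.
Implicit Types (U : set V) (A : V -> 'M[R]_(p.+1, q.+1)).

Definition mx_entry (i : 'I_p.+1) (j : 'I_q.+1) (M : 'M[R]_(p.+1, q.+1)) : R := M i j.

Lemma mx_entry_is_linear i j : linear (mx_entry i j).
Proof. by move=> c M N; rewrite /mx_entry !mxE. Qed.

HB.instance Definition _ i j :=
  GRing.isLinear.Build R 'M[R]_(p.+1, q.+1) R _ (mx_entry i j) (mx_entry_is_linear i j).

Lemma Ck_entry k U A i j : open U -> Ck k U A -> Ck k U (fun x => A x i j).
Proof. by move=> oU; apply: (Ck_linear (l := mx_entry i j)) => //; exact: coord_continuous. Qed.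

Lemma Ck_sum (I : Type) (r : seq I) (W : normedModType R) k U (f : I -> V -> W) : open U ->
  (forall i, Ck k U (f i)) -> Ck k U (fun x => \sum_(i <- r) f i x).
Proof.
move=> oU Cf; elim: r => [|i r IHr].
  by apply: (Ck_eq oU _ (Ck_cst k U 0)) => x _; rewrite big_nil.
by apply: (Ck_eq oU _ (CkD oU (Cf i) IHr)) => x _; rewrite big_cons.
Qed.

Lemma Ck_matrix k U A : open U -> (forall i j, Ck k U (fun x => A x i j)) -> Ck k U A.
Proof.
move=> oU CA; apply: (Ck_eq (f := fun x => \sum_i \sum_j A x i j *: delta_mx i j) oU).
  by move=> x _; rewrite [RHS]matrix_sum_delta.
apply: Ck_sum => // i; apply: Ck_sum => // j; exact: Ck_scale.
Qed.

Lemma derive_entry A x v i j : differentiable A x ->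
  ('D_v A x) i j = 'D_v (fun y => A y i j) x.
Proof. by move=> dA; rewrite derive_mx ?mxE //; exact: diff_derivable. Qed.

End MatrixFunctions.

Section Segments.
Context {R : realType} {V : normedModType R}.
Implicit Types (f : V -> R) (x v : V).

Lemma is_derive_line f x v t : differentiable f (x + t *: v) ->
  is_derive t 1 (fun s : R => f (x + s *: v)) ('D_v f (x + t *: v)).
Proof.
move=> df; have dv : derivable f (x + t *: v) v by exact: diff_derivable.
have E (h : R) : f (h *: v + (x + t *: v)) = f (x + (h *: 1 + t) *: v).
  by rewrite -[h%:A]/(h * 1) mulr1 scalerDl addrCA.
split.
  rewrite /derivable; move: dv; rewrite /derivable.
  by under [X in cvg (X @ _) -> _]eq_fun do rewrite /= E.
by rewrite /derive; under [in RHS]eq_fun do rewrite /= E.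
Qed.

Lemma MVT_line f x v : (forall t : R, 0 <= t <= 1 -> differentiable f (x + t *: v)) ->
  exists2 t : R, 0 < t < 1 & f (x + v) - f x = 'D_v f (x + t *: v).
Proof.
move=> df; have [||t] := @MVT R (fun s => f (x + s *: v)) (fun s => 'D_v f (x + s *: v)) 0 1 ltr01.
- move=> t; rewrite in_itv /= => /andP[t0 t1].
  by apply: is_derive_line; apply: df; rewrite !ltW.
- apply: continuous_in_subspaceT => t; rewrite inE /= in_itv /= => t01.
  apply: differentiable_continuous; apply/derivable1_diffP.
  by have [] := is_derive_line (df t t01).
rewrite in_itv /= => t01; rewrite scale1r scale0r addr0 subr0 mulr1 => e.
by exists t.
Qed.

Lemma ball_segment (x0 x v : V) r (t : R) : 0 <= t <= 1 ->
  ball x0 r x -> ball x0 r (x + v) -> ball x0 r (x + t *: v).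
Proof.
move=> /andP[t0 t1]; rewrite -!ball_normE /= => bx bv.
have -> : x0 - (x + t *: v) = (1 - t) *: (x0 - x) + t *: (x0 - (x + v)).
  rewrite !opprD !addrA; move: (x0 - x) => u.
  by rewrite scalerBl scale1r scalerBr addrA subrK.
have [->|tn0] := eqVneq t 0; first by rewrite scale0r addr0 subr0 scale1r.
have tgt : 0 < t by rewrite lt_neqAle eq_sym tn0.
apply: le_lt_trans (ler_normD _ _) _; rewrite !normrZ ger0_norm ?subr_ge0 // gtr0_norm //.
have h1 : (1 - t) * `|x0 - x| <= (1 - t) * r by rewrite ler_wpM2l ?subr_ge0 // ltW.
have h2 : t * `|x0 - (x + v)| < t * r by rewrite ltr_pM2l.
by have -> : r = (1 - t) * r + t * r; [ring | exact: ler_ltD].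
Qed.

End Segments.

(** * Symmetry of second derivatives *)

Section Schwarz.
Context {R : realType} {V : normedModType R}.

(** The mean value theorem in direction [v] for the increment [f(. + w) - f], then in direction [w]
    for ['D_v f]. *)
Lemma second_difference (f : V -> R) x v w r : 0 < r -> Ck 2 (ball x r) f ->
  `|v| + `|w| < r -> exists2 y, `|y - x| <= `|v| + `|w| &
  f (x + w + v) - f (x + v) - (f (x + w) - f x) = 'D_w ('D_v f) y.
Proof.
move=> r0 [df Cf] vw.
have inb (s t : R) : 0 <= s <= 1 -> 0 <= t <= 1 ->
    `|x + t *: w + s *: v - x| <= `|v| + `|w|.
  move=> /andP[s0 s1] /andP[t0 t1]; rewrite addrAC [x + _]addrC addrK.
  apply: le_trans (ler_normD _ _) _; rewrite !normrZ !ger0_norm // addrC lerD //.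
    by rewrite ler_piMl.
  by rewrite ler_piMl.
have inB (s t : R) : 0 <= s <= 1 -> 0 <= t <= 1 -> ball x r (x + t *: w + s *: v).
  move=> s01 t01; rewrite -ball_normE /= distrC.
  exact: le_lt_trans (inb s t s01 t01) vw.
have t01 : 0 <= (0 : R) <= 1 by rewrite lexx ler01.
have o01 : 0 <= (1 : R) <= 1 by rewrite lexx ler01.
pose g y := f (y + w) - f y.
have dshift y : differentiable f (y + w) -> differentiable (fun z => f (z + w)) y.
  move=> dfy; have dyw : differentiable (fun z : V => z + w) y.
    by apply: differentiableD => //; exact: differentiable_cst.
  exact: (differentiable_comp dyw dfy).
have Dshift y : differentiable f (y + w) -> 'D_v (fun z => f (z + w)) y = 'D_v f (y + w).
  by move=> dfy; rewrite /derive; under [in RHS]eq_fun do rewrite /= addrA.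
have Bs s : 0 <= s <= 1 -> ball x r (x + s *: v).
  by move=> s01; have := inB s 0 s01 t01; rewrite scale0r addr0.
have Bsw s : 0 <= s <= 1 -> ball x r (x + s *: v + w).
  by move=> s01; have := inB s 1 s01 o01; rewrite scale1r addrAC.
have dg s : 0 <= s <= 1 -> differentiable g (x + s *: v).
  move=> s01; have -> : g = (fun z => f (z + w)) - f by [].
  apply: differentiableB; last by apply: df; exact: Bs.
  by apply: dshift; apply: df; exact: Bsw.
have [s /andP[s0 s1]] := MVT_line dg.
have s01 : 0 <= s <= 1 by rewrite !ltW.
have dfs : differentiable f (x + s *: v) by apply: df; exact: Bs.
have dfsw : differentiable f (x + s *: v + w) by apply: df; exact: Bsw.
have -> : 'D_v g (x + s *: v) = 'D_v f (x + s *: v + w) - 'D_v f (x + s *: v).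
  by rewrite deriveB ?Dshift //; apply: diff_derivable => //; exact: dshift.
have [dDv _] := Cf v.
have [t t01'|t /andP[t0 t1] ->] := @MVT_line R V ('D_v f) (x + s *: v) w.
  by apply: dDv; rewrite addrAC; exact: inB.
move=> gE; exists (x + s *: v + t *: w).
  have t01' : 0 <= t <= 1 by rewrite !ltW.
  by have := inb s t s01 t01'; rewrite [x + t *: w + _]addrAC.
by rewrite -gE /g [x + v + w]addrAC.
Qed.

(** The second difference is symmetric in [v] and [w], so the two mixed derivatives agree when taken
    at suitable points [y] and [y']. Scaling both directions by a small [h] brings these points
    close to [x], where the mixed derivatives are continuous. *)
Lemma schwarz (f : V -> R) U x v w : open U -> U x -> Ck 2 U f ->
  'D_w ('D_v f) x = 'D_v ('D_w f) x.
Proof.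
move=> oU Ux CU.
have [r /= r0 rU] : nbhs_ball x U by apply/nbhs_ballP; exact: open_nbhs_nbhs.
have Cr : Ck 2 (ball x r) f by exact: Ck_sub rU CU.
have cont (v' w' : V) : {for x, continuous ('D_w' ('D_v' f))}.
  case: CU => _ /(_ v')[_ /(_ w')]; exact.
have second (v' w' : V) (h : R) y : ball x r y ->
    'D_(h *: w') ('D_(h *: v') f) y = h ^+ 2 * 'D_w' ('D_v' f) y.
  case: Cr => df Cf By; have [dDv _] := Cf v'.
  have scal (g : V -> R) z u : differentiable g z -> 'D_(h *: u) g z = h * 'D_u g z.
    by move=> dg; rewrite !deriveE // linearZ.
  have nb : \forall z \near y, (h \*: 'D_v' f) z = 'D_(h *: v') f z.
    apply: (near_open (U := ball x r) _ By) => [|z Bz]; first exact: ball_open.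
    by rewrite [RHS]scal //; exact: df.
  have dhv : differentiable ('D_(h *: v') f) y.
    apply: (differentiable_near_eq nb); apply: differentiableZ; exact: dDv.
  have e := near_eq_derive w' nb.
  have e2 : 'D_w' (h \*: 'D_v' f) y = h *: 'D_w' ('D_v' f) y.
    by apply: deriveZ; apply: diff_derivable; exact: dDv.
  by rewrite (scal _ _ _ dhv) -[X in _ * X]e e2 mulrA expr2.
apply/eqP; rewrite -subr_eq0 -normr_le0; apply/ler_addgt0Pl => e e0; rewrite addr0.
have e20 : 0 < e / 2 by rewrite divr_gt0.
have /nbhs_ballP[r1 /= r10 H1] : \forall y \near x,
    `|'D_w ('D_v f) x - 'D_w ('D_v f) y| <= e / 2.
  by have /cvgrPdist_le := cont v w; apply.
have /nbhs_ballP[r2 /= r20 H2] : \forall y \near x,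
    `|'D_v ('D_w f) x - 'D_v ('D_w f) y| <= e / 2.
  by have /cvgrPdist_le := cont w v; apply.
pose rr := Num.min r (Num.min r1 r2).
have rr0 : 0 < rr by rewrite !lt_min r0 r10 r20.
(* The summand 1 keeps the denominator positive when both directions are zero. *)
pose h := rr / (2 * (`|v| + `|w| + 1)).
have den : 0 < `|v| + `|w| + 1 by rewrite ltr_wpDl // addr_ge0.
have h0 : 0 < h by rewrite divr_gt0 // mulr_gt0.
have hvw : `|h *: v| + `|h *: w| < rr.
  have hD : h * (2 * (`|v| + `|w| + 1)) = rr by rewrite /h divfK // gt_eqF // mulr_gt0.
  have {}hD : h * `|v| + h * `|w| + (h * `|v| + h * `|w|) + (h + h) = rr by rewrite -hD; ring.
  have half (a b c : R) : 0 < b -> 0 < c -> a + a + (b + b) = c -> a < c by move=> *; lra.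
  by rewrite (normrZ h v) (normrZ h w) (gtr0_norm h0); exact: half h0 rr0 hD.
have hr : `|h *: v| + `|h *: w| < r by rewrite (lt_le_trans hvw) // ge_min lexx.
have [y yx E1] := second_difference r0 Cr hr.
have [y' y'x E2] := @second_difference f x (h *: w) (h *: v) r r0 Cr (eq_ind _ (fun z => z < r) hr _ (addrC _ _)).
have By z : `|z - x| <= `|h *: v| + `|h *: w| -> forall r', rr <= r' -> ball x r' z.
  by move=> zx r' rr'; rewrite -ball_normE /= distrC (le_lt_trans zx) // (lt_le_trans hvw).
have y'x2 : `|y' - x| <= `|h *: v| + `|h *: w| by rewrite [leRHS]addrC.
have rr1 : rr <= r1 by rewrite !ge_min lexx orbT.
have rr2 : rr <= r2 by rewrite !ge_min lexx !orbT.
have rrr : rr <= r by rewrite ge_min lexx.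
have E : 'D_w ('D_v f) y = 'D_v ('D_w f) y'.
  have h2 : h ^+ 2 != 0 by rewrite expf_neq0 // gt_eqF.
  have s1 := second v w h y (By y yx _ rrr); have s2 := second w v h y' (By y' y'x2 _ rrr).
  apply: (mulfI h2); rewrite -[LHS]s1 -[RHS]s2 -E1 -E2 [x + h *: v + h *: w]addrAC.
  by rewrite !opprB addrACA [RHS]addrACA; congr (_ + _); exact: addrC.
have a1 := H1 y (By y yx _ rr1); have a2 := H2 y' (By y' y'x2 _ rr2).
move: a1 a2; rewrite -E; move: ('D_w ('D_v f) y) ('D_w ('D_v f) x) ('D_v ('D_w f) x) => c a b a1 a2.
have -> : a - b = (a - c) - (b - c) by rewrite opprB addrA subrK.
by apply: le_trans (ler_normB _ _) _; rewrite (splitr e) lerD.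
Qed.

End Schwarz.

Section Coordinates.
Context {R : realType} {n : nat}.
Local Notation V := 'cV[R]_n.+1.
Implicit Types (f : V -> R) (x v w : V).

Lemma col_sum_delta (v : V) : v = \sum_i v i 0 *: delta_mx i 0.
Proof.
rewrite {1}[v]matrix_sum_delta; apply: eq_bigr => i _.
by rewrite big_ord1; congr (v i _ *: delta_mx i _); exact: ord1.
Qed.

Lemma derive_coord f x v : differentiable f x ->
  'D_v f x = \sum_i v i 0 * 'D_(delta_mx i 0) f x.
Proof.
move=> df; rewrite {1}(col_sum_delta v) deriveE // linear_sum; apply: eq_bigr => i _.
by rewrite linearZ (deriveE _ df).
Qed.

Lemma ler_coord v i : `|v i 0| <= `|v|.
Proof.
rewrite [leRHS]/Num.Def.normr /= mx_normrE; apply/bigmax_geP; right.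
by exists (i, 0).
Qed.

Lemma ler_sum_coord (v : V) (c : 'I_n.+1 -> R) (B : R) : (forall i, `|c i| <= B) ->
  `|\sum_i v i 0 * c i| <= n.+1%:R * B * `|v|.
Proof.
move=> cB; apply: le_trans (ler_norm_sum _ _ _) _.
have -> : n.+1%:R * B * `|v| = \sum_(i < n.+1) `|v| * B.
  by rewrite sumr_const card_ord -[RHS]mulr_natl; ring.
by apply: ler_sum => i _; rewrite normrM ler_pM // ler_coord.
Qed.

Lemma bounded_near (I : finType) (g : I -> V -> R) x :
  (forall i, {for x, continuous (g i)}) ->
  exists K : R, \forall y \near x, forall i, `|g i y| <= K.
Proof.
move=> gc; exists (1 + \sum_i `|g i x|).
suff H i : \forall y \near x, `|g i y| <= 1 + \sum_j `|g j x| by exact: filter_forall H.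
have /cvgrPdist_le/(_ _ ltr01) := gc i; apply: filterS => y gy.
rewrite -[g i y](subrK (g i x)); apply: le_trans (ler_normD _ _) _.
rewrite distrC lerD // (bigD1 i) //= lerDl; exact: sumr_ge0.
Qed.

Lemma antiderivative (phi : R -> R) :
  (forall t : R, 0 <= t <= 1 -> {for t, continuous phi}) ->
  exists2 Phi : R -> R, Phi 0 = 0 &
    forall t : R, 0 <= t <= 1 -> is_derive t 1 Phi (phi t).
Proof.
(* Clamping the argument extends [phi] continuously beyond [[0, 1]]. Integration over [[-1, 2]] then
   makes 0 and 1 interior points, where the fundamental theorem gives two-sided derivatives. *)
move=> phic; pose cl (t : R) := Num.max 0 (Num.min t 1).
have clc t : {for t, continuous cl}.
  apply: (@continuous_max R R (cst 0) (fun t => Num.min t 1)); first exact: cvg_cst.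
  by apply: (@continuous_min R R id (cst 1)); [exact: cvg_id | exact: cvg_cst].
have clI t : 0 <= cl t <= 1.
  by rewrite /cl le_max lexx ge_max ler01 ge_min lexx orbT.
have psic t : {for t, continuous (phi \o cl)}.
  by apply: continuous_comp; [exact: clc | exact/phic/clI].
have int : (@lebesgue_measure R).-integrable `[-1, 2] (EFin \o (phi \o cl)).
  apply: continuous_compact_integrable; first exact: segment_compact.
  by apply: continuous_subspaceT => t; exact: psic.
pose F (x : R) := (\int[@lebesgue_measure R]_(t in [set` `[(-1)%R, x]]) ((phi \o cl) t))%R.
exists (fun t => F t - F 0) => [|t /andP[t0 t1]]; first by rewrite subrr.
have [dF FE] := @continuous_FTC1_closed R (phi \o cl) (-1) t 2 ltac:(lra) int ltac:(lra) (psic t).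
have tE : phi t = phi (cl t).
  by rewrite /cl (min_idPl t1) (max_idPr t0).
have -> : phi t = phi t - 0 by rewrite subr0.
apply: is_deriveB; split=> //.
by rewrite -derive1E FE tE.
Qed.

End Coordinates.

(** * Potentials of closed forms on a ball *)

Section Poincare.
Context {R : realType} {n : nat}.
Local Notation V := 'cV[R]_n.+1.
Implicit Types (al : 'I_n.+1 -> V -> R) (U : set V) (u v w x y : V).

Definition pair_form al v y : R := \sum_i v i 0 * al i y.

Lemma pair_form_is_linear al y : linear (fun v => pair_form al v y).
Proof.
move=> c v w; rewrite /pair_form scaler_sumr -big_split; apply: eq_bigr => i _.
by rewrite !mxE mulrDl -[c *: _]/(c * _) mulrA.
Qed.

Definition coform al y v := pair_form al v y.

HB.instance Definition _ al y :=
  GRing.isLinear.Build R V R _ (coform al y) (pair_form_is_linear al y).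

Lemma pair_formD al v w y : pair_form al (v + w) y = pair_form al v y + pair_form al w y.
Proof. by have := pair_form_is_linear al y 1 v w; rewrite !scale1r. Qed.

Lemma pair_form_le al v y (B : R) : (forall i, `|al i y| <= B) ->
  `|pair_form al v y| <= n.+1%:R * B * `|v|.
Proof. exact: ler_sum_coord. Qed.

Lemma Ck_pair_form al k U v : open U -> (forall i, Ck k U (al i)) -> Ck k U (pair_form al v).
Proof.
move=> oU Ca; apply: Ck_sum => // i; apply: CkM => //; exact: (Ck_cst k U (v i 0)).
Qed.

Lemma derive_pair_form al v w y : (forall i, differentiable (al i) y) ->
  'D_w (pair_form al v) y = pair_form (fun i => 'D_w (al i)) v y.
Proof.
move=> da; have -> : pair_form al v = \sum_i (v i 0 \*: al i).
  by apply/funext => z; rewrite fct_sumE.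
have dai i : derivable (al i) y w by exact: diff_derivable.
rewrite derive_sum => [|i]; last exact: derivableZ.
by apply: eq_bigr => i _; rewrite deriveZ.
Qed.

Lemma near_derive_eq (f g : V -> R) U x v : open U -> U x ->
  (forall y, U y -> f y = g y) -> 'D_v f x = 'D_v g x.
Proof. by move=> oU Ux fg; apply: near_eq_derive; exact: near_open oU Ux fg. Qed.

Lemma derive2_pair_form al U u v w y : open U -> U y -> (forall i, Ck 2 U (al i)) ->
  'D_u ('D_w (pair_form al v)) y =
  pair_form (fun i => pair_form (fun j => pair_form
    (fun k => 'D_(delta_mx k 0) ('D_(delta_mx j 0) (al i))) u) w) v y.
Proof.
move=> oU Uy Ca; have da i z : U z -> differentiable (al i) z by case: (Ca i) => d _; exact: d.
have dda i j z : U z -> differentiable ('D_j (al i)) z.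
  by case: (Ca i) => _ /(_ j)[d _]; exact: d.
rewrite (near_derive_eq u oU Uy (fun z Uz => derive_pair_form v w (fun i => da i z Uz))).
rewrite derive_pair_form => [|i]; last exact: dda.
apply: eq_bigr => i _; congr (_ * _).
rewrite (near_derive_eq u oU Uy (fun z Uz => derive_coord w (da i z Uz))).
rewrite (derive_pair_form (al := fun j => 'D_(delta_mx j 0) (al i))) => [|j]; last exact: dda.
by apply: eq_bigr => j _; rewrite (derive_coord _ (dda _ _ _ Uy)).
Qed.

Lemma derive2_pair_form_le al U (B : R) u v w y : open U -> U y -> (forall i, Ck 2 U (al i)) ->
  (forall i j k, `|'D_(delta_mx k 0) ('D_(delta_mx j 0) (al i)) y| <= B) ->
  `|'D_u ('D_w (pair_form al v)) y| <=
    n.+1%:R * (n.+1%:R * (n.+1%:R * B * `|u|) * `|w|) * `|v|.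
Proof.
move=> oU Uy Ca aB; rewrite (derive2_pair_form u v w oU Uy Ca).
apply: pair_form_le => i; apply: pair_form_le => j; exact: pair_form_le.
Qed.

Lemma derive_pair_form_le al (B : R) v w y : (forall i, differentiable (al i) y) ->
  (forall i j, `|'D_(delta_mx j 0) (al i) y| <= B) ->
  `|'D_w (pair_form al v) y| <= n.+1%:R * (n.+1%:R * B * `|w|) * `|v|.
Proof.
move=> da aB; rewrite derive_pair_form //; apply: pair_form_le => i.
by rewrite derive_coord //; exact: ler_sum_coord.
Qed.

Lemma derive_scale (f : V -> R) x v (c : R) : differentiable f x -> 'D_(c *: v) f x = c * 'D_v f x.
Proof. by move=> df; rewrite !deriveE // linearZ. Qed.

(** [F x] is the integral of the form along the segment from [x0] to [x]. Instead of differentiating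
    under the integral sign, the first-order error is bounded by a multiple of [|h|^2], through the
    mean value theorem for this error as a function of the ray parameter. *)
Lemma primitive_ray al U x0 (r B : R) : 0 < r -> ball x0 r `<=` U -> open U ->
  (forall i, Ck 2 U (al i)) ->
  (forall i j y, U y -> 'D_(delta_mx j 0) (al i) y = 'D_(delta_mx i 0) (al j) y) ->
  (forall i j y, ball x0 r y -> `|'D_(delta_mx j 0) (al i) y| <= B) ->
  (forall i j k y, ball x0 r y ->
     `|'D_(delta_mx k 0) ('D_(delta_mx j 0) (al i)) y| <= B) ->
  exists F : V -> R, F x0 = 0 /\
    exists2 K : R, 0 <= K & forall x h, ball x0 r x -> ball x0 r (x + h) ->
      `|F (x + h) - F x - pair_form al h x| <= K * `|h| ^+ 2.
Proof.
move=> r0 rU oU Ca sym B1 B2.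
have da i y : U y -> differentiable (al i) y by case: (Ca i) => d _; exact: d.
have dp v y : U y -> differentiable (pair_form al v) y.
  by move=> Uy; have [d _] := Ck_pair_form v oU Ca; exact: d.
have symp v w y : U y -> 'D_v (pair_form al w) y = 'D_w (pair_form al v) y.
  move=> Uy; rewrite !derive_pair_form; try by move=> i; exact: da.
  under [LHS]eq_bigr do rewrite (derive_coord _ (da _ _ Uy)) mulr_sumr.
  under [RHS]eq_bigr do rewrite (derive_coord _ (da _ _ Uy)) mulr_sumr.
  rewrite exchange_big; apply: eq_bigr => i _; apply: eq_bigr => j _.
  by rewrite mulrCA (sym _ _ _ Uy).
have x0B : ball x0 r x0 by exact: ballxx.
have seg x (t : R) : ball x0 r x -> 0 <= t <= 1 -> ball x0 r (x0 + t *: (x - x0)).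
  by move=> Bx t01; apply: ball_segment => //; rewrite addrC subrK.
have ray x : ball x0 r x -> exists2 Phi : R -> R, Phi 0 = 0 &
    forall t : R, 0 <= t <= 1 ->
      is_derive t 1 Phi (pair_form al (x - x0) (x0 + t *: (x - x0))).
  move=> Bx.
  apply: (antiderivative (phi := fun t => pair_form al (x - x0) (x0 + t *: (x - x0)))).
  move=> t t01; apply: differentiable_continuous; apply/derivable1_diffP.
  by have [] := is_derive_line (dp (x - x0) _ (rU _ (seg x t Bx t01))).
have {ray} [Phi Phi0] : exists2 Phi : V -> R -> R, forall x, Phi x 0 = 0 &
    forall x, ball x0 r x -> forall t : R, 0 <= t <= 1 ->
      is_derive t 1 (Phi x) (pair_form al (x - x0) (x0 + t *: (x - x0))).
  have ch x : exists Phi : R -> R, Phi 0 = 0 /\ (ball x0 r x -> forall t : R, 0 <= t <= 1 ->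
      is_derive t 1 Phi (pair_form al (x - x0) (x0 + t *: (x - x0)))).
    have [Bx|nBx] := pselect (ball x0 r x); last by exists (fun=> 0).
    by have [Phi P0 P1] := ray x Bx; exists Phi.
  have [Phi PhiP] := choice ch.
  by exists Phi => x; have [] := PhiP x.
move=> dPhi.
have N0 : 0 <= n.+1%:R :> R by exact: ler0n.
have B0 : 0 <= B by apply: le_trans (normr_ge0 _) (B1 0 0 x0 x0B).
pose N : R := n.+1%:R.
exists (fun x => Phi x 1); split.
  have z (t : R) : 0 <= t <= 1 -> is_derive t 1 (Phi x0) 0.
    move=> t01; have := dPhi x0 x0B t t01.
    suff -> : pair_form al (x0 - x0) (x0 + t *: (x0 - x0)) = 0 by [].
    by rewrite /pair_form big1 // => i _; rewrite subrr mxE mul0r.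
  have [||t _] := @MVT R (Phi x0) (fun=> 0) 0 1 ltr01.
  - by move=> t; rewrite in_itv /= => /andP[t0 t1]; apply: z; rewrite !ltW.
  - apply: continuous_in_subspaceT => t; rewrite inE /= in_itv /= => t01.
    apply: differentiable_continuous; apply/derivable1_diffP.
    by have [] := z t t01.
  by rewrite mul0r Phi0 subr0.
(* The summands are the bounds for the second derivatives, with [|x - x0| <= r], and for the first
   derivatives of the coefficients. *)
exists (N * (N * (N * B)) * r + N * (N * B)).
  by rewrite addr_ge0 ?mulr_ge0 // ltW.
move=> x h Bx Bxh; set xi := x - x0.
have xhE : x + h - x0 = xi + h by rewrite addrAC.
have line (v : V) (t : R) : 0 <= t <= 1 -> is_derive t (1 : R) (fun s : R => pair_form al v (x0 + s *: xi))
    ('D_xi (pair_form al v) (x0 + t *: xi)).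
  by move=> t01; apply: is_derive_line; apply: dp; apply: rU; exact: seg.
(* [P 1] is the error term; since the form is closed, [P'] is of second order in [h]. *)
pose P (t : R) := Phi (x + h) t - Phi x t - t * pair_form al h (x0 + t *: xi).
pose dP (t : R) := pair_form al (xi + h) (x0 + t *: (xi + h)) - pair_form al xi (x0 + t *: xi)
  - (t * 'D_xi (pair_form al h) (x0 + t *: xi) + pair_form al h (x0 + t *: xi)).
have Pd (t : R) : 0 <= t <= 1 -> is_derive t 1 P (dP t).
  move=> t01; apply: is_deriveB; first apply: is_deriveB.
  - by have := dPhi _ Bxh t t01; rewrite xhE.
  - exact: dPhi.
  have := @is_deriveM _ _ id (fun s => pair_form al h (x0 + s *: xi)) t 1 1 _
    (is_derive_id _ _) (line h t t01).
  by rewrite -[_ *: 1]/(_ * 1) mulr1.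
have [||c /andP[c0 c1]] := @MVT R P dP 0 1 ltr01.
- by move=> t; rewrite in_itv /= => /andP[t0 t1]; apply: Pd; rewrite !ltW.
- apply: continuous_in_subspaceT => t; rewrite inE /= in_itv /= => t01.
  apply: differentiable_continuous; apply/derivable1_diffP.
  by have [] := Pd t t01.
have c01 : 0 <= c <= 1 by rewrite !ltW.
have -> : P 1 - P 0 = Phi (x + h) 1 - Phi x 1 - pair_form al h x.
  by rewrite /P !Phi0 scale1r mul0r !subr0 mul1r /xi [x0 + _]addrC subrK.
rewrite subr0 mulr1 => ->.
rewrite /dP; set y := x0 + c *: xi.
have yB : ball x0 r y by exact: seg.
set h1 := c *: h.
have yh1 : x0 + c *: (xi + h) = y + h1 by rewrite scalerDr addrA.
have yh1B : ball x0 r (y + h1) by rewrite -yh1 -xhE; exact: seg.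
have inB (s : R) : 0 <= s <= 1 -> ball x0 r (y + s *: h1) by move=> s01; exact: ball_segment.
have [s01|s /andP[s0 s1] e1] := @MVT_line R V (pair_form al xi) y h1.
  by move=> s01'; apply: dp; apply: rU; exact: inB.
have s01 : 0 <= s <= 1 by rewrite !ltW.
set h2 := s *: h1.
have [s' s01'|s' /andP[s0' s1'] e2] := @MVT_line R V ('D_h (pair_form al xi)) y h2.
  have [_ /(_ h)[d _]] := Ck_pair_form xi oU Ca; apply: d; apply: rU.
  by apply: ball_segment => //; exact: inB.
have s01' : 0 <= s' <= 1 by rewrite !ltW.
have [q01|q /andP[q0 q1] e3] := @MVT_line R V (pair_form al h) y h1.
  by move=> q01'; apply: dp; apply: rU; exact: inB.
have q01 : 0 <= q <= 1 by rewrite !ltW.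
(* Closedness enters through [symp], which trades ['D_xi] of the form on [h] for ['D_h] of the form
   on [xi]; this cancels the terms of first order in [h]. *)
have -> : pair_form al (xi + h) (x0 + c *: (xi + h)) - pair_form al xi y -
   (c * 'D_xi (pair_form al h) y + pair_form al h y) =
   c * 'D_h2 ('D_h (pair_form al xi)) (y + s' *: h2) + 'D_h1 (pair_form al h) (y + q *: h1).
  rewrite -e2 -e3 yh1 pair_formD mulrBr -(derive_scale _ _ (dp xi _ (rU _ (inB s s01)))) -e1.
  rewrite (symp _ _ _ (rU _ yB)).
  by rewrite opprD !addrA; congr (_ - _); rewrite -!addrA; congr (_ + _); rewrite addrCA; congr (_ + _); rewrite addrC.
have sc (k : R) (v : V) : 0 <= k <= 1 -> `|k *: v| <= `|v|.
  by move=> /andP[k0 k1]; rewrite normrZ ger0_norm // ler_piMl.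
have h1h : `|h1| <= `|h| by exact: sc.
have h2h : `|h2| <= `|h| by apply: le_trans h1h; exact: sc.
have xir : `|xi| <= r by move: Bx; rewrite -ball_normE /= distrC => /ltW.
have z2B : ball x0 r (y + s' *: h2) by apply: ball_segment => //; exact: inB.
have b1 : `|c * 'D_h2 ('D_h (pair_form al xi)) (y + s' *: h2)| <=
    N * (N * (N * B * `|h|) * `|h|) * r.
  rewrite normrM ger0_norm ?(ltW c0) //; apply: le_trans (ler_piMl (normr_ge0 _) (ltW c1)) _.
  apply: le_trans (derive2_pair_form_le _ _ _ oU (rU _ z2B) Ca (fun i j k => B2 i j k _ z2B)) _.
  apply: ler_pM => //; first by rewrite ?mulr_ge0.
  rewrite ler_wpM2l // ler_wpM2r // ler_wpM2l //  ler_wpM2l //.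
  by rewrite mulr_ge0.
have b2 : `|'D_h1 (pair_form al h) (y + q *: h1)| <= N * (N * B * `|h|) * `|h|.
  have zB := inB q q01.
  apply: le_trans (derive_pair_form_le _ _ (fun i => da i _ (rU _ zB)) (fun i j => B1 i j _ zB)) _.
  by rewrite ler_wpM2r // ler_wpM2l // ler_wpM2l // mulr_ge0.
apply: le_trans (ler_normD _ _) _; apply: le_trans (lerD b1 b2) _.
move: (`|h|) => t; rewrite le_eqVlt; apply/orP; left; apply/eqP; ring.
Qed.

Lemma poincare_local al U x0 : open U -> U x0 -> (forall i, smooth U (al i)) ->
  (forall i j y, U y -> 'D_(delta_mx j 0) (al i) y = 'D_(delta_mx i 0) (al j) y) ->
  exists F V', [/\ open V', V' x0, V' `<=` U & [/\ F x0 = 0, smooth V' F &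
    forall i x, V' x -> 'D_(delta_mx i 0) F x = al i x]].
Proof.
move=> oU Ux0 Ca sym.
have /nbhs_ballP[r0 /= r00 r0U] : nbhs x0 U by exact: open_nbhs_nbhs.
have [B1 nB1] := @bounded_near R n ('I_n.+1 * 'I_n.+1)%type
  (fun ij => 'D_(delta_mx ij.2 0) (al ij.1)) x0
  (fun ij => match Ca ij.1 1 with conj _ h => h _ x0 Ux0 end).
have [B2 nB2] := @bounded_near R n ('I_n.+1 * ('I_n.+1 * 'I_n.+1))%type
  (fun ij => 'D_(delta_mx ij.2.2 0) ('D_(delta_mx ij.2.1 0) (al ij.1))) x0
  (fun ij => match Ca ij.1 2 with conj _ h => match h _ with conj _ h' => h' _ x0 Ux0 end end).
have /nbhs_ballP[r1 /= r10 r1P] : \forall y \near x0,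
    (forall ij, `|'D_(delta_mx ij.2 0) (al ij.1) y| <= B1) /\
    (forall ij, `|'D_(delta_mx ij.2.2 0) ('D_(delta_mx ij.2.1 0) (al ij.1)) y| <= B2).
  exact: filterI.
pose r := Num.min r0 r1; have rgt : 0 < r by rewrite lt_min r00 r10.
have rU : ball x0 r `<=` U.
  by move=> y By; apply: r0U; apply: le_ball By; rewrite ge_min lexx.
have rP y : ball x0 r y -> (forall ij, `|'D_(delta_mx ij.2 0) (al ij.1) y| <= B1) /\
    (forall ij, `|'D_(delta_mx ij.2.2 0) ('D_(delta_mx ij.2.1 0) (al ij.1)) y| <= B2).
  by move=> By; apply: r1P; apply: le_ball By; rewrite ge_min lexx orbT.
have [||F [F0 [K K0 FK]]] := @primitive_ray al U x0 r (Num.max B1 B2) rgt rU oU (fun i => Ca i 2) sym.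
- by move=> i j y /rP[b _]; rewrite le_max (b (i, j)).
- by move=> i j k y /rP[_ b]; rewrite le_max (b (i, (j, k))) orbT.
have oB : open (ball x0 r) by exact: ball_open.
exists F, (ball x0 r); split => //; first exact: ballxx.
have dF x : ball x0 r x -> differentiable F x /\ forall v, 'D_v F x = pair_form al v x.
  move=> Bx; pose ll : {linear V -> R} := coform al x.
  have lc : continuous ll.
    have C : Ck 0 setT (coform al x).
      apply: Ck_sum => [|i]; first exact: openT.
      apply: CkM; [exact: openT | | exact: (Ck_cst 0 setT (al i x))].
      by move=> v _; exact: coord_continuous.
    by move=> v; exact: C.
  have E (e : R) : 0 < e -> \forall h \near (0 : V), `|F (h + x) - (F x + ll h)| <= e * `|h|.
    move=> e0.
    have xB : \forall h \near (0 : V), ball x0 r (h + x).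
      have : \forall y \near x, ball x0 r y by exact: near_open Bx _.
      by rewrite (near_shift 0) /= subr0.
    have K1 : 0 < K + 1 by rewrite ltr_wpDl.
    have hsm : \forall h \near (0 : V), `|h| <= e / (K + 1).
      by apply/nbhs_ballP; exists (e / (K + 1)) => /= [|y]; [exact: divr_gt0 | rewrite -ball_normE /= sub0r normrN => /ltW].
    near=> h.
    have hs : `|h| <= e / (K + 1) by near: h.
    rewrite opprD addrA [h + x]addrC.
    apply: le_trans (FK x h Bx _) _; first by rewrite addrC; near: h.
    rewrite expr2 mulrA ler_wpM2r //; apply: le_trans (ler_wpM2l K0 hs) _.
    by rewrite mulrCA ler_piMr ?(ltW e0) // ler_pdivrMr // mul1r lerDl.
  split; first by apply/differentiable_le; exists ll.
  move=> v; rewrite deriveE; last by apply/differentiable_le; exists ll.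
  by rewrite (diff_le lc E).
split=> //; last first.
  move=> i x Bx; rewrite (dF x Bx).2 /pair_form (bigD1 i) //= big1 => [|j ji].
    by rewrite mxE !eqxx mul1r addr0.
  by rewrite mxE (negbTE ji) mul0r.
case=> [|k] /=; first by move=> x Bx; apply: differentiable_continuous; exact: (dF x Bx).1.
split=> [x Bx|v]; first exact: (dF x Bx).1.
apply: (Ck_eq (f := pair_form al v) oB); first by move=> x Bx; rewrite (dF x Bx).2.
by apply: Ck_pair_form => // i; apply: Ck_sub (Ca i k).
Unshelve. all: by end_near. Qed.

End Poincare.

Section SmoothMatrices.
Context {R : realType} {V : normedModType R}.
Implicit Types (U : set V).

Lemma Ck_prod (I : Type) (r : seq I) k U (f : I -> V -> R) : open U ->
  (forall i, Ck k U (f i)) -> Ck k U (fun x => \prod_(i <- r) f i x).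
Proof.
move=> oU Cf; elim: r => [|i r IHr].
  by apply: (Ck_eq oU _ (Ck_cst k U (1 : R))) => x _; rewrite big_nil.
by apply: (Ck_eq oU _ (CkM oU (Cf i) IHr)) => x _; rewrite big_cons.
Qed.

Lemma Ck_det m k U (A : V -> 'M[R]_m) : open U ->
  (forall i j, Ck k U (fun x => A x i j)) -> Ck k U (fun x => \det (A x)).
Proof.
move=> oU CA; apply: Ck_sum => // s; apply: CkM => //.
  exact: Ck_cst.
exact: Ck_prod.
Qed.

Lemma Ck_mulmx m k U p q (A : V -> 'M[R]_(p.+1, m.+1)) (B : V -> 'M[R]_(m.+1, q.+1)) :
  open U -> Ck k U A -> Ck k U B -> Ck k U (fun x => A x *m B x).
Proof.
move=> oU CA CB; apply: Ck_matrix => // i j.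
apply: (Ck_eq (f := fun x => \sum_k A x i k * B x k j) oU); first by move=> x _; rewrite mxE.
by apply: Ck_sum => // l; apply: CkM => //; exact: Ck_entry.
Qed.

Lemma Ck_mxX m k U (A : V -> 'M[R]_m.+1) d : open U -> Ck k U A -> Ck k U (fun x => A x ^+ d).
Proof.
move=> oU CA; elim: d => [|d IHd]; first exact: (@Ck_cst R V 'M[R]_m.+1 k U 1).
by apply: (Ck_eq oU _ (Ck_mulmx oU CA IHd)) => x _; rewrite exprS.
Qed.

Lemma near_neq0 U (f : V -> R) x : open U -> U x -> Ck 0 U f -> f x != 0 ->
  \forall y \near x, f y != 0.
Proof. by move=> oU Ux Cf fx; exact: cvgr_neq0 (Cf x Ux) fx. Qed.

End SmoothMatrices.

(** * Coordinates from an invertible Jacobian *)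

Section LocalInjectivity.
Context {R : realType} {n : nat}.
Local Notation V := 'cV[R]_n.+1.

Lemma mulmx_col_le m (A : 'M[R]_(m.+1, n.+1)) (v : V) (e : R) : (forall i j, `|A i j| <= e) ->
  `|A *m v| <= n.+1%:R * e * `|v|.
Proof.
move=> Ae; rewrite [leLHS]/Num.Def.normr /= mx_normrE; apply/bigmax_leP; split.
  have e0 : 0 <= e by apply: le_trans (Ae 0 0).
  by rewrite mulr_ge0 // mulr_ge0.
move=> [i j] _ /=; rewrite (ord1 j) mxE.
under eq_bigr do rewrite mulrC.
by apply: ler_sum_coord => k; exact: Ae.
Qed.

(** If [phi y = phi z], the mean value theorem in each component gives a matrix [M] that kills
    [u = y - z]. Its rows are differentials at different points [w k], so all partial derivatives
    are kept uniformly close to those at [x0]; then [u = J^-1 (J - M) u] forces [u = 0]. *)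
Lemma local_coordinates U (phi : V -> V) x0 : open U -> U x0 -> smooth U phi ->
  jac phi x0 \in unitmx ->
  exists V', [/\ open V', V' x0, V' `<=` U & coordinates V' phi].
Proof.
move=> oU Ux0 Cphi uJ; set J := jac phi x0.
have Cp k : smooth U (fun y => phi y k 0) by move=> m; exact: Ck_entry.
have Jc k i : {for x0, continuous ('D_(delta_mx i 0) (fun y => phi y k 0))}.
  by have [_ /(_ (delta_mx i 0)) c] := Cp k 1; exact: c.
have CJ : Ck 0 U (fun x => jac phi x).
  apply: Ck_matrix => // k i; have [_ /(_ (delta_mx i 0)) c] := Cp k 1.
  have E x : U x -> 'D_(delta_mx i 0) (fun y => phi y k 0) x = jac phi x k i by rewrite !mxE.
  exact: (@Ck_eq _ _ _ 0 _ _ _ oU E c).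
have nu : \forall y \near x0, jac phi y \in unitmx.
  have : \forall y \near x0, \det (jac phi y) != 0.
    apply: (near_neq0 oU Ux0); last by rewrite -unitfE -unitmxE.
    by apply: Ck_det => // i j; exact: Ck_entry.
  by apply: filterS => y; rewrite -unitfE -unitmxE.
pose c : R := 1 + \sum_i \sum_j `|invmx J i j|.
have c0 : 0 < c by rewrite ltr_wpDr // sumr_ge0 // => i _; exact: sumr_ge0.
have cJ i j : `|invmx J i j| <= c.
  have le1 : `|invmx J i j| <= \sum_l `|invmx J i l| by rewrite (bigD1 j) //= lerDl sumr_ge0.
  apply: le_trans le1 _; rewrite /c [X in _ <= 1 + X](bigD1 i) //= addrCA lerDl addr_ge0 ?sumr_ge0 // => k _.
  exact: sumr_ge0.
pose N : R := n.+1%:R; have N0 : 0 < N by rewrite ltr0n.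
(* Chosen so that [u = J^-1 (J - M) u] yields [|u| <= |u| / 2]; each [N] comes from bounding a
   matrix-vector product by the entries. *)
pose e : R := (N * c * N * 2)^-1.
have e0 : 0 < e by rewrite invr_gt0 !mulr_gt0.
have nJ : \forall y \near x0, forall ki : 'I_n.+1 * 'I_n.+1,
    `|'D_(delta_mx ki.2 0) (fun y => phi y ki.1 0) x0 - 'D_(delta_mx ki.2 0) (fun y => phi y ki.1 0) y| <= e.
  suff H (ki : 'I_n.+1 * 'I_n.+1) : \forall y \near x0,
    `|'D_(delta_mx ki.2 0) (fun y => phi y ki.1 0) x0 - 'D_(delta_mx ki.2 0) (fun y => phi y ki.1 0) y| <= e by exact: filter_forall H.
  by have /cvgrPdist_le := Jc ki.1 ki.2; exact.
have nU : nbhs x0 U by exact: open_nbhs_nbhs.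
have /nbhs_ballP[r /= r0 rP] : nbhs x0 (U `&` [set y | jac phi y \in unitmx] `&`
    [set y | forall ki : 'I_n.+1 * 'I_n.+1,
    `|'D_(delta_mx ki.2 0) (fun y => phi y ki.1 0) x0 - 'D_(delta_mx ki.2 0) (fun y => phi y ki.1 0) y| <= e]).
  by apply: filterI => //; exact: filterI.
exists (ball x0 r); split; [exact: ball_open|exact: ballxx|by move=> y /rP[[]]|].
split; [by move=> k; apply: Ck_sub (Cphi k) => y /rP[[]]| |by move=> y /rP[[]]].
move=> y z; rewrite !inE => By Bz yz; apply/eqP; rewrite -subr_eq0; apply/eqP.
set u := y - z.
have mv k : exists2 w, ball x0 r w & 'D_u (fun y => phi y k 0) w = 0.
  have inB (t : R) : 0 <= t <= 1 -> ball x0 r (z + t *: u).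
    by move=> t01; apply: ball_segment => //; rewrite addrC subrK.
  have [t|t /andP[t0 t1] e1] := @MVT_line R V (fun y => phi y k 0) z u.
    by move=> /inB /rP[[Uz _] _]; have [d _] := Cp k 1; exact: d.
  exists (z + t *: u); first by apply: inB; rewrite !ltW.
  by rewrite -e1 [z + u]addrC subrK yz subrr.
have [w wB] : exists2 w : 'I_n.+1 -> V, forall k, ball x0 r (w k) &
    forall k, 'D_u (fun y => phi y k 0) (w k) = 0.
  have {}mv k : exists w, ball x0 r w /\ 'D_u (fun y => phi y k 0) w = 0.
    by have [w] := mv k; exists w.
  by have [w wP] := choice mv; exists w => k; have [] := wP k.
move=> wD; pose M : 'M[R]_n.+1 := \matrix_(k, i) 'D_(delta_mx i 0) (fun y => phi y k 0) (w k).
have Mu : M *m u = 0.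
  apply/matrixP => k j; rewrite (ord1 j) !mxE; etransitivity; last exact: (wD k).
  rewrite derive_coord.
    by apply: eq_bigr => i _; rewrite !mxE mulrC.
  by have [[Uw _] _] := rP _ (wB k); have [d _] := Cp k 1; exact: d.
have uE : u = invmx J *m ((J - M) *m u).
  by rewrite mulmxBl Mu subr0 mulKmx.
have b1 : `|(J - M) *m u| <= N * e * `|u|.
  apply: mulmx_col_le => k i; rewrite !mxE.
  by have [_ /(_ (k, i))] := rP _ (wB k).
have b2 : `|u| <= N * c * (N * e * `|u|).
  by rewrite {1}uE; apply: le_trans (mulmx_col_le _ cJ) _; rewrite ler_pM2l // mulr_gt0.
apply/normr0_eq0/eqP; rewrite eq_le normr_ge0 andbT.
have eE : N * c * (N * e * `|u|) = 2^-1 * `|u|.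
  by rewrite /e; field; rewrite !gt_eqF.
by move: b2; rewrite eE; move: (`|u|) => t; lra.
Qed.

End LocalInjectivity.

(** * Smooth roots of complex polynomials *)

Section ComplexParts.
Context {R : realType}.
Local Notation C := R[i].
Local Notation re := (@complex.Re R).
Local Notation im := (@complex.Im R).
Implicit Types z w : C.

Lemma reD z w : re (z + w) = re z + re w. Proof. by case: z w => [a b] [c d]. Qed.
Lemma imD z w : im (z + w) = im z + im w. Proof. by case: z w => [a b] [c d]. Qed.
Lemma reN z : re (- z) = - re z. Proof. by case: z. Qed.
Lemma imN z : im (- z) = - im z. Proof. by case: z. Qed.
Lemma reM z w : re (z * w) = re z * re w - im z * im w.
Proof. by case: z w => [a b] [c d]. Qed.
Lemma imM z w : im (z * w) = re z * im w + im z * re w.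
Proof. by case: z w => [a b] [c d]. Qed.

(** The squared modulus as an element of [R]; the norm of [R[i]] takes its values in [R[i]]. *)
Definition nm2 z : R := re z ^+ 2 + im z ^+ 2.

Lemma reV z : re z^-1 = re z / nm2 z. Proof. by case: z. Qed.
Lemma imV z : im z^-1 = - (im z / nm2 z). Proof. by case: z. Qed.

Lemma nm2_ge0 z : 0 <= nm2 z. Proof. by rewrite addr_ge0 // sqr_ge0. Qed.

Lemma nm2M z w : nm2 (z * w) = nm2 z * nm2 w.
Proof. by rewrite /nm2 reM imM; ring. Qed.

Lemma nm2_eq0 z : (nm2 z == 0) = (z == 0).
Proof.
by case: z => a b; rewrite eq_complex /nm2 paddr_eq0 ?sqr_ge0 //= !sqrf_eq0.
Qed.

Lemma nm2_prod (I : Type) (r : seq I) (f : I -> C) :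
  nm2 (\prod_(i <- r) f i) = \prod_(i <- r) nm2 (f i).
Proof. by apply: big_morph; [exact: nm2M | rewrite /nm2 /= expr1n expr0n addr0]. Qed.

Lemma nm2N z : nm2 (- z) = nm2 z. Proof. by rewrite /nm2 reN imN !sqrrN. Qed.

Lemma re_sqr_le z : re z ^+ 2 <= nm2 z. Proof. by rewrite lerDl sqr_ge0. Qed.
Lemma im_sqr_le z : im z ^+ 2 <= nm2 z. Proof. by rewrite lerDr sqr_ge0. Qed.

(** [|p(z)|] is the product of the distances from [z] to the [d + 1] roots, none smaller than the
    least of them. *)
Lemma nearest_root (p : {poly C}) d z : p \is monic -> size p = d.+2 ->
  exists2 y, root p y & nm2 (z - y) ^+ d.+1 <= nm2 p.[z].
Proof.
move=> pm sp; have [s pE] := closed_field_poly_normal p.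
rewrite (monicP pm) scale1r in pE.
have ss : size s = d.+1 by have := sp; rewrite pE size_prod_XsubC => -[].
pose f (i : 'I_d.+1) := nm2 (z - s`_i).
have [i _ fi] := @arg_minP _ _ _ (ord0 : 'I_d.+1) predT f isT.
exists s`_i; first by rewrite pE root_prod_XsubC mem_nth // ss.
rewrite pE horner_prod nm2_prod (big_nth 0) ss big_mkord.
under [leRHS]eq_bigr do rewrite hornerXsubC.
have -> : nm2 (z - s`_i) ^+ d.+1 = \prod_(j < d.+1) f i.
  by rewrite prodr_const card_ord.
by apply: ler_prod => j _; rewrite nm2_ge0 fi.
Qed.

End ComplexParts.

(** * Limits and derivatives of complex functions through real and imaginary parts *)

Section ComplexLimits.
Context {R : realType} {T : Type} (F : set_system T) {FF : Filter F}.
Local Notation C := R[i].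
Local Notation re := (@complex.Re R).
Local Notation im := (@complex.Im R).
Implicit Types (f g : T -> C) (l : C).

Definition ccvg f l : Prop :=
  ((fun x => re (f x)) @ F --> re l) /\ ((fun x => im (f x)) @ F --> im l).

Lemma ccvg_cst l : ccvg (fun=> l) l.
Proof. by split; exact: cvg_cst. Qed.

Lemma ccvgD f g a b : ccvg f a -> ccvg g b -> ccvg (fun x => f x + g x) (a + b).
Proof.
move=> [f1 f2] [g1 g2]; split.
  by under eq_fun do rewrite reD; rewrite reD; exact: cvgD.
by under eq_fun do rewrite imD; rewrite imD; exact: cvgD.
Qed.

Lemma ccvgN f a : ccvg f a -> ccvg (fun x => - f x) (- a).
Proof.
move=> [f1 f2]; split.
  by under eq_fun do rewrite reN; rewrite reN; exact: cvgN.
by under eq_fun do rewrite imN; rewrite imN; exact: cvgN.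
Qed.

Lemma ccvgM f g a b : ccvg f a -> ccvg g b -> ccvg (fun x => f x * g x) (a * b).
Proof.
move=> [f1 f2] [g1 g2]; split.
  by under eq_fun do rewrite reM; rewrite reM; apply: cvgB; exact: cvgM.
by under eq_fun do rewrite imM; rewrite imM; apply: cvgD; exact: cvgM.
Qed.

Lemma cvg_nm2 f a : ccvg f a -> (fun x => nm2 (f x)) @ F --> nm2 a.
Proof. by move=> [f1 f2]; apply: cvgD; under eq_fun do rewrite expr2; rewrite expr2; exact: cvgM. Qed.

Lemma ccvgV f a : a != 0 -> ccvg f a -> ccvg (fun x => (f x)^-1) a^-1.
Proof.
move=> a0 fa; have [f1 f2] := fa.
have n0 : (fun x => (nm2 (f x))^-1) @ F --> (nm2 a)^-1.
  by apply: cvgV; [rewrite nm2_eq0 | exact: cvg_nm2].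
split.
  by under eq_fun do rewrite reV; rewrite reV; exact: cvgM.
by under eq_fun do rewrite imV; rewrite imV; apply: cvgN; exact: cvgM.
Qed.

Lemma ccvg_sum (I : Type) (r : seq I) (f : I -> T -> C) (a : I -> C) :
  (forall i, ccvg (f i) (a i)) ->
  ccvg (fun x => \sum_(i <- r) f i x) (\sum_(i <- r) a i).
Proof.
move=> fa; elim: r => [|i r IHr].
  by rewrite big_nil; under [fun x => _]eq_fun do rewrite big_nil; exact: ccvg_cst.
by rewrite big_cons; under [fun x => _]eq_fun do rewrite big_cons; exact: ccvgD.
Qed.

Lemma ccvgX f a k : ccvg f a -> ccvg (fun x => f x ^+ k) (a ^+ k).
Proof.
move=> fa; elim: k => [|k IHk]; first exact: ccvg_cst.
by rewrite exprS; under [fun x => _]eq_fun do rewrite exprS; exact: ccvgM.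
Qed.

Lemma ccvg_horner (p : T -> {poly C}) (q : {poly C}) f a d : (forall x, size (p x) <= d)%N -> (size q <= d)%N ->
  (forall i, ccvg (fun x => (p x)`_i) q`_i) -> ccvg f a ->
  ccvg (fun x => (p x).[f x]) q.[a].
Proof.
move=> sp sq pq fa; rewrite (horner_coef_wide _ sq).
under [fun x => _]eq_fun do rewrite (horner_coef_wide _ (sp _)).
by apply: ccvg_sum => i; apply: ccvgM => //; exact: ccvgX.
Qed.

Lemma ccvg_nm2 f a : (fun x => nm2 (f x - a)) @ F --> (0 : R) -> ccvg f a.
Proof.
move=> f0.
have H (P : C -> R) : (forall z w, P (z - w) = P z - P w) -> (forall z, P z ^+ 2 <= nm2 z) ->
    (fun x => P (f x)) @ F --> P a.
  move=> PB Pn; apply/cvgrPdist_lt => e e0.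
  have /cvgrPdist_lt/(_ _ (exprn_gt0 2 e0)) := f0; apply: filterS => x.
  rewrite sub0r normrN ger0_norm ?nm2_ge0 // => fx.
  rewrite distrC -PB -(@ltr_pXn2r _ 2) ?nnegrE // ?ltW //.
  by rewrite real_normK ?num_real // (le_lt_trans (Pn _)).
split; apply: H; [by move=> z w; rewrite reD reN|exact: re_sqr_le|
  by move=> z w; rewrite imD imN|exact: im_sqr_le].
Qed.

End ComplexLimits.

Section ComplexSmooth.
Context {R : realType} {V : normedModType R}.
Local Notation C := R[i].
Local Notation re := (@complex.Re R).
Local Notation im := (@complex.Im R).
Implicit Types (U : set V) (f g : V -> C) (x y v : V).

Definition cCk k U f : Prop := Ck k U (fun x => re (f x)) /\ Ck k U (fun x => im (f x)).
Definition cdiff f x : Prop :=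
  differentiable (fun y => re (f y)) x /\ differentiable (fun y => im (f y)) x.
Definition cD v f x : C :=
  Complex ('D_v (fun y => re (f y)) x) ('D_v (fun y => im (f y)) x).

Lemma cCk_eq k U f g : open U -> (forall x, U x -> f x = g x) -> cCk k U f -> cCk k U g.
Proof.
move=> oU fg [f1 f2].
by split; [apply: Ck_eq f1 | apply: Ck_eq f2] => // x Ux; rewrite fg.
Qed.

Lemma cCk_sub k U U' f : U' `<=` U -> cCk k U f -> cCk k U' f.
Proof. by move=> UU [f1 f2]; split; [exact: Ck_sub f1 | exact: Ck_sub f2]. Qed.

Lemma cCk_cst k U (c : C) : cCk k U (fun=> c).
Proof. by split; exact: Ck_cst. Qed.

Lemma cCkD k U f g : open U -> cCk k U f -> cCk k U g -> cCk k U (fun x => f x + g x).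
Proof.
move=> oU [f1 f2] [g1 g2]; split.
  by apply: (Ck_eq oU _ (CkD oU f1 g1)) => x _; rewrite reD.
by apply: (Ck_eq oU _ (CkD oU f2 g2)) => x _; rewrite imD.
Qed.

Lemma CkN k U (f : V -> R) : open U -> Ck k U f -> Ck k U (fun x => - f x).
Proof.
move=> oU Cf; apply: (Ck_eq oU _ (CkM oU (Ck_cst k U (-1 : R)) Cf)) => x _.
exact: mulN1r.
Qed.

Lemma CkB k U (f g : V -> R) : open U -> Ck k U f -> Ck k U g -> Ck k U (fun x => f x - g x).
Proof. by move=> oU Cf Cg; apply: CkD => //; exact: CkN. Qed.

Lemma cCkM k U f g : open U -> cCk k U f -> cCk k U g -> cCk k U (fun x => f x * g x).
Proof.
move=> oU [f1 f2] [g1 g2]; split.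
  by apply: (Ck_eq oU _ (CkB oU (CkM oU f1 g1) (CkM oU f2 g2))) => x _; rewrite reM.
by apply: (Ck_eq oU _ (CkD oU (CkM oU f1 g2) (CkM oU f2 g1))) => x _; rewrite imM.
Qed.

Lemma cCkN k U f : open U -> cCk k U f -> cCk k U (fun x => - f x).
Proof.
move=> oU Cf; apply: (cCk_eq oU _ (cCkM oU (cCk_cst k U (-1)) Cf)) => x _.
exact: mulN1r.
Qed.

Lemma cCkV k U f : open U -> (forall x, U x -> f x != 0) -> cCk k U f ->
  cCk k U (fun x => (f x)^-1).
Proof.
move=> oU f0 [f1 f2].
have n0 x : U x -> nm2 (f x) != 0 by move=> Ux; rewrite nm2_eq0 f0.
have Cn : Ck k U (fun x => (nm2 (f x))^-1).
  apply: CkV => //; apply: (Ck_eq oU _ (CkD oU (CkM oU f1 f1) (CkM oU f2 f2))) => x _.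
  by rewrite /nm2 !expr2.
split.
  by apply: (Ck_eq oU _ (CkM oU f1 Cn)) => x _; rewrite reV.
by apply: (Ck_eq oU _ (CkN oU (CkM oU f2 Cn))) => x _; rewrite imV.
Qed.

Lemma cCk_sum (I : Type) (r : seq I) k U (f : I -> V -> C) : open U ->
  (forall i, cCk k U (f i)) -> cCk k U (fun x => \sum_(i <- r) f i x).
Proof.
move=> oU Cf; elim: r => [|i r IHr].
  by apply: (cCk_eq oU _ (cCk_cst k U 0)) => x _; rewrite big_nil.
by apply: (cCk_eq oU _ (cCkD oU (Cf i) IHr)) => x _; rewrite big_cons.
Qed.

Lemma cCkX k U f m : open U -> cCk k U f -> cCk k U (fun x => f x ^+ m).
Proof.
move=> oU Cf; elim: m => [|m IHm]; first exact: cCk_cst.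
by apply: (cCk_eq oU _ (cCkM oU Cf IHm)) => x _; rewrite exprS.
Qed.

Lemma cCkS k U f : cCk k.+1 U f <->
  (forall x, U x -> cdiff f x) /\ (forall v, cCk k U (cD v f)).
Proof.
split=> [[[d1 f1] [d2 f2]]|[d Cf]].
  by split=> [x Ux|v]; split; [exact: d1 | exact: d2 | exact: f1 | exact: f2].
by split; split=> [x /d[]|v] //; have [] := Cf v.
Qed.

Lemma cCk_cvg U f x : U x -> cCk 0 U f -> ccvg (nbhs x) f (f x).
Proof. by move=> Ux [f1 f2]; split; [exact: f1 | exact: f2]. Qed.

Lemma cdiff_near f g x : (\forall y \near x, f y = g y) -> cdiff f x -> cdiff g x.
Proof.
move=> fg [d1 d2]; split.
  by apply: differentiable_near_eq d1; apply: filterS fg => y ->.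
by apply: differentiable_near_eq d2; apply: filterS fg => y ->.
Qed.

Lemma cD_near v f g x : (\forall y \near x, f y = g y) -> cD v f x = cD v g x.
Proof.
move=> fg; congr (Complex _ _); apply: near_eq_derive; apply: filterS fg => y -> //.
Qed.

Lemma cDD v f g x : cdiff f x -> cdiff g x ->
  cdiff (fun y => f y + g y) x /\ cD v (fun y => f y + g y) x = cD v f x + cD v g x.
Proof.
move=> [f1 f2] [g1 g2].
have e1 : (fun y => re (f y + g y)) = (fun y => re (f y)) + (fun y => re (g y)).
  by apply/funext => y; rewrite reD.
have e2 : (fun y => im (f y + g y)) = (fun y => im (f y)) + (fun y => im (g y)).
  by apply/funext => y; rewrite imD.
split; first by split; [rewrite e1 | rewrite e2]; exact: differentiableD.
rewrite /cD e1 e2 !deriveD //; exact: diff_derivable.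
Qed.

Lemma cDM v f g x : cdiff f x -> cdiff g x ->
  cdiff (fun y => f y * g y) x /\
  cD v (fun y => f y * g y) x = cD v f x * g x + f x * cD v g x.
Proof.
move=> [f1 f2] [g1 g2].
have e1 : (fun y => re (f y * g y)) =
    (fun y => re (f y)) * (fun y => re (g y)) - (fun y => im (f y)) * (fun y => im (g y)).
  by apply/funext => y; rewrite reM.
have e2 : (fun y => im (f y * g y)) =
    (fun y => re (f y)) * (fun y => im (g y)) + (fun y => im (f y)) * (fun y => re (g y)).
  by apply/funext => y; rewrite imM.
split.
  by split; [rewrite e1; apply: differentiableB | rewrite e2; apply: differentiableD];
    exact: differentiableM.
have dv (h : V -> R) : differentiable h x -> derivable h x v by exact: diff_derivable.
rewrite /cD e1 e2 deriveB ?deriveD; try by apply: derivableM; exact: dv.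
rewrite !deriveM; try exact: dv.
apply/eqP; rewrite eq_complex reD imD !reM !imM /= /GRing.scale /=.
by apply/andP; split; apply/eqP; ring.
Qed.

Lemma cD_cst v (c : C) x : cdiff (fun=> c) x /\ cD v (fun=> c) x = 0.
Proof.
split; first by split; exact: differentiable_cst.
by congr (Complex _ _); exact: derive_cst.
Qed.

(** [al x - al y] is already of first order in [x - y], so the variation of the merely continuous
    [be] contributes only a smaller order. With a divided difference in [be], this gives the
    derivative of a root of which only continuity is known. *)
Lemma difference_mul (al be : V -> R) y : differentiable al y -> {for y, continuous be} ->
  differentiable (fun x => (al x - al y) * be x) y /\
  forall v, 'D_v (fun x => (al x - al y) * be x) y = 'D_v al y * be y.
Proof.
move=> da bc; have [l lc lE] := (differentiable_le al y).1 da.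
have lD : 'd al y = l :> (V -> R) by exact: diff_le.
have [k k0 lk] := linear_lipschitz lc.
pose L : {linear V -> R} := be y \*: l.
have Lc : continuous L by move=> x; apply: cvgZl_tmp; exact: lc.
have E (e : R) : 0 < e -> \forall h \near (0 : V),
    `|(al (h + y) - al y) * be (h + y) - ((al y - al y) * be y + L h)| <= e * `|h|.
  move=> e0; pose b := `|be y| + 1; have b0 : 0 < b by rewrite ltr_wpDl.
  have e1 : 0 < e / 2 / b by rewrite !divr_gt0.
  have e2 : 0 < e / 2 / k by rewrite !divr_gt0.
  have nb (e' : R) : 0 < e' -> \forall h \near (0 : V), `|be y - be (h + y)| <= e'.
    move=> e'0; have /cvgrPdist_le/(_ _ e'0) := bc.
    move=> H; have {}H : \forall z \near y, `|be y - be z| <= e' by exact: H.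
    by move: H; rewrite (near_shift 0) /= subr0.
  near=> h; rewrite subrr mul0r add0r.
  have h1 : `|al (h + y) - (al y + l h)| <= e / 2 / b * `|h| by near: h; exact: lE.
  have h2 : `|be y - be (h + y)| <= e / 2 / k by near: h; exact: nb.
  have h3 : `|be y - be (h + y)| <= 1 by near: h; exact: nb.
  have h4 : `|be (h + y)| <= b.
    rewrite -[be (h + y)](subKr (be y)); apply: le_trans (ler_normB _ _) _.
    by rewrite lerD.
  have -> : (al (h + y) - al y) * be (h + y) - L h =
    (al (h + y) - (al y + l h)) * be (h + y) - l h * (be y - be (h + y)).
    by rewrite /L /= /GRing.scale /=; ring.
  apply: le_trans (ler_normB _ _) _; rewrite !normrM.
  have -> : e * `|h| = e / 2 / b * `|h| * b + k * `|h| * (e / 2 / k).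
    by field; rewrite !gt_eqF.
  by rewrite lerD // ler_pM.
have df : differentiable (fun x => (al x - al y) * be x) y.
  by apply/differentiable_le; exists L.
split=> // v; rewrite !deriveE // (diff_le Lc E) lD /L /= /GRing.scale /=.
exact: mulrC.
Unshelve. all: by end_near. Qed.

Lemma cdifference_mul al be y : cdiff al y -> ccvg (nbhs y) be (be y) ->
  cdiff (fun x => (al x - al y) * be x) y /\
  forall v, cD v (fun x => (al x - al y) * be x) y = cD v al y * be y.
Proof.
move=> [a1 a2] [b1 b2].
have [d11 D11] := difference_mul a1 b1; have [d12 D12] := difference_mul a1 b2.
have [d21 D21] := difference_mul a2 b1; have [d22 D22] := difference_mul a2 b2.
have e1 : (fun x => re ((al x - al y) * be x)) =
  (fun x => (re (al x) - re (al y)) * re (be x)) - (fun x => (im (al x) - im (al y)) * im (be x)).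
  by apply/funext => x; rewrite reM reD imD reN imN.
have e2 : (fun x => im ((al x - al y) * be x)) =
  (fun x => (re (al x) - re (al y)) * im (be x)) + (fun x => (im (al x) - im (al y)) * re (be x)).
  by apply/funext => x; rewrite imM reD imD reN imN.
split.
  by split; [rewrite e1; exact: differentiableB | rewrite e2; exact: differentiableD].
move=> v; rewrite /cD e1 e2 deriveB ?deriveD; try exact: diff_derivable.
rewrite D11 D12 D21 D22; apply/eqP; rewrite eq_complex reM imM /=.
by rewrite eqxx /= addrC.
Qed.

End ComplexSmooth.

(** * Smooth dependence of simple roots *)

Section DividedDifference.
Context {A : comNzRingType}.
Implicit Types (p : {poly A}) (z w : A).

(** [(p(z) - p(w)) / (z - w)] as a polynomial expression, which makes sense on the diagonal. The
    bound [d] fixes the number of terms while the polynomial varies. *)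
Definition divdiff d p z w : A :=
  \sum_(i < d) p`_i * \sum_(j < i) z ^+ (i.-1 - j) * w ^+ j.

Lemma divdiffE d p z w : (size p <= d)%N -> p.[z] - p.[w] = (z - w) * divdiff d p z w.
Proof.
move=> sp; rewrite !(horner_coef_wide _ sp) -sumrB mulr_sumr; apply: eq_bigr => i _.
by rewrite -mulrBr subrXX mulrCA.
Qed.

Lemma divdiff_diag d p z : (size p <= d)%N -> divdiff d p z z = p^`().[z].
Proof.
move=> sp; have {2}-> : p = \sum_(i < d) p`_i *: 'X^i.
  by rewrite -poly_def; apply/polyP => i; rewrite coef_poly; case: ltnP => // /(leq_trans sp) /leq_sizeP ->.
rewrite raddf_sum horner_sum; apply: eq_bigr => i _.
rewrite /= derivZ derivXn !hornerE hornerMn hornerXn; congr (_ * _).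
rewrite (eq_bigr (fun=> z ^+ i.-1)); first by rewrite sumr_const card_ord.
by move=> j _; rewrite -exprD subnK // -ltnS prednK // (leq_ltn_trans _ (ltn_ord j)).
Qed.

End DividedDifference.

Section SmoothRoot.
Context {R : realType} {V : normedModType R}.
Local Notation C := R[i].
Implicit Types (U : set V) (v : V).

Lemma ccvg_divdiff (T : Type) (F : set_system T) (FF : Filter F) d
    (p : T -> {poly C}) (q : {poly C}) (f g : T -> C) (a b : C) :
  (forall i, ccvg F (fun x => (p x)`_i) q`_i) -> ccvg F f a -> ccvg F g b ->
  ccvg F (fun x => divdiff d (p x) (f x) (g x)) (divdiff d q a b).
Proof.
move=> pq fa gb; apply: ccvg_sum => i; apply: ccvgM => //; apply: ccvg_sum => j.
by apply: ccvgM; exact: ccvgX.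
Qed.

Lemma ccvg_comp (T T' : Type) (F : set_system T) (G : set_system T') (FF : Filter F)
    (FG : Filter G) (h : T -> T') (f : T' -> C) l :
  h @ F --> G -> ccvg G f l -> ccvg F (fun x => f (h x)) l.
Proof. by move=> hG [f1 f2]; split; [exact: cvg_comp f1 | exact: cvg_comp f2]. Qed.

Lemma csmooth_horner k U (P : V -> {poly C}) (r : V -> C) d : open U ->
  (forall x, (size (P x) <= d)%N) -> (forall i, cCk k U (fun x => (P x)`_i)) -> cCk k U r ->
  cCk k U (fun x => (P x).[r x]).
Proof.
move=> oU sP CP Cr; apply: (cCk_eq (f := fun x => \sum_(i < d) (P x)`_i * r x ^+ i)) => //.
  by move=> x _; rewrite (horner_coef_wide _ (sP x)).
by apply: cCk_sum => // i; apply: cCkM => //; exact: cCkX.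
Qed.

Lemma cD_lincomb (I : finType) v (f : I -> V -> C) (c : I -> C) y :
  (forall i, cdiff (f i) y) ->
  cdiff (fun x => \sum_i f i x * c i) y /\
  cD v (fun x => \sum_i f i x * c i) y = \sum_i cD v (f i) y * c i.
Proof.
move=> df; elim: (index_enum I) => [|i s [IH1 IH2]].
  rewrite big_nil; under [fun x => _]eq_fun do rewrite big_nil.
  exact: cD_cst.
rewrite big_cons; under [fun x => _]eq_fun do rewrite big_cons.
have [cc cE] := cD_cst v (c i) y.
have [d1 E1] := cDM v (df i) cc.
by have [d2 ->] := cDD v d1 IH1; rewrite E1 cE mulr0 addr0 IH2.
Qed.

(* The divided difference of [P x] between [r x] and [r y] stays away from 0, so that
   [r x - r y] is a difference of smooth functions of [x] over a continuous function. *)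
Lemma simple_root_smooth U (P : V -> {poly C}) (r : V -> C) d x0 : open U -> U x0 ->
  (forall x, size (P x) <= d)%N -> (forall i k, cCk k U (fun x => (P x)`_i)) ->
  (forall x, U x -> (P x).[r x] = 0) -> ccvg (nbhs x0) r (r x0) ->
  (P x0)^`().[r x0] != 0 ->
  exists V', [/\ open V', V' x0, V' `<=` U & forall k, cCk k V' r].
Proof.
move=> oU Ux0 sP CP rP rc simple.
pose Q x y := divdiff d (P x) (r x) (r y).
have Pc x i : U x -> ccvg (nbhs x) (fun x => (P x)`_i) (P x)`_i.
  by move=> Ux; exact: cCk_cvg Ux (CP i 0).
have Qc : ccvg (nbhs (x0, x0)) (fun z => Q z.1 z.2) (Q x0 x0).
  apply: ccvg_divdiff => [i||].
  - exact: (ccvg_comp _ _ cvg_fst (Pc x0 i Ux0)).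
  - exact: (ccvg_comp _ _ cvg_fst rc).
  - exact: (ccvg_comp _ _ cvg_snd rc).
have Q0 : 0 < nm2 (Q x0 x0).
  by rewrite lt_neqAle nm2_ge0 andbT eq_sym nm2_eq0 /Q divdiff_diag.
pose dl := nm2 (Q x0 x0) / 2; have dl0 : 0 < dl by rewrite divr_gt0.
have [V' [oV V0 VU VQ]] : exists V', [/\ open V', V' x0, V' `<=` U &
    forall x y, V' x -> V' y -> dl <= nm2 (Q x y)].
  have /cvgrPdist_le/(_ _ dl0) : (fun z => nm2 (Q z.1 z.2)) @ nbhs (x0, x0) --> nm2 (Q x0 x0).
    exact: cvg_nm2 Qc.
  move=> [[A B] /= [nA nB] AB].
  have /nbhs_ballP[e /= e0 eP] : nbhs x0 (A `&` B `&` U).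
    by apply: filterI; [exact: filterI | exact: open_nbhs_nbhs].
  exists (ball x0 e); split; [exact: ball_open|exact: ballxx|by move=> y /eP[]|].
  move=> x y /eP[[Ax _] _] /eP[[_ By] _].
  have := AB (x, y) (conj Ax By); rewrite /= => h.
  have : nm2 (Q x0 x0) - nm2 (Q x y) <= dl by apply: le_trans (ler_norm _) h.
  rewrite /dl; move: (nm2 (Q x0 x0)) (nm2 (Q x y)) => s t; lra.
exists V'; split=> //.
have Qn0 x y : V' x -> V' y -> Q x y != 0.
  by move=> Vx Vy; rewrite -nm2_eq0 gt_eqF // (lt_le_trans dl0) // VQ.
pose al y x := (P x).[r y].
have Cal k y : cCk k V' (al y).
  apply: (csmooth_horner (d := d)) => // [i|]; last exact: cCk_cst.
  exact: cCk_sub VU (CP i k).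
(* [P x] vanishes at [r x] and [P y] at [r y], so [al y x - al y y] is the difference of the values
   of [P x] at [r y] and at [r x]. *)
have rE x y : V' x -> V' y -> r x - r y = - ((al y x - al y y) / Q x y).
  move=> Vx Vy; apply: (mulIf (Qn0 x y Vx Vy)).
  rewrite mulNr divfK ?Qn0 // -divdiffE // rP; last exact: VU.
  by rewrite /al (rP y) ?subr0 ?sub0r //; exact: VU.
have nV y : V' y -> \forall x \near y, V' x by move=> Vy; exact: near_open Vy _.
have rcont y : V' y -> ccvg (nbhs y) r (r y).
  move=> Vy; apply: ccvg_nm2.
  have a0 : (fun x => dl^-1 * nm2 (al y x - al y y)) @ nbhs y --> (0 : R).
    have -> : (0 : R) = dl^-1 * 0 by rewrite mulr0.
    apply: cvgZl_tmp.
    have : ccvg (nbhs y) (fun x => al y x - al y y) (al y y - al y y).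
      by apply: ccvgD; [exact: cCk_cvg Vy (Cal 0 y) | exact: ccvg_cst].
    by move=> /cvg_nm2; rewrite subrr /nm2 /= expr0n addr0.
  apply: (squeeze_cvgr (f := cst 0) (h := fun x => dl^-1 * nm2 (al y x - al y y))) => //; last exact: cvg_cst.
  near=> x; have Vx : V' x by near: x; exact: nV.
  rewrite nm2_ge0 /= rE // nm2N nm2M mulrC.
  have -> : nm2 (Q x y)^-1 = (nm2 (Q x y))^-1.
    by apply: (mulfI (x := nm2 (Q x y))); rewrite ?nm2_eq0 ?Qn0 // -nm2M !divff ?nm2_eq0 ?Qn0 // /nm2 /= expr1n expr0n addr0.
  by rewrite ler_wpM2r ?nm2_ge0 // lef_pV2 ?posrE ?VQ // (lt_le_trans dl0) ?VQ.
pose be y x := - (Q x y)^-1.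
have bec y : V' y -> ccvg (nbhs y) (be y) (be y y).
  move=> Vy; apply: ccvgN; apply: ccvgV; first exact: Qn0.
  apply: ccvg_divdiff; [move=> i; exact/Pc/VU | exact: rcont | exact: ccvg_cst].
have rder y : V' y -> cdiff r y /\ forall v, cD v r y = cD v (al y) y * be y y.
  move=> Vy; have [|d0 D0] := @cdifference_mul _ _ (al y) (be y) y _ (bec y Vy).
    by have [] := (cCkS 0 V' (al y)).1 (Cal 1 y) => d1 _; exact: d1.
  have nE : \forall x \near y, r y + (al y x - al y y) * be y x = r x.
    near=> x; have Vx : V' x by near: x; exact: nV.
    by rewrite /be mulrN -rE // addrC subrK.
  have [dc Dc] : cdiff (fun x => r y + (al y x - al y y) * be y x) y /\ forall v,
      cD v (fun x => r y + (al y x - al y y) * be y x) y = cD v (al y) y * be y y.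
    have cc v := cD_cst v (r y) y.
    split=> [|v]; first by have [] := cDD 0 (cc 0).1 d0.
    by have [_ ->] := cDD v (cc v).1 d0; rewrite (cc v).2 add0r D0.
  by split=> [|v]; [exact: cdiff_near nE dc | rewrite -(cD_near v nE)].
have alD v y : V' y -> cD v (al y) y = \sum_(i < d) cD v (fun x => (P x)`_i) y * r y ^+ i.
  move=> Vy.
  have dP i : cdiff (fun x => (P x)`_i) y.
    by have [dd _] := (cCkS 0 U _).1 (CP i 1); apply: dd; exact: VU.
  have -> : al y = (fun x => \sum_(i < d) (P x)`_i * r y ^+ i).
    by apply/funext => x; rewrite /al (horner_coef_wide _ (sP x)).
  exact: (@cD_lincomb 'I_d v (fun i x => (P x)`_i) (fun i => r y ^+ i) y (fun i => dP i)).2.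
(* Bootstrapping: the derivative of [r] is an expression in [r] itself, the coefficients of [P] and
   their derivatives, so each order of smoothness gives the next. *)
suff H k : cCk k V' r by [].
elim: k => [|k IHk].
  split=> y Vy; have [[d1 d2] _] := rder y Vy; exact: differentiable_continuous.
apply/cCkS; split=> [y Vy|v]; first by have [] := rder y Vy.
have CQ : cCk k V' (fun y => be y y).
  apply: cCkN => //; apply: cCkV => //; first by move=> y Vy; exact: Qn0.
  apply: (cCk_eq (f := fun y => (P y)^`().[r y])) => //.
    by move=> y _; rewrite /Q divdiff_diag.
  apply: (csmooth_horner (d := d)) => //.
    move=> x; apply/leq_sizeP => j dj.
    by rewrite coef_deriv (leq_sizeP _ _ (sP x)) ?mul0rn // leqW.
  move=> i; apply: (cCk_eq (f := fun x => (P x)`_i.+1 * i.+1%:R)) => //.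
    by move=> x _; rewrite coef_deriv mulr_natr.
  apply: cCkM => //; last exact: cCk_cst.
  exact: cCk_sub VU (CP _ k).
have Ca : cCk k V' (fun y => \sum_(i < d) cD v (fun x => (P x)`_i) y * r y ^+ i).
  apply: cCk_sum => // i; apply: cCkM => //; last exact: cCkX.
  by have [_ CD] := (cCkS k U _).1 (CP i k.+1); exact: cCk_sub VU (CD v).
apply: (cCk_eq oV _ (cCkM oV Ca CQ)) => y Vy.
by rewrite (rder y Vy).2 alD.
Unshelve. all: by end_near. Qed.

End SmoothRoot.

(** * Multiple roots of constant multiplicity *)

Section Multiplicity.
Context {A : comNzRingType}.
Implicit Types (p q : {poly A}) (z : A).

Lemma derivn_mul_XsubC_exp m q z : ((('X - z%:P) ^+ m * q)^`(m)).[z] = (m`!)%:R * q.[z].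
Proof.
elim: m q => [|m IHm] q; first by rewrite expr0 !mul1r.
rewrite derivSn derivM deriv_exp derivXsubC mul1r /=.
have -> : ('X - z%:P) ^+ m *+ m.+1 * q + ('X - z%:P) ^+ m.+1 * q^`() =
    ('X - z%:P) ^+ m * (q *+ m.+1 + ('X - z%:P) * q^`()).
  by rewrite mulrDr mulrnAr mulrnAl mulrA -exprSr.
rewrite IHm hornerD hornerM hornerXsubC subrr mul0r addr0 hornerMn factS natrM.
by rewrite -[q.[z] *+ _]mulr_natl mulrA [(m`!)%:R * _]mulrC.
Qed.

Lemma derivn_mul_XsubC_exp0 m k q z : (k < m)%N -> ((('X - z%:P) ^+ m * q)^`(k)).[z] = 0.
Proof.
move=> km; rewrite -(subnKC (ltnW km)) exprD -mulrA derivn_mul_XsubC_exp.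
rewrite hornerM horner_exp hornerXsubC subrr expr0n subn_eq0 leqNgt km /=.
by rewrite mul0r mulr0.
Qed.

End Multiplicity.

Section ContinuousRoots.
Context {R : realType} {V : normedModType R}.
Local Notation C := R[i].
Implicit Types (U : set V) (P : V -> {poly C}).

(** A root of [P x] is chosen within the bound of [nearest_root]; the bound is a root of
    [|P_x(z0)|], which tends to 0. *)
Lemma continuous_root P d x0 z0 : (forall x, P x \is monic) -> (forall x, size (P x) = d.+2) ->
  (forall i, ccvg (nbhs x0) (fun x => (P x)`_i) (P x0)`_i) -> root (P x0) z0 ->
  exists r : V -> C, [/\ forall x, root (P x) (r x), r x0 = z0 & ccvg (nbhs x0) r z0].
Proof.
move=> mP sP cP z0P.
have ch x : exists y, root (P x) y /\ nm2 (z0 - y) ^+ d.+1 <= nm2 (P x).[z0].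
  by have [y ry yz] := nearest_root z0 (mP x) (sP x); exists y.
have [r rP] := choice ch.
have Pz : ccvg (nbhs x0) (fun x => (P x).[z0]) (P x0).[z0].
  by apply: (ccvg_horner (d := d.+2)) => // [x||]; rewrite ?sP //; exact: ccvg_cst.
rewrite (rootP z0P) in Pz.
have n0 : nm2 (0 : C) = 0 by apply/eqP; rewrite nm2_eq0.
exists r; split=> [x||]; first by have [] := rP x.
  have [_] := rP x0; rewrite (rootP z0P) n0 => h.
  apply/eqP; rewrite eq_sym -subr_eq0 -nm2_eq0.
  by have := h; rewrite le_eqVlt ltNge exprn_ge0 ?nm2_ge0 //= orbF expf_eq0.
apply: ccvg_nm2; apply/cvgrPdist_lt => e e0.
have /cvgrPdist_lt h0 : (fun x => nm2 (P x).[z0]) @ nbhs x0 --> nm2 (0 : C) by exact: cvg_nm2.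
have := h0 _ (exprn_gt0 d.+1 e0); apply: filterS => x.
rewrite n0 !sub0r !normrN !ger0_norm ?nm2_ge0 // => h.
have [_ h2] := rP x; rewrite -nm2N opprB.
by rewrite -(@ltr_pXn2r _ d.+1) ?nnegrE ?nm2_ge0 ?ltW // (le_lt_trans h2).
Qed.

Lemma near_ccvg_neq0 (f : V -> C) (x : V) l : ccvg (nbhs x) f l -> l != 0 -> \forall y \near x, f y != 0.
Proof.
move=> fl l0; have n0 : nm2 l != 0 by rewrite nm2_eq0.
have : \forall y \near x, nm2 (f y) != 0 by exact: cvgr_neq0 (cvg_nm2 fl) n0.
by apply: filterS => y; rewrite nm2_eq0.
Qed.

Lemma root_prod_exp (s : nat) (m : 'I_s -> nat) (la : 'I_s -> C) z :
  root (\prod_(a < s) ('X - (la a)%:P) ^+ m a) z -> exists a, z = la a.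
Proof.
rewrite /root horner_prod => /prodf_eq0[a _]; rewrite horner_exp hornerXsubC => h.
by exists a; move: h; rewrite expf_eq0 subr_eq0 => /andP[_ /eqP].
Qed.

(* Near a multiple root the multiplicities can only drop, while their sum is constant. *)
Lemma cluster_permutation (s : nat) (m : 'I_s -> nat) (la ze : 'I_s -> C) (p : {poly C}) :
  p = \prod_(a < s) ('X - (la a)%:P) ^+ m a -> injective ze ->
  (forall b, root p (ze b)) -> (forall b, p^`(m b).[ze b] != 0) ->
  p = \prod_(a < s) ('X - (ze a)%:P) ^+ m a.
Proof.
move=> pE zeI zr zm.
have ch b : exists a, ze b = la a by apply: (@root_prod_exp s m); rewrite -pE.
have [sg sgE] := choice ch.
have sI : injective sg by move=> a b ab; apply: zeI; rewrite !sgE ab.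
have mle b : (m (sg b) <= m b)%N.
  rewrite leqNgt; apply: contra (zm b) => mlt; apply/eqP.
  by rewrite pE (bigD1 (sg b)) //= sgE derivn_mul_XsubC_exp0.
pose sp := perm sI.
have msum : (\sum_b m (sg b) = \sum_b m b)%N.
  by rewrite [RHS](reindex_inj sI).
have meq b : m (sg b) = m b.
  have := (leqif_sum (fun b (_ : true) => leqif_eq (mle b))).2; rewrite msum eqxx => /esym/forallP/(_ b) /eqP.
  by [].
rewrite pE (reindex_inj sI); apply: eq_bigr => b _.
by rewrite meq sgE.
Qed.

(** The given [lam] may be permuted from point to point and carry no continuity; only their values
    at [x0] and the multiplicities are kept. A root of multiplicity exactly [m b] is a simple root
    of the derivative of order [m b - 1]. Constancy of the multiplicities keeps [r b] a root of that
    derivative near [x0], so [simple_root_smooth] applies. *)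
Lemma eigenvalue_functions U (P : V -> {poly C}) d (s : nat) (m : 'I_s -> nat)
    (lam : 'I_s -> V -> C) x0 : open U -> U x0 ->
  (forall x, P x \is monic) -> (forall x, size (P x) = d.+2) ->
  (forall i k, cCk k U (fun x => (P x)`_i)) -> (forall a, 0 < m a)%N ->
  (forall x, U x -> injective (lam^~ x) /\ P x = \prod_(a < s) ('X - (lam a x)%:P) ^+ m a) ->
  exists r : 'I_s -> V -> C, exists V', [/\ open V', V' x0, V' `<=` U & [/\
    injective (r^~ x0), forall b k, cCk k V' (r b) &
    forall x, V' x -> P x = \prod_(a < s) ('X - (r a x)%:P) ^+ m a]].
Proof.
move=> oU Ux0 mP sP CP m0 lamP; have [lamI PE] := lamP x0 Ux0.
have Pc i : ccvg (nbhs x0) (fun x => (P x)`_i) (P x0)`_i by exact: cCk_cvg Ux0 (CP i 0).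
have ch b : exists r : V -> C,
    [/\ forall x, root (P x) (r x), r x0 = lam b x0 & ccvg (nbhs x0) r (lam b x0)].
  apply: (continuous_root (d := d)) => //.
  rewrite PE /root horner_prod (bigD1 b) //= horner_exp hornerXsubC subrr.
  by rewrite expr0n eqn0Ngt m0 mul0r.
have [r rP] := choice ch.
have [rr r0 rc] : [/\ forall b x, root (P x) (r b x), forall b, r b x0 = lam b x0 &
    forall b, ccvg (nbhs x0) (r b) (lam b x0)].
  by split=> b; have [] := rP b.
have dP k i : ccvg (nbhs x0) (fun x => (P x)^`(k)`_i) (P x0)^`(k)`_i.
  rewrite coef_derivn -mulr_natr.
  under [fun x => _]eq_fun do rewrite coef_derivn -mulr_natr.
  by apply: ccvgM; [exact: Pc | exact: ccvg_cst].
have sd k x : (size (P x)^`(k) <= d.+2)%N.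
  apply/leq_sizeP => j dj; rewrite coef_derivn (leq_sizeP _ d.+2 _) ?mul0rn ?sP //.
  exact: leq_trans dj (leq_addl _ _).
have simple b : (P x0)^`(m b).[lam b x0] != 0.
  rewrite PE (bigD1 b) //= derivn_mul_XsubC_exp mulf_neq0 //.
  rewrite horner_prod; apply/prodf_neq0 => a ab.
  rewrite horner_exp hornerXsubC expf_neq0 // subr_eq0.
  by apply: contraNneq ab => /lamI ->.
have n1 (b : 'I_s) : \forall x \near x0, (P x)^`(m b).[r b x] != 0.
  apply: (near_ccvg_neq0 _ (simple b)); apply: (ccvg_horner (d := d.+2)) => //.
have n2 (ab : 'I_s * 'I_s) : \forall x \near x0, ab.1 != ab.2 -> r ab.1 x - r ab.2 x != 0.
  have [e|ne] := eqVneq ab.1 ab.2; first exact: nearW.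
  have : \forall x \near x0, r ab.1 x - r ab.2 x != 0.
    apply: (@near_ccvg_neq0 _ _ (lam ab.1 x0 - lam ab.2 x0)).
      by apply: ccvgD => //; exact: ccvgN.
    by rewrite subr_eq0; apply: contraNneq ne => /lamI ->.
  by apply: filterS.
have nn1 : \forall x \near x0, forall b, (P x)^`(m b).[r b x] != 0 by exact: filter_forall n1.
have nn2 : \forall x \near x0, forall ab : 'I_s * 'I_s, ab.1 != ab.2 -> r ab.1 x - r ab.2 x != 0.
  exact: filter_forall n2.
have /nbhs_ballP[e /= e0 eP] : nbhs x0 (U `&`
   ([set x | forall b, (P x)^`(m b).[r b x] != 0] `&`
    [set x | forall ab : 'I_s * 'I_s, ab.1 != ab.2 -> r ab.1 x - r ab.2 x != 0])).
  by apply: filterI; [exact: open_nbhs_nbhs | exact: filterI].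
have rE x : ball x0 e x -> P x = \prod_(a < s) ('X - (r a x)%:P) ^+ m a.
  move=> /eP[Ux [h1 h2]]; have [_ PEx] := lamP x Ux.
  apply: (cluster_permutation PEx) => // a b /eqP; rewrite -subr_eq0.
  by apply: contraTeq => ab; exact: (h2 (a, b)).
have sm b : exists V', [/\ open V', V' x0, V' `<=` ball x0 e & forall k, cCk k V' (r b)].
  apply: (@simple_root_smooth _ _ (ball x0 e) (fun x => (P x)^`((m b).-1)) (r b) d.+2).
  - exact: ball_open.
  - exact: ballxx.
  - exact: sd.
  - move=> i k; apply: (cCk_eq (f := fun x => (P x)`_((m b).-1 + i) * (((m b).-1 + i) ^_ (m b).-1)%:R)).
    + exact: ball_open.
    + by move=> x _; rewrite coef_derivn mulr_natr.
    apply: cCkM; [exact: ball_open | | exact: cCk_cst].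
    by apply: cCk_sub (CP _ k) => x /eP[].
  - move=> x Bx; rewrite (rE x Bx) (bigD1 b) //= derivn_mul_XsubC_exp0 //.
    by rewrite prednK.
  - by rewrite r0; exact: rc.
  by rewrite r0 -derivnS prednK.
have [W WP] := choice sm.
have nW (b : 'I_s) : \forall x \near x0, W b x.
  by have [oW W0 _ _] := WP b; exact: open_nbhs_nbhs.
have nnW : \forall x \near x0, forall b, W b x by exact: filter_forall nW.
have /nbhs_ballP[e' /= e'0 e'P] : nbhs x0 (ball x0 e `&` [set x | forall b, W b x]).
  by apply: filterI => //; exact: nbhsx_ballx.
exists r, (ball x0 e'); split; [exact: ball_open|exact: ballxx|by move=> x /e'P[/eP[]]|].
split.
- by move=> a b; rewrite /= !r0 => /lamI.
- by move=> b k; have [_ _ _ CW] := WP b; apply: cCk_sub (CW k) => x /e'P[_ /(_ b)].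
by move=> x /e'P[Bx _]; exact: rE.
Qed.

(** 1 is a simple root of [X^(k+1) - f(x0)]. *)
Lemma smooth_kth_root U (f : V -> C) k x0 : open U -> U x0 -> (forall j, cCk j U f) ->
  f x0 = 1 -> exists r : V -> C, exists V', [/\ open V', V' x0, V' `<=` U & [/\
    r x0 = 1, forall j, cCk j V' r & forall x, r x ^+ k.+1 = f x]].
Proof.
move=> oU Ux0 Cf f0; pose P x : {poly C} := 'X^(k.+1) - (f x)%:P.
have sP x : size (P x) = k.+2 by rewrite size_XnsubC.
have mP x : P x \is monic by rewrite monicXnsubC.
have Pi x i : (P x)`_i = (i == k.+1)%:R - f x * (i == 0%N)%:R.
  by rewrite coefB coefXn coefC; case: (i == 0%N); rewrite ?mulr1 ?mulr0.
have CP i j : cCk j U (fun x => (P x)`_i).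
  apply: (cCk_eq (f := fun x => (i == k.+1)%:R - f x * (i == 0%N)%:R)) => //.
  apply: cCkD => //; first exact: cCk_cst.
  by apply: cCkN => //; apply: cCkM => //; exact: cCk_cst.
have [||r [rr r0 rc]] := @continuous_root P k x0 1 mP sP.
- by move=> i; exact: cCk_cvg Ux0 (CP i 0).
- by rewrite /root !hornerE f0 expr1n subrr.
have rE x : r x ^+ k.+1 = f x.
  by have /rootP := rr x; rewrite !hornerE => /eqP; rewrite subr_eq0 => /eqP.
have [||||V' [oV V0 VU CV]] := @simple_root_smooth _ _ U P r k.+2 x0 oU Ux0 _ CP.
- by move=> x; rewrite sP.
- by move=> x _; apply/rootP.
- by rewrite r0.
- rewrite r0 derivB derivXn derivC subr0 hornerMn hornerXn expr1n.
  by rewrite pnatr_eq0.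
by exists r, V'; split.
Qed.

End ContinuousRoots.

(** * Germs of smooth complex functions *)

Section Germs.
Context {R : realType} {n : nat} (x0 : 'cV[R]_n.+1).
Local Notation C := R[i].
Local Notation V := 'cV[R]_n.+1.
Implicit Types (f g : V -> C).

Definition smooth_at f : Prop :=
  exists U : set V, [/\ open U, U x0 & forall k, cCk k U f].

Definition near_eq f g : Prop := \forall x \near x0, f x = g x.

Lemma near_eq_refl f : near_eq f f. Proof. by near=> x. Unshelve. all: by end_near. Qed.
Lemma near_eq_sym f g : near_eq f g -> near_eq g f.
Proof. by apply: filterS => x. Qed.
Lemma near_eq_trans f g h : near_eq f g -> near_eq g h -> near_eq f h.
Proof. by move=> fg; apply: filterS2 fg => x ->. Qed.
Hint Resolve near_eq_refl : core.

Lemma near_eq_open f g : near_eq f g -> exists U : set V, [/\ open U, U x0 & forall x, U x -> f x = g x].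
Proof.
move=> /nbhs_ballP[e /= e0 eP]; exists (ball x0 e).
by split; [exact: ball_open | exact: ballxx | exact: eP].
Qed.

Lemma smooth_at2 f g : smooth_at f -> smooth_at g ->
  exists U : set V, [/\ open U, U x0, forall k, cCk k U f & forall k, cCk k U g].
Proof.
move=> [U [oU Ux Cf]] [W [oW Wx Cg]]; exists (U `&` W); split=> // [|k|k].
- exact: openI.
- by apply: cCk_sub (Cf k) => x [].
- by apply: cCk_sub (Cg k) => x [].
Qed.

Lemma smooth_atD f g : smooth_at f -> smooth_at g -> smooth_at (fun x => f x + g x).
Proof.
move=> sf sg; have [U [oU Ux Cf Cg]] := smooth_at2 sf sg.
by exists U; split=> // k; exact: cCkD.
Qed.

Lemma smooth_atM f g : smooth_at f -> smooth_at g -> smooth_at (fun x => f x * g x).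
Proof.
move=> sf sg; have [U [oU Ux Cf Cg]] := smooth_at2 sf sg.
by exists U; split=> // k; exact: cCkM.
Qed.

Lemma smooth_atN f : smooth_at f -> smooth_at (fun x => - f x).
Proof. by move=> [U [oU Ux Cf]]; exists U; split=> // k; exact: cCkN. Qed.

Lemma smooth_at_cst (c : C) : smooth_at (fun=> c).
Proof. by exists setT; split=> //; [exact: openT | move=> k; exact: cCk_cst]. Qed.

Lemma smooth_at_cvg f : smooth_at f -> ccvg (nbhs x0) f (f x0).
Proof. by move=> [U [oU Ux Cf]]; exact: cCk_cvg Ux (Cf 0). Qed.

Lemma smooth_atV f : smooth_at f -> f x0 != 0 -> smooth_at (fun x => (f x)^-1).
Proof.
move=> sf f0; have := near_ccvg_neq0 (smooth_at_cvg sf) f0.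
case: sf => U [oU Ux Cf] /nbhs_ballP[e /= e0 eP].
have oUe : open (U `&` ball x0 e) by apply: openI => //; exact: ball_open.
exists (U `&` ball x0 e); split=> //; first by split=> //; exact: ballxx.
move=> k; apply: cCkV => // [x [_ /eP]//|].
by apply: cCk_sub (Cf k) => x [].
Qed.

Lemma smooth_at_cD v f : smooth_at f -> smooth_at (cD v f).
Proof.
move=> [U [oU Ux Cf]]; exists U; split=> // k.
by have [_ h] := (cCkS k U f).1 (Cf k.+1); exact: h.
Qed.

Lemma smooth_at_conj f : smooth_at f -> smooth_at (fun x => (f x)^*%C).
Proof.
move=> [U [oU Ux Cf]]; exists U; split=> // k; have [f1 f2] := Cf k.
split; first by apply: (Ck_eq oU _ f1) => x _; case: (f x).
by apply: (Ck_eq oU _ (CkN oU f2)) => x _; case: (f x).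
Qed.

Lemma near_eq_cD v f g : near_eq f g -> near_eq (cD v f) (cD v g).
Proof.
move=> /near_eq_open[U [oU Ux fg]]; apply: (near_open oU Ux) => x Ux'.
by apply: cD_near; exact: near_open oU Ux' fg.
Qed.

(* A germ is represented by a function chosen once and for all in its class. *)
Definition canon f : V -> C := xget (fun=> 0) [set g | smooth_at g /\ near_eq f g].

Lemma canonP f : smooth_at f -> smooth_at (canon f) /\ near_eq f (canon f).
Proof.
move=> sf; rewrite /canon; case: xgetP => [g _ //|/(_ f)] []; split=> //.
Qed.

Lemma canon_eq f g : near_eq f g -> canon f = canon g.
Proof.
move=> fg; congr (xget _ _); apply/seteqP; split=> h /= [sh fh]; split=> //.
  exact: near_eq_trans (near_eq_sym fg) fh.
exact: near_eq_trans fg fh.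
Qed.

Definition canonical_germ f : bool := `[< smooth_at f /\ canon f = f >].

Record germ := Germ { germ_fun : V -> C; germ_funP : canonical_germ germ_fun }.

HB.instance Definition _ := [isSub for germ_fun].
HB.instance Definition _ := [Choice of germ by <:].

Lemma canonical_canon f : smooth_at f -> canonical_germ (canon f).
Proof.
move=> sf; have [sc fc] := canonP sf; apply/asboolP; split=> //.
by apply: canon_eq; exact: near_eq_sym.
Qed.

(** The default germ of [insubd] is met only when [f] is not smooth near [x0]. *)
Definition mk f : germ :=
  insubd (Germ (canonical_canon (smooth_at_cst 0))) (canon f).

Lemma germ_smooth (a : germ) : smooth_at (germ_fun a).
Proof. by case: a => f /= /asboolP[]. Qed.
Hint Resolve germ_smooth : core.

Lemma mkK f : smooth_at f -> near_eq (germ_fun (mk f)) f.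
Proof.
move=> sf; rewrite /mk -[germ_fun _]/(val _) insubdK; last exact: canonical_canon.
by apply: near_eq_sym; exact: (canonP sf).2.
Qed.

Lemma germ_ext (a b : germ) : near_eq (germ_fun a) (germ_fun b) -> a = b.
Proof.
case: a b => [f fP] [g gP] /= fg; apply: val_inj => /=.
have /asboolP[_ <-] := fP; have /asboolP[_ <-] := gP; exact: canon_eq.
Qed.

Lemma mk_eqP f g : smooth_at f -> smooth_at g -> mk f = mk g <-> near_eq f g.
Proof.
move=> sf sg; split=> [e|fg].
  by apply: near_eq_trans (near_eq_sym (mkK sf)) _; rewrite e; exact: mkK.
apply: germ_ext; apply: near_eq_trans (mkK sf) _; apply: near_eq_trans fg _.
exact: near_eq_sym (mkK sg).
Qed.

Lemma germK (a : germ) : mk (germ_fun a) = a.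
Proof. by apply: germ_ext; exact: mkK. Qed.

Definition germ_add (a b : germ) := mk (fun x => germ_fun a x + germ_fun b x).
Definition germ_mul (a b : germ) := mk (fun x => germ_fun a x * germ_fun b x).
Definition germ_opp (a : germ) := mk (fun x => - germ_fun a x).

Lemma mk_add f g : smooth_at f -> smooth_at g ->
  germ_add (mk f) (mk g) = mk (fun x => f x + g x).
Proof.
move=> sf sg; apply/mk_eqP; try exact: smooth_atD.
by apply: filterS2 (mkK sf) (mkK sg) => x -> ->.
Qed.

Lemma mk_mul f g : smooth_at f -> smooth_at g ->
  germ_mul (mk f) (mk g) = mk (fun x => f x * g x).
Proof.
move=> sf sg; apply/mk_eqP; try exact: smooth_atM.
by apply: filterS2 (mkK sf) (mkK sg) => x -> ->.
Qed.

Lemma mk_opp f : smooth_at f -> germ_opp (mk f) = mk (fun x => - f x).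
Proof.
move=> sf; apply/mk_eqP; try exact: smooth_atN.
by apply: filterS (mkK sf) => x ->.
Qed.

Lemma germ_ind (P : germ -> Prop) : (forall f, smooth_at f -> P (mk f)) -> forall a, P a.
Proof. by move=> Pm a; rewrite -(germK a); exact: Pm. Qed.

Lemma germ_addA : associative germ_add.
Proof.
elim/germ_ind => f sf; elim/germ_ind => g sg; elim/germ_ind => h sh.
rewrite !mk_add //; try exact: smooth_atD.
by congr mk; apply/funext => x; rewrite addrA.
Qed.

Lemma germ_addC : commutative germ_add.
Proof.
elim/germ_ind => f sf; elim/germ_ind => g sg.
by rewrite !mk_add //; congr mk; apply/funext => x; rewrite addrC.
Qed.

Lemma germ_add0 : left_id (mk (fun=> 0)) germ_add.
Proof.
elim/germ_ind => f sf; rewrite mk_add //; last exact: smooth_at_cst.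
by congr mk; apply/funext => x; rewrite add0r.
Qed.

Lemma germ_addN : left_inverse (mk (fun=> 0)) germ_opp germ_add.
Proof.
elim/germ_ind => f sf; rewrite mk_opp // mk_add //; last exact: smooth_atN.
by congr mk; apply/funext => x; rewrite addNr.
Qed.

HB.instance Definition _ := GRing.isZmodule.Build germ germ_addA germ_addC germ_add0 germ_addN.

Lemma germ_mulA : associative germ_mul.
Proof.
elim/germ_ind => f sf; elim/germ_ind => g sg; elim/germ_ind => h sh.
rewrite !mk_mul //; try exact: smooth_atM.
by congr mk; apply/funext => x; rewrite mulrA.
Qed.

Lemma germ_mulC : commutative germ_mul.
Proof.
elim/germ_ind => f sf; elim/germ_ind => g sg.
by rewrite !mk_mul //; congr mk; apply/funext => x; rewrite mulrC.
Qed.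

Lemma germ_mul1 : left_id (mk (fun=> 1)) germ_mul.
Proof.
elim/germ_ind => f sf; rewrite mk_mul //; last exact: smooth_at_cst.
by congr mk; apply/funext => x; rewrite mul1r.
Qed.

Lemma germ_mulDl : left_distributive germ_mul germ_add.
Proof.
elim/germ_ind => f sf; elim/germ_ind => g sg; elim/germ_ind => h sh.
rewrite !(mk_mul, mk_add) //; try exact: smooth_atM; try exact: smooth_atD.
by congr mk; apply/funext => x; rewrite mulrDl.
Qed.

Lemma near_eq_at f g : near_eq f g -> f x0 = g x0.
Proof. by move=> fg; exact: nbhs_singleton fg. Qed.

Lemma germ_1_neq0 : mk (fun=> 1) != mk (fun=> 0).
Proof.
apply/eqP => /mk_eqP e; have := e (smooth_at_cst 1) (smooth_at_cst 0).
by move=> /near_eq_at /eqP; rewrite oner_eq0.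
Qed.

HB.instance Definition _ := GRing.Zmodule_isComNzRing.Build germ
  germ_mulA germ_mulC germ_mul1 germ_mulDl germ_1_neq0.

Lemma mkD f g : smooth_at f -> smooth_at g -> mk (fun x => f x + g x) = mk f + mk g.
Proof. by move=> sf sg; rewrite -mk_add. Qed.
Lemma mkM f g : smooth_at f -> smooth_at g -> mk (fun x => f x * g x) = mk f * mk g.
Proof. by move=> sf sg; rewrite -mk_mul. Qed.
Lemma mkN f : smooth_at f -> mk (fun x => - f x) = - mk f.
Proof. by move=> sf; rewrite -mk_opp. Qed.

Lemma mkB f g : smooth_at f -> smooth_at g -> mk (fun x => f x - g x) = mk f - mk g.
Proof. by move=> sf sg; rewrite mkD ?mkN //; exact: smooth_atN. Qed.

Definition ev (a : germ) : C := germ_fun a x0.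

Lemma ev_mk f : smooth_at f -> ev (mk f) = f x0.
Proof. by move=> sf; exact: near_eq_at (mkK sf). Qed.

Lemma ev_is_zmod_morphism : zmod_morphism ev.
Proof.
elim/germ_ind => f sf; elim/germ_ind => g sg; rewrite -mkN // -mkD //; last exact: smooth_atN.
by rewrite !ev_mk //; apply: smooth_atD => //; exact: smooth_atN.
Qed.

Lemma ev_is_monoid_morphism : monoid_morphism ev.
Proof.
split; first by rewrite -[1]/(mk (fun=> 1)) ev_mk //; exact: smooth_at_cst.
elim/germ_ind => f sf; elim/germ_ind => g sg; rewrite -mkM //.
by rewrite !ev_mk //; exact: smooth_atM.
Qed.

HB.instance Definition _ := GRing.isZmodMorphism.Build germ C ev ev_is_zmod_morphism.
HB.instance Definition _ := GRing.isMonoidMorphism.Build germ C ev ev_is_monoid_morphism.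

Definition germ_unit : {pred germ} := fun a => ev a != 0.
(** Non-units are returned unchanged, as the unit ring interface requires. *)
Definition germ_inv (a : germ) : germ :=
  if ev a != 0 then mk (fun x => (germ_fun a x)^-1) else a.

Lemma germ_mulV : {in germ_unit, left_inverse 1 germ_inv *%R}.
Proof.
move=> a; rewrite unfold_in => a0; rewrite /germ_inv a0 -{2}(germK a) -mkM //; last first.
  exact: smooth_atV.
apply/mk_eqP; [apply: smooth_atM => //; exact: smooth_atV | exact: smooth_at_cst |].
have := near_ccvg_neq0 (smooth_at_cvg (germ_smooth a)) a0.
by apply: filterS => x; exact: mulVf.
Qed.

Lemma germ_unitPl (a b : germ) : b * a = 1 -> germ_unit a.
Proof.
move=> ba; rewrite /germ_unit; apply/negP => /eqP a0.
have : ev (b * a) = 1 by rewrite ba; exact: (rmorph1 (ev : {rmorphism germ -> C})).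
by rewrite rmorphM /= a0 mulr0 => /esym/eqP; rewrite oner_eq0.
Qed.

Lemma germ_inv_out : {in [predC germ_unit], germ_inv =1 id}.
Proof. by move=> a /negP ha; rewrite /germ_inv; case: ifP => // a0; case: ha. Qed.

HB.instance Definition _ := GRing.ComNzRing_hasMulInverse.Build germ
  germ_mulV germ_unitPl germ_inv_out.

Lemma germ_unitE (a : germ) : (a \is a GRing.unit) = (ev a != 0).
Proof. by []. Qed.

Definition cst (c : C) : germ := mk (fun=> c).

Lemma cst_is_zmod_morphism : zmod_morphism cst.
Proof.
by move=> a b; rewrite /cst -mkB //; exact: smooth_at_cst.
Qed.

Lemma cst_is_monoid_morphism : monoid_morphism cst.
Proof.
by split=> // a b; rewrite /cst -mkM //; exact: smooth_at_cst.
Qed.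

HB.instance Definition _ := GRing.isZmodMorphism.Build C germ cst cst_is_zmod_morphism.
HB.instance Definition _ := GRing.isMonoidMorphism.Build C germ cst cst_is_monoid_morphism.

Definition cj (a : germ) : germ := mk (fun x => (germ_fun a x)^*%C).

Lemma cj_mk f : smooth_at f -> cj (mk f) = mk (fun x => (f x)^*%C).
Proof.
move=> sf; apply/mk_eqP; try exact: smooth_at_conj.
by apply: filterS (mkK sf) => x ->.
Qed.

Lemma cj_is_zmod_morphism : zmod_morphism cj.
Proof.
elim/germ_ind => f sf; elim/germ_ind => g sg.
rewrite -mkN // -mkD //; last exact: smooth_atN.
rewrite !cj_mk //; last by apply: smooth_atD => //; exact: smooth_atN.
rewrite -mkN -?mkD //; try apply: smooth_atN; try exact: smooth_at_conj.
by congr mk; apply/funext => x; rewrite rmorphB.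
Qed.

Lemma cj_is_monoid_morphism : monoid_morphism cj.
Proof.
split; first by rewrite cj_mk; [congr mk; apply/funext => x; rewrite rmorph1 | exact: smooth_at_cst].
elim/germ_ind => f sf; elim/germ_ind => g sg.
rewrite -mkM // !cj_mk //; last exact: smooth_atM.
rewrite -mkM //; try exact: smooth_at_conj.
by congr mk; apply/funext => x; rewrite rmorphM.
Qed.

HB.instance Definition _ := GRing.isZmodMorphism.Build germ germ cj cj_is_zmod_morphism.
HB.instance Definition _ := GRing.isMonoidMorphism.Build germ germ cj cj_is_monoid_morphism.

Definition dg (j : 'I_n.+1) (a : germ) : germ := mk (cD (delta_mx j 0) (germ_fun a)).

Lemma dg_mk j f : smooth_at f -> dg j (mk f) = mk (cD (delta_mx j 0) f).
Proof.
move=> sf; apply/mk_eqP; try exact: smooth_at_cD.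
by apply: near_eq_cD; exact: mkK.
Qed.

Lemma smooth_at_cdiff f : smooth_at f ->
  exists U : set V, [/\ open U, U x0 & forall x, U x -> cdiff f x].
Proof.
move=> [U [oU Ux Cf]]; exists U; split=> //.
by have [h _] := (cCkS 0 U f).1 (Cf 1).
Qed.

Lemma near_cdiff f : smooth_at f -> \forall x \near x0, cdiff f x.
Proof. by move=> /smooth_at_cdiff[U [oU Ux h]]; exact: near_open oU Ux h. Qed.

Lemma dg_is_zmod_morphism j : zmod_morphism (dg j).
Proof.
elim/germ_ind => f sf; elim/germ_ind => g sg.
have sNg := smooth_atN sg.
rewrite -mkN // -mkD // !dg_mk //; last exact: smooth_atD.
rewrite -mkN -?mkD //; try apply: smooth_atN; try exact: smooth_at_cD.
apply/mk_eqP; [apply: smooth_at_cD; exact: smooth_atD |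
  apply: smooth_atD; [|apply: smooth_atN]; exact: smooth_at_cD |].
apply: filterS2 (near_cdiff sf) (near_cdiff sg) => x df dg.
have [dc cE] := cD_cst (delta_mx j 0) (-1) x.
have [dN NE] := cDM (delta_mx j 0) dc dg.
have e : (fun x => - g x) = (fun y => -1 * g y) by apply/funext => y; rewrite mulN1r.
have -> : (fun y => f y - g y) = (fun y => f y + -1 * g y).
  by apply/funext => y; rewrite mulN1r.
have [_ ->] := cDD (delta_mx j 0) df dN.
by rewrite NE cE mul0r add0r mulN1r.
Qed.

HB.instance Definition _ j := GRing.isZmodMorphism.Build germ germ (dg j) (dg_is_zmod_morphism j).

Lemma dgM j a b : dg j (a * b) = dg j a * b + a * dg j b.
Proof.
elim/germ_ind: a => f sf; elim/germ_ind: b => g sg.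
have sd := smooth_at_cD (delta_mx j 0).
rewrite -mkM // !dg_mk //; last exact: smooth_atM.
rewrite -!mkM //; try exact: sd.
rewrite -mkD //; try (apply: smooth_atM => //; exact: sd).
apply/mk_eqP; [apply: sd; exact: smooth_atM | apply: smooth_atD; apply: smooth_atM => //; exact: sd |].
by apply: filterS2 (near_cdiff sf) (near_cdiff sg) => x df dg; have [_ ->] := cDM (delta_mx j 0) df dg.
Qed.

Lemma dgC i j a : dg i (dg j a) = dg j (dg i a).
Proof.
elim/germ_ind: a => f sf; have s1 v := smooth_at_cD v sf.
rewrite (dg_mk j sf) (dg_mk i sf) (dg_mk i (s1 _)) (dg_mk j (s1 _)).
apply/mk_eqP; [exact: smooth_at_cD | exact: smooth_at_cD |].
case: sf => U [oU Ux Cf]; apply: (near_open oU Ux) => x Ux'.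
have [f1 f2] := Cf 2.
have e1 := schwarz (delta_mx j 0) (delta_mx i 0) oU Ux' f1.
have e2 := schwarz (delta_mx j 0) (delta_mx i 0) oU Ux' f2.
apply/eqP; rewrite eq_complex; apply/andP; split; apply/eqP; [exact: e1 | exact: e2].
Qed.

Lemma dg_cst j c : dg j (cst c) = 0.
Proof.
rewrite /cst dg_mk; last exact: smooth_at_cst.
apply/mk_eqP; [exact/smooth_at_cD/smooth_at_cst | exact: smooth_at_cst |].
suff -> : cD (delta_mx j 0) (fun=> c) = (fun=> 0) :> (V -> C) by exact: near_eq_refl.
by apply/funext => x; have [] := cD_cst (delta_mx j 0) c x.
Qed.

Lemma dg_cj j a : dg j (cj a) = cj (dg j a).
Proof.
elim/germ_ind: a => f sf.
have sc := smooth_at_conj sf; have sd := smooth_at_cD (delta_mx j 0).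
rewrite cj_mk // !dg_mk // cj_mk //; last exact: sd.
apply/mk_eqP; [exact: sd | apply: smooth_at_conj; exact: sd |].
apply: filterS (near_cdiff sf) => x [d1 d2].
congr (Complex _ _).
  by congr ('D_ _ _ x); apply/funext => y; case: (f y).
have -> : (fun y => complex.Im (f y)^*%C) = - (fun y => complex.Im (f y)).
  by apply/funext => y; rewrite -[RHS]/(- complex.Im (f y)); case: (f y).
by rewrite deriveN //; exact: diff_derivable.
Qed.

Lemma ev_cj a : ev (cj a) = (ev a)^*%C.
Proof.
elim/germ_ind: a => f sf; rewrite cj_mk // !ev_mk //; exact: smooth_at_conj.
Qed.

Lemma cj_cst c : cj (cst c) = cst c^*%C.
Proof. by rewrite /cst cj_mk //; exact: smooth_at_cst. Qed.

Lemma cjK a : cj (cj a) = a.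
Proof.
elim/germ_ind: a => f sf; have sc := smooth_at_conj sf.
by rewrite !cj_mk //; congr mk; apply/funext => x; exact: conjcK.
Qed.

Lemma mkX f k : smooth_at f ->
  smooth_at (fun x => f x ^+ k) /\ mk (fun x => f x ^+ k) = mk f ^+ k.
Proof.
move=> sf; elim: k => [|k [s1 IH]]; first by split=> //; exact: smooth_at_cst.
have -> : (fun x => f x ^+ k.+1) = (fun x => f x * f x ^+ k).
  by apply/funext => x; rewrite exprS.
by split; [exact: smooth_atM | rewrite exprS -IH -mkM].
Qed.

Lemma germ_reduced (a : germ) k : a ^+ k = 0 -> a = 0.
Proof.
elim/germ_ind: a => f sf; have [s1 <-] := mkX k sf.
move=> /(mk_eqP s1 (smooth_at_cst 0)) h; apply/(mk_eqP sf (smooth_at_cst 0)).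
by apply: filterS h => x /eqP; rewrite expf_eq0 => /andP[_ /eqP].
Qed.

Lemma germ_roots (T : germ) k : ev T = 1 -> exists r : germ, r ^+ k.+1 = T /\ ev r = 1.
Proof.
elim/germ_ind: T => f sf; rewrite ev_mk // => f0; case: (sf) => U [oU Ux Cf].
have [r [V' [oV V0 VU [r0 Cr rE]]]] := smooth_kth_root k oU Ux Cf f0.
have sr : smooth_at r by exists V'.
exists (mk r); split; last by rewrite ev_mk.
by have [_ <-] := mkX k.+1 sr; congr mk; apply/funext.
Qed.

(** Real and imaginary parts have separate potentials, both 0 at [x0]. *)
Lemma germ_poincare (al : 'I_n.+1 -> germ) : (forall i j, dg j (al i) = dg i (al j)) ->
  exists u : germ, ev u = 0 /\ forall j, dg j u = al j.
Proof.
move=> sym; pose a i := germ_fun (al i).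
have ch i : exists U : set V, [/\ open U, U x0 & forall k, cCk k U (a i)] by exact: germ_smooth.
have [W WP] := choice ch.
have nW (i : 'I_n.+1) : \forall x \near x0, W i x.
  by have [oW W0 _] := WP i; exact: open_nbhs_nbhs.
have nS (ij : 'I_n.+1 * 'I_n.+1) : \forall x \near x0,
    cD (delta_mx ij.2 0) (a ij.1) x = cD (delta_mx ij.1 0) (a ij.2) x.
  have sd := smooth_at_cD; apply/(mk_eqP (sd _ _ (germ_smooth _)) (sd _ _ (germ_smooth _))).
  by rewrite -!dg_mk ?germK.
have nnW : \forall x \near x0, forall i, W i x by exact: filter_forall nW.
have nnS : \forall x \near x0, forall ij : 'I_n.+1 * 'I_n.+1,
    cD (delta_mx ij.2 0) (a ij.1) x = cD (delta_mx ij.1 0) (a ij.2) x by exact: filter_forall nS.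
have /nbhs_ballP[e /= e0 eP] : nbhs x0 ([set x | forall i, W i x] `&`
   [set x | forall ij : 'I_n.+1 * 'I_n.+1,
      cD (delta_mx ij.2 0) (a ij.1) x = cD (delta_mx ij.1 0) (a ij.2) x]) by exact: filterI.
have oB : open (ball x0 e) by exact: ball_open.
have Ca i k : cCk k (ball x0 e) (a i).
  by have [_ _ CW] := WP i; apply: cCk_sub (CW k) => x /eP[].
have [||F1 [V1 [oV1 V10 _ [F10 CF1 DF1]]]] :=
    @poincare_local R n (fun i x => complex.Re (a i x)) _ x0 oB (ballxx x0 e0).
- by move=> i k; have [] := Ca i k.
- by move=> i j y /eP[_ /(_ (i, j))] [].
have [||F2 [V2 [oV2 V20 _ [F20 CF2 DF2]]]] :=
    @poincare_local R n (fun i x => complex.Im (a i x)) _ x0 oB (ballxx x0 e0).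
- by move=> i k; have [] := Ca i k.
- by move=> i j y /eP[_ /(_ (i, j))] [].
pose u x : C := Complex (F1 x) (F2 x).
have oV : open (V1 `&` V2) by exact: openI.
have su : smooth_at u.
  exists (V1 `&` V2); split=> // k; split.
    by apply: Ck_sub (CF1 k) => x [].
  by apply: Ck_sub (CF2 k) => x [].
exists (mk u); split; first by rewrite ev_mk // /u F10 F20.
move=> j; rewrite dg_mk // -(germK (al j)); apply/mk_eqP => //; first exact: smooth_at_cD.
have V0 : (V1 `&` V2) x0 by [].
apply: (near_open oV V0) => x [V1x V2x].
by rewrite /cD /u /= DF1 // DF2 // /a; case: (germ_fun (al j) x).
Qed.

End Germs.

(** * Functions representing germs, and germ polynomials and matrices *)

Section Representatives.
Context {R : realType} {n : nat} (x0 : 'cV[R]_n.+1).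
Local Notation C := R[i].
Local Notation V := 'cV[R]_n.+1.
Local Notation germ := (germ x0).
Implicit Types (f g : V -> C) (a b : germ).

(** Identities of germs are transported to identities of functions near [x0] and back; [prep] and
    [mrep] do the same for polynomials and matrices. *)
Definition rep f a : Prop := smooth_at x0 f /\ a = mk x0 f.

Lemma rep_eq f g a b : rep f a -> rep g b -> near_eq x0 f g -> a = b.
Proof. by move=> [sf ->] [sg ->] fg; apply/mk_eqP. Qed.

Lemma rep_near f g a : rep f a -> rep g a -> near_eq x0 f g.
Proof. by move=> [sf ->] [sg /mk_eqP]; apply. Qed.

Lemma rep_ev f a : rep f a -> ev a = f x0.
Proof. by move=> [sf ->]; exact: ev_mk. Qed.

Lemma repD f g a b : rep f a -> rep g b -> rep (fun x => f x + g x) (a + b).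
Proof. by move=> [sf ->] [sg ->]; split; [exact: smooth_atD | rewrite mkD]. Qed.

Lemma repM f g a b : rep f a -> rep g b -> rep (fun x => f x * g x) (a * b).
Proof. by move=> [sf ->] [sg ->]; split; [exact: smooth_atM | rewrite mkM]. Qed.

Lemma repN f a : rep f a -> rep (fun x => - f x) (- a).
Proof. by move=> [sf ->]; split; [exact: smooth_atN | rewrite mkN]. Qed.

Lemma rep_cst c : rep (fun=> c) (cst x0 c).
Proof. by split; [exact: smooth_at_cst|]. Qed.

Lemma rep0 : rep (fun=> 0) 0. Proof. exact: rep_cst. Qed.
Lemma rep1 : rep (fun=> 1) 1. Proof. exact: rep_cst. Qed.

Lemma rep_sum (I : Type) (r : seq I) (f : I -> V -> C) (a : I -> germ) :
  (forall i, rep (f i) (a i)) -> rep (fun x => \sum_(i <- r) f i x) (\sum_(i <- r) a i).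
Proof.
move=> fa; elim: r => [|i r IHr].
  by rewrite big_nil; under [fun x => _]eq_fun do rewrite big_nil; exact: rep0.
by rewrite big_cons; under [fun x => _]eq_fun do rewrite big_cons; exact: repD.
Qed.

Lemma rep_d j f a : rep f a -> rep (cD (delta_mx j 0) f) (dg j a).
Proof. by move=> [sf ->]; split; [exact: smooth_at_cD | rewrite dg_mk]. Qed.

Lemma rep_eq_fun f g a : (forall x, f x = g x) -> rep f a -> rep g a.
Proof. by move=> fg; suff -> : f = g; [|apply/funext]. Qed.

Definition prep (P : V -> {poly C}) (p : {poly germ}) : Prop :=
  forall i, rep (fun x => (P x)`_i) p`_i.

Lemma prep_eq P Q p q : prep P p -> prep Q q -> (\forall x \near x0, P x = Q x) -> p = q.
Proof.
move=> Pp Qq PQ; apply/polyP => i; apply: rep_eq (Pp i) (Qq i) _.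
by apply: filterS PQ => x ->.
Qed.

Lemma prepD P Q p q : prep P p -> prep Q q -> prep (fun x => P x + Q x) (p + q).
Proof.
move=> Pp Qq i; rewrite coefD; under [fun x => _]eq_fun do rewrite coefD.
exact: repD.
Qed.

Lemma prepN P p : prep P p -> prep (fun x => - P x) (- p).
Proof.
move=> Pp i; rewrite coefN; under [fun x => _]eq_fun do rewrite coefN.
exact: repN.
Qed.

Lemma prepM P Q p q : prep P p -> prep Q q -> prep (fun x => P x * Q x) (p * q).
Proof.
move=> Pp Qq i; rewrite coefM; under [fun x => _]eq_fun do rewrite coefM.
by apply: rep_sum => j; exact: repM.
Qed.

Lemma prepC f a : rep f a -> prep (fun x => (f x)%:P) a%:P.
Proof.
move=> fa i; rewrite coefC; under [fun x => _]eq_fun do rewrite coefC.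
by case: (i == 0)%N => //; exact: rep0.
Qed.

Lemma prep1 : prep (fun=> 1) 1. Proof. exact: prepC rep1. Qed.
Lemma prep0 : prep (fun=> 0) 0. Proof. by move=> i; rewrite !coef0; exact: rep0. Qed.

Lemma prepX : prep (fun=> 'X) 'X.
Proof. by move=> i; rewrite !coefX; case: (i == 1)%N; [exact: rep1 | exact: rep0]. Qed.

Lemma prep_sum (I : Type) (r : seq I) (P : I -> V -> {poly C}) (p : I -> {poly germ}) :
  (forall i, prep (P i) (p i)) -> prep (fun x => \sum_(i <- r) P i x) (\sum_(i <- r) p i).
Proof.
move=> Pp; elim: r => [|i r IHr].
  by rewrite big_nil; under [fun x => _]eq_fun do rewrite big_nil; exact: prep0.
by rewrite big_cons; under [fun x => _]eq_fun do rewrite big_cons; exact: prepD.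
Qed.

Lemma prep_prod (I : Type) (r : seq I) (P : I -> V -> {poly C}) (p : I -> {poly germ}) :
  (forall i, prep (P i) (p i)) -> prep (fun x => \prod_(i <- r) P i x) (\prod_(i <- r) p i).
Proof.
move=> Pp; elim: r => [|i r IHr].
  by rewrite big_nil; under [fun x => _]eq_fun do rewrite big_nil; exact: prep1.
by rewrite big_cons; under [fun x => _]eq_fun do rewrite big_cons; exact: prepM.
Qed.

Lemma prep_exp P p k : prep P p -> prep (fun x => P x ^+ k) (p ^+ k).
Proof.
move=> Pp; elim: k => [|k IHk]; first exact: prep1.
by rewrite exprS; under [fun x => _]eq_fun do rewrite exprS; exact: prepM.
Qed.

Definition mrep p q (A : V -> 'M[C]_(p, q)) (M : 'M[germ]_(p, q)) : Prop :=
  forall i j, rep (fun x => A x i j) (M i j).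

Lemma mrep_eq p q (A B : V -> 'M[C]_(p, q)) M N : mrep A M -> mrep B N ->
  (\forall x \near x0, A x = B x) -> M = N.
Proof.
move=> AM BN AB; apply/matrixP => i j; apply: rep_eq (AM i j) (BN i j) _.
by apply: filterS AB => x ->.
Qed.

Lemma mrep_near p q (A B : V -> 'M[C]_(p, q)) M : mrep A M -> mrep B M ->
  \forall x \near x0, A x = B x.
Proof.
move=> AM BM; have H (ij : 'I_p * 'I_q) : \forall x \near x0, A x ij.1 ij.2 = B x ij.1 ij.2.
  exact: rep_near (AM _ _) (BM _ _).
have : \forall x \near x0, forall ij : 'I_p * 'I_q, A x ij.1 ij.2 = B x ij.1 ij.2.
  exact: filter_forall H.
apply: filterS => x h.
by apply/matrixP => i j; exact: (h (i, j)).
Qed.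

Lemma mrep_ev p q (A : V -> 'M[C]_(p, q)) M : mrep A M -> map_mx (@ev R n x0) M = A x0.
Proof. by move=> AM; apply/matrixP => i j; rewrite mxE; exact: rep_ev (AM i j). Qed.

Lemma mrep0 p q : mrep (fun=> 0 : 'M[C]_(p, q)) 0.
Proof.
move=> i j; suff -> : (fun x : V => (0 : 'M[C]_(p, q)) i j) = (fun=> 0) by rewrite mxE; exact: rep0.
by apply/funext => x; rewrite mxE.
Qed.

Lemma mrepD p q (A B : V -> 'M[C]_(p, q)) M N : mrep A M -> mrep B N ->
  mrep (fun x => A x + B x) (M + N).
Proof. by move=> AM BN i j; rewrite mxE; apply: rep_eq_fun (repD (AM i j) (BN i j)) => x; rewrite mxE. Qed.

Lemma mrepN p q (A : V -> 'M[C]_(p, q)) M : mrep A M -> mrep (fun x => - A x) (- M).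
Proof. by move=> AM i j; rewrite mxE; apply: rep_eq_fun (repN (AM i j)) => x; rewrite mxE. Qed.

Lemma mrepM p q r (A : V -> 'M[C]_(p, q)) (B : V -> 'M[C]_(q, r)) M N : mrep A M -> mrep B N ->
  mrep (fun x => A x *m B x) (M *m N).
Proof.
move=> AM BN i j; rewrite mxE; apply: (rep_eq_fun (f := fun x => \sum_k A x i k * B x k j)).
  by move=> x; rewrite mxE.
by apply: rep_sum => k; exact: repM.
Qed.

Lemma mrepZ p q f a (A : V -> 'M[C]_(p, q)) M : rep f a -> mrep A M ->
  mrep (fun x => f x *: A x) (a *: M).
Proof. by move=> fa AM i j; rewrite mxE; apply: rep_eq_fun (repM fa (AM i j)) => x; rewrite mxE. Qed.

Lemma mrep_sum (I : Type) (r : seq I) p q (A : I -> V -> 'M[C]_(p, q)) M :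
  (forall i, mrep (A i) (M i)) -> mrep (fun x => \sum_(i <- r) A i x) (\sum_(i <- r) M i).
Proof.
move=> AM i j; rewrite summxE; apply: (rep_eq_fun (f := fun x => \sum_(k <- r) A k x i j)).
  by move=> x; rewrite summxE.
by apply: rep_sum => k; exact: AM.
Qed.

Lemma mrep_scalar m f a : rep f a -> mrep (fun x => (f x)%:M : 'M[C]_m) a%:M.
Proof.
move=> fa i j; rewrite mxE; apply: (rep_eq_fun (f := fun x => f x *+ (i == j))).
  by move=> x; rewrite mxE.
by case: (i == j); rewrite ?mulr1n ?mulr0n //; exact: rep0.
Qed.

Lemma mrep_exp m (A : V -> 'M[C]_m.+1) M k : mrep A M -> mrep (fun x => A x ^+ k) (M ^+ k).
Proof.
move=> AM; elim: k => [|k IHk]; first exact: mrep_scalar rep1.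
rewrite exprS; under [fun x => _]eq_fun do rewrite exprS.
exact: mrepM.
Qed.

Definition cDmx p q v (A : V -> 'M[C]_(p, q)) (x : V) : 'M[C]_(p, q) :=
  \matrix_(i, j) cD v (fun y => A y i j) x.

Lemma mrep_d p q j (A : V -> 'M[C]_(p, q)) M : mrep A M ->
  mrep (cDmx (delta_mx j 0) A) (dmx (@dg R n x0) j M).
Proof.
move=> AM i k; rewrite mxE; apply: rep_eq_fun (rep_d j (AM i k)) => x.
by rewrite mxE.
Qed.

Lemma prep_char_poly m (A : V -> 'M[C]_m) M : mrep A M ->
  prep (fun x => char_poly (A x)) (char_poly M).
Proof.
move=> AM.
have E i j : prep (fun x => char_poly_mx (A x) i j) (char_poly_mx M i j).
  have X1 : prep (fun=> 'X *+ (i == j)) ('X *+ (i == j)).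
    by case: (i == j); [exact: prepX | exact: prep0].
  move=> k; rewrite !mxE; apply: rep_eq_fun (prepD X1 (prepN (prepC (AM i j))) k) => x.
  by rewrite !mxE.
apply: prep_sum => s; apply: prepM; last by apply: prep_prod => i; exact: E.
by apply: prep_exp; apply: prepN; exact: prep1.
Qed.

Lemma mrep_horner m (A : V -> 'M[C]_m.+1) M (p : {poly C}) : mrep A M ->
  mrep (fun x => horner_mx (A x) p) (horner_mx M (map_poly (cst x0) p)).
Proof.
move=> AM; elim/poly_ind: p => [|p c IHp].
  rewrite map_poly0 rmorph0; under [fun x => _]eq_fun do rewrite rmorph0.
  by move=> i j; rewrite !mxE; exact: rep0.
rewrite !rmorphD !rmorphM /= map_polyX map_polyC /= horner_mx_X horner_mx_C.
under [fun x => _]eq_fun do rewrite rmorphD rmorphM /= horner_mx_X horner_mx_C.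
by apply: mrepD; [exact: mrepM | exact: mrep_scalar (rep_cst c)].
Qed.

(** [symop] written for actual functions, so that the tensorial bracket at a point can be compared
    with the bracket of germs. *)
Definition csymop (L M : V -> 'M[C]_n.+1) j (x : V) : 'M[C]_n.+1 :=
  (\sum_l L x l j *: cDmx (delta_mx l 0) M x) - L x *m cDmx (delta_mx j 0) M x
  + M x *m (\matrix_(r, k) cD (delta_mx k 0) (fun y => L y r j) x)
  - (\matrix_(r, k) cD (delta_mx k 0) (fun y => L y r j) x) *m M x.

Lemma mrep_symop (A B : V -> 'M[C]_n.+1) L M j : mrep A L -> mrep B M ->
  mrep (csymop A B j) (symop (@dg R n x0) L j M).
Proof.
move=> AL BM.
have G : mrep (fun x => \matrix_(r, k) cD (delta_mx k 0) (fun y => A y r j) x) (gmx (@dg R n x0) L j).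
  by move=> r k; rewrite mxE; apply: rep_eq_fun (rep_d k (AL r j)) => x; rewrite mxE.
apply: mrepD; last by apply: mrepN; exact: mrepM.
apply: mrepD; last exact: mrepM.
apply: mrepD; last by apply: mrepN; apply: mrepM => //; exact: mrep_d.
by apply: mrep_sum => l; apply: mrepZ => //; exact: mrep_d.
Qed.

End Representatives.

(** * From real tensor fields to germs *)

Section RealFields.
Context {R : realType} {n : nat}.
Local Notation C := R[i].
Local Notation V := 'cV[R]_n.+1.
Implicit Types (U : set V) (x y : V).

Definition cmx p q (A : V -> 'M[R]_(p, q)) (y : V) : 'M[C]_(p, q) := map_mx (real_complex R) (A y).

Lemma smooth_at_real U (f : V -> R) x : open U -> U x -> smooth U f ->
  smooth_at x (fun y => (f y)%:C%C).
Proof. by move=> oU Ux Cf; exists U; split=> // k; split; [exact: Cf | exact: Ck_cst]. Qed.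

Definition gm x p q (A : V -> 'M[R]_(p, q)) : 'M[germ x]_(p, q) :=
  \matrix_(i, j) mk x (fun y => (A y i j)%:C%C).

Lemma mrep_real U x p q (A : V -> 'M[R]_(p.+1, q.+1)) : open U -> U x -> smooth U A ->
  mrep (cmx A) (gm x A).
Proof.
move=> oU Ux CA i j; rewrite mxE; split.
  have -> : (fun y => cmx A y i j) = (fun y => (A y i j)%:C%C).
    by apply/funext => y; rewrite mxE.
  by apply: (smooth_at_real oU Ux) => k; exact: Ck_entry.
by congr mk; apply/funext => y; rewrite mxE.
Qed.

Lemma cD_real v (f : V -> R) x : cD v (fun y => (f y)%:C%C) x = ('D_v f x)%:C%C.
Proof. by congr (Complex _ _); exact: derive_cst. Qed.

Lemma derive_const_field v w x : 'D_v (fun=> w : V) x = 0 :> V.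
Proof. exact: derive_cst. Qed.

(** Constant coordinate fields have zero bracket, so only derivatives of the columns of [L] and [M]
    remain. *)
Lemma sym_bracket_const U (L M : opfield R n) j k x r : open U -> U x ->
  smooth U L -> smooth U M ->
  sym_bracket L M (fun=> delta_mx j 0) (fun=> delta_mx k 0) x r 0 =
  \sum_l L x l j * 'D_(delta_mx l 0) (fun y => M y r k) x
  - \sum_l M x l k * 'D_(delta_mx l 0) (fun y => L y r j) x
  - \sum_p L x r p * 'D_(delta_mx j 0) (fun y => M y p k) x
  + \sum_p M x r p * 'D_(delta_mx k 0) (fun y => L y p j) x.
Proof.
move=> oU Ux CL CM.
have dcol (A : opfield R n) i : smooth U A -> differentiable (fun y => A y *m delta_mx i 0 : V) x.
  move=> CA; have [d _] := Ck_mulmx oU (CA 1) (Ck_cst 1 U (delta_mx i 0 : V)); exact: d.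
have entry (A : opfield R n) i v p : smooth U A ->
    ('D_v (fun y => A y *m delta_mx i 0 : V) x) p 0 = 'D_v (fun y => A y p i) x.
  move=> CA; rewrite (derive_entry _ _ _ (dcol A i CA)); congr ('D_v _ x).
  by apply/funext => y; rewrite -colE mxE.
have dentry (A : opfield R n) p i : smooth U A -> differentiable (fun y => A y p i) x.
  by move=> CA; have [d _] := Ck_entry p i oU (CA 1); exact: d.
have tot (A B : opfield R n) i p q : smooth U A ->
    'D_(B x *m delta_mx i 0) (fun y => A y p q) x = \sum_l B x l i * 'D_(delta_mx l 0) (fun y => A y p q) x.
  move=> CA; rewrite (derive_coord _ (dentry A p q CA)); apply: eq_bigr => l _.
  by rewrite -colE mxE.
pose P y : V := M y *m delta_mx k 0; pose Q y : V := L y *m delta_mx j 0.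
have sE : sym_bracket L M (fun=> delta_mx j 0) (fun=> delta_mx k 0) x =
    L x *m (M x *m ('D_(delta_mx j 0) (fun=> delta_mx k 0 : V) x
                    - 'D_(delta_mx k 0) (fun=> delta_mx j 0 : V) x))
    + ('D_(Q x) P x - 'D_(P x) Q x)
    - L x *m ('D_(delta_mx j 0) P x - 'D_(P x) (fun=> delta_mx j 0 : V) x)
    - M x *m ('D_(Q x) (fun=> delta_mx k 0 : V) x - 'D_(delta_mx k 0) Q x) by [].
have e1 := derive_const_field (delta_mx j 0) (delta_mx k 0) x.
have e2 := derive_const_field (delta_mx k 0) (delta_mx j 0) x.
have e3 := derive_const_field (P x) (delta_mx j 0) x.
have e4 := derive_const_field (Q x) (delta_mx k 0) x.
rewrite {}e1 {}e2 {}e3 {}e4 in sE; rewrite {}sE.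
have eP v p : ('D_v P x) p 0 = 'D_v (fun y => M y p k) x by exact: entry.
have eQ v p : ('D_v Q x) p 0 = 'D_v (fun y => L y p j) x by exact: entry.
have t1 : ('D_(Q x) P x) r 0 = _ := etrans (eP (Q x) r) (tot M L j r k CM).
have t2 : ('D_(P x) Q x) r 0 = _ := etrans (eQ (P x) r) (tot L M k r j CL).
rewrite -t1 -t2.
have s1 : \sum_p L x r p * 'D_(delta_mx j 0) (fun y => M y p k) x = (L x *m 'D_(delta_mx j 0) P x) r 0.
  by rewrite mxE; apply: eq_bigr => p _; rewrite eP.
have s2 : \sum_p M x r p * 'D_(delta_mx k 0) (fun y => L y p j) x = (M x *m 'D_(delta_mx k 0) Q x) r 0.
  by rewrite mxE; apply: eq_bigr => p _; rewrite eQ.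
rewrite s1 s2.
move: ('D_(Q x) P x) ('D_(P x) Q x) ('D_(delta_mx j 0) P x) ('D_(delta_mx k 0) Q x) => a b c e.
rewrite subr0 sub0r subr0 !mulmx0 add0r mulmxN opprK.
by move: (L x *m c) (M x *m e) => u w; rewrite !mxE.
Qed.

Lemma csymop_real U (L M : opfield R n) j x r k : open U -> U x ->
  smooth U L -> smooth U M ->
  csymop (cmx L) (cmx M) j x r k =
  (sym_bracket L M (fun=> delta_mx j 0) (fun=> delta_mx k 0) x r 0)%:C%C.
Proof.
move=> oU Ux CL CM; rewrite (sym_bracket_const j k r oU Ux CL CM).
have E (A : opfield R n) v p q : cD v (fun y => cmx A y p q) x = ('D_v (fun y => A y p q) x)%:C%C.
  have -> : (fun y => cmx A y p q) = (fun y => (A y p q)%:C%C) by apply/funext => y; rewrite mxE.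
  exact: cD_real.
have B4 (A1 A2 A3 A4 : 'M[C]_n.+1) : (A1 - A2 + A3 - A4) r k = A1 r k - A2 r k + A3 r k - A4 r k.
  by rewrite !mxE.
pose G : 'M[C]_n.+1 := \matrix_(r, k) cD (delta_mx k 0) (fun y => cmx L y r j) x.
have T1 : (\sum_l cmx L x l j *: cDmx (delta_mx l 0) (cmx M) x) r k =
    (\sum_l L x l j * 'D_(delta_mx l 0) (fun y => M y r k) x)%:C%C.
  by rewrite summxE rmorph_sum; apply: eq_bigr => l _; rewrite !mxE E rmorphM.
have T2 : (cmx L x *m cDmx (delta_mx j 0) (cmx M) x) r k =
    (\sum_p L x r p * 'D_(delta_mx j 0) (fun y => M y p k) x)%:C%C.
  by rewrite mxE rmorph_sum; apply: eq_bigr => l _; rewrite !mxE E rmorphM.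
have T3 : (cmx M x *m G) r k = (\sum_p M x r p * 'D_(delta_mx k 0) (fun y => L y p j) x)%:C%C.
  by rewrite mxE rmorph_sum; apply: eq_bigr => l _; rewrite !mxE E rmorphM.
have T4 : (G *m cmx M x) r k = (\sum_l M x l k * 'D_(delta_mx l 0) (fun y => L y r j) x)%:C%C.
  by rewrite mxE rmorph_sum; apply: eq_bigr => l _; rewrite !mxE E rmorphM mulrC.
rewrite /csymop B4 T1 T2 T3 T4 !(rmorphD, rmorphN) /=.
by rewrite [LHS]addrAC; congr (_ + _); rewrite addrAC.
Qed.

Lemma Sym_csymop U (L M : opfield R n) j x : open U -> smooth U L -> in_Sym U L M -> U x ->
  csymop (cmx L) (cmx M) j x = 0.
Proof.
move=> oU CL [CM _ LM] Ux; apply/matrixP => r k.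
rewrite (csymop_real j r k oU Ux CL CM) LM //; last by move=> m; exact: Ck_cst.
  by rewrite !mxE.
by move=> m; exact: Ck_cst.
Qed.

(** The Nijenhuis identity is [<L, L> = 0] with two terms interchanged. *)
Lemma nijenhuis_in_Sym U (L : opfield R n) : smooth U L -> nijenhuis U L -> in_Sym U L L.
Proof.
move=> CL NL; apply: And3; [exact: CL | by move=> x _ | move=> xi eta Cxi Ceta x Ux].
by apply: etrans (NL xi eta Cxi Ceta x Ux); exact: addrAC.
Qed.

Lemma germ_symop0 U (L M : opfield R n) x j : open U -> U x -> smooth U L -> smooth U M ->
  (forall y, U y -> csymop (cmx L) (cmx M) j y = 0) ->
  symop (@dg R n x) (gm x L) j (gm x M) = 0.
Proof.
move=> oU Ux CL CM LM0; have LM0' y : U y -> csymop (cmx L) (cmx M) j y = 0 by exact: LM0.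
apply: (mrep_eq (mrep_symop j (mrep_real oU Ux CL) (mrep_real oU Ux CM)) (@mrep0 _ _ x _ _)).
exact: (near_open oU Ux) LM0'.
Qed.

Lemma germ_closed U (al : form1) x : open U -> U x -> smooth U al -> closed_form U al ->
  closed (@dg R n x) (gm x al).
Proof.
move=> oU Ux Ca cl i j.
have ra := mrep_real oU Ux Ca.
apply: rep_eq (rep_d i (ra 0 j)) (rep_d j (ra 0 i)) _.
apply: (near_open oU Ux) => y Uy.
have E v k : cD v (fun y => cmx al y 0 k) y = ('D_v al y 0 k)%:C%C.
  have -> : (fun y => cmx al y 0 k) = (fun y => (al y 0 k)%:C%C) by apply/funext => z; rewrite mxE.
  by rewrite cD_real derive_entry //; have [d _] := Ca 1; exact: d.
rewrite !E; congr (_%:C%C); apply/eqP; rewrite -subr_eq0; apply/eqP.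
have := cl y Uy (delta_mx i 0) (delta_mx j 0); rewrite /d1.
by rewrite -!colE !mxE.
Qed.

Lemma gm_mul U x p q r (A : V -> 'M[R]_(p.+1, q.+1)) (B : V -> 'M[R]_(q.+1, r.+1)) :
  open U -> U x -> smooth U A -> smooth U B -> gm x (fun y => A y *m B y) = gm x A *m gm x B.
Proof.
move=> oU Ux CA CB.
have CAB : smooth U (fun y => A y *m B y) by move=> k; exact: Ck_mulmx.
apply: (mrep_eq (mrep_real oU Ux CAB) (mrepM (mrep_real oU Ux CA) (mrep_real oU Ux CB))).
by near=> y; rewrite /cmx map_mxM.
Unshelve. all: by end_near. Qed.

Lemma ev_gm x p q (A : V -> 'M[R]_(p.+1, q.+1)) U : open U -> U x -> smooth U A ->
  map_mx (@ev R n x) (gm x A) = cmx A x.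
Proof. by move=> oU Ux CA; exact: mrep_ev (mrep_real oU Ux CA). Qed.

Lemma gm_krylov U x (a : form1) (L : opfield R n) : open U -> U x -> smooth U a -> smooth U L ->
  krylov (a x) (L x) \in unitmx -> krylov (gm x a) (gm x L) \in unitmx.
Proof.
move=> oU Ux Ca CL uk.
have e : map_mx (@ev R n x) (krylov (gm x a) (gm x L)) = map_mx (real_complex R) (krylov (a x) (L x)).
  rewrite !ev_krylov; congr (krylov _ _); [exact: (ev_gm oU Ux Ca) | exact: (ev_gm oU Ux CL)].
rewrite unitmxE germ_unitE -det_map_mx e det_map_mx.
by move: uk; rewrite unitmxE unitfE; apply: contra => /eqP; rewrite -(rmorph0 (real_complex R)) => /(fmorph_inj (real_complex R)) ->.
Qed.

End RealFields.

(** * The flat operator as a real operator field near [x0] *)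

Section FlatFunction.
Context {R : realType} {n : nat}.
Local Notation C := R[i].
Local Notation V := 'cV[R]_n.+1.
Implicit Types (U : set V) (x y : V).

Lemma cCk_smooth_at U (f : V -> C) : (forall x, U x -> smooth_at x f) -> forall k, cCk k U f.
Proof.
move=> sf k; split; apply: Ck_local => x /sf[U' [oU Ux Cf]]; exists U'; split=> //.
  by have [] := Cf k.
by have [] := Cf k.
Qed.

Lemma common_smooth (I : finType) (f : I -> V -> C) x : (forall i, smooth_at x (f i)) ->
  exists U, [/\ open U, U x & forall i k, cCk k U (f i)].
Proof.
move=> sf; have [W WP] := choice sf.
have nW (i : I) : \forall y \near x, W i y.
  by have [oW W0 _] := WP i; exact: open_nbhs_nbhs.
have nnW : \forall y \near x, forall i, W i y by exact: filter_forall nW.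
have /nbhs_ballP[e /= e0 eP] : nbhs x [set y | forall i, W i y] by exact: nnW.
exists (ball x e); split; [exact: ball_open | exact: ballxx |] => i k.
by have [_ _ CW] := WP i; apply: cCk_sub (CW k) => y /eP.
Qed.

Lemma cmx_inj p q (A B : 'M[R]_(p, q)) :
  map_mx (real_complex R) A = map_mx (real_complex R) B -> A = B.
Proof. by move=> h; apply: (map_mx_inj (f := real_complex R)) h. Qed.

Lemma flat_germ U (L : opfield R n) (a : form1) x0 : open U -> U x0 -> smooth U L ->
  (forall x j, U x -> csymop (cmx L) (cmx L) j x = 0) -> algebraically_generic U L ->
  smooth U a -> closed_form U a -> closed_form U (fun x => a x *m L x) ->
  krylov (a x0) (L x0) \in unitmx ->
  exists M : 'M[germ x0]_n.+1, [/\ gm x0 L *m M = M *m gm x0 L,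
   forall j, symop (@dg R n x0) (gm x0 L) j M = 0,
   horner_mx M (map_poly (cst x0) (map_poly (@ev R n x0) (char_poly (gm x0 L)))) = 0,
   map_mx (@ev R n x0) M = map_mx (@ev R n x0) (gm x0 L) & map_mx (@cj R n x0) M = M].
Proof.
move=> oU Ux0 CL DL [s [m [lam [m0 lamP]]]] Ca cla claL uk.
pose P x := char_poly (cmx L x).
have CP i k : cCk k U (fun x => (P x)`_i).
  apply: cCk_smooth_at => x Ux.
  by have [] := prep_char_poly (mrep_real oU Ux CL) i.
have [r [V' [oV V0 VU [rI Cr PE]]]] := @eigenvalue_functions R _ U P n s m lam x0 oU Ux0
  (fun x => char_poly_monic _) (fun x => size_char_poly _) CP m0 lamP.
have sr b : smooth_at x0 (r b) by exists V'.
have Lr : mrep (cmx L) (gm x0 L) by exact: mrep_real oU Ux0 CL.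
have CaL : smooth U (fun x => a x *m L x) by move=> k; exact: Ck_mulmx.
apply: (@flat_operator C n (germ x0) (@dg R n x0) (@ev R n x0) (@dgM R n x0) (@dgC R n x0)
  _ _ _ (cst x0) _ _ (@germ_reduced R n x0) (@cj R n x0) (@conjc R) (@dg_cj R n x0) (@ev_cj R n x0)
  (@cj_cst R n x0) (@cjK R n x0) (gm x0 L) (gm x0 a) _ _ _ _ s m (fun b => mk x0 (r b)) m0).
- by move=> x; rewrite germ_unitE.
- move=> al cal; have [u [u0 uE]] := @germ_poincare R n x0 (fun i => al 0 i) (fun i j => cal j i).
  by exists u; split=> //; apply/rowP => j; rewrite !mxE; exact: uE.
- by move=> k T; exact: germ_roots.
- by move=> z; rewrite /cst /= ev_mk //; exact: smooth_at_cst.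
- exact: dg_cst.
- by move=> j; apply: (germ_symop0 oU Ux0) => // y; exact: DL.
- exact: germ_closed oU Ux0 Ca cla.
- by rewrite -(gm_mul oU Ux0 Ca CL); exact: germ_closed oU Ux0 CaL claL.
- exact: gm_krylov oU Ux0 Ca CL uk.
- apply: prep_eq (prep_char_poly Lr) _ _; last by exact: (near_open oV V0 PE).
  apply: prep_prod => b; apply: prep_exp; apply: prepD; first exact: prepX.
  by apply: prepN; apply: prepC.
- by move=> b c /=; rewrite !ev_mk //; exact: rI.
apply/matrixP => i j; rewrite !mxE /= cj_mk.
  by congr mk; apply/funext => y; exact: conjc_real.
by apply: (smooth_at_real oU Ux0) => k; exact: Ck_entry.
Qed.

(** Finitely many identities of germs hold on one common ball. The germ matrix is fixed by
    conjugation, so taking real parts of its representatives changes nothing near [x0]. *)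
Lemma flat_function U (L : opfield R n) (a : form1) x0 : open U -> U x0 -> smooth U L ->
  (forall x j, U x -> csymop (cmx L) (cmx L) j x = 0) -> algebraically_generic U L ->
  smooth U a -> closed_form U a -> closed_form U (fun x => a x *m L x) ->
  krylov (a x0) (L x0) \in unitmx ->
  exists V1 (L' : opfield R n), [/\ open V1, V1 x0, V1 `<=` U & [/\ smooth V1 L',
    L' x0 = L x0,
    forall y, V1 y -> L y *m L' y = L' y *m L y,
    forall y j, V1 y -> csymop (cmx L) (cmx L') j y = 0 &
    forall y, V1 y -> horner_mx (L' y) (char_poly (L x0)) = 0]].
Proof.
move=> oU Ux0 CL DL gen Ca cla claL uk.
have [M [LM DM chiM evM cjM]] := flat_germ oU Ux0 CL DL gen Ca cla claL uk.
have Lr : mrep (cmx L) (gm x0 L) by exact: mrep_real oU Ux0 CL.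
pose L' : opfield R n := fun y => \matrix_(i, j) complex.Re (germ_fun (M i j) y).
have Mr : mrep (cmx L') M.
  move=> i j; pose f := germ_fun (M i j); have sf : smooth_at x0 f by exact: germ_smooth.
  have Mf : M i j = mk x0 f by rewrite germK.
  have E : (fun y => cmx L' y i j) = (fun y => (complex.Re (f y))%:C%C).
    by apply/funext => y; rewrite !mxE.
  have cf : near_eq x0 (fun y => (f y)^*%C) f.
    apply/(mk_eqP (smooth_at_conj sf) sf); rewrite -cj_mk // -Mf.
    by have /matrixP/(_ i j) := cjM; rewrite mxE.
  have sr : smooth_at x0 (fun y => (complex.Re (f y))%:C%C).
    case: sf => W [oW Wx Cf]; apply: (smooth_at_real oW Wx) => k.
    by have [] := Cf k.
  rewrite E; split=> //; rewrite Mf; apply/(mk_eqP sf sr).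
  apply: filterS cf => y; case: (f y) => u v /= [] h.
  by congr (Complex _ _); lra.
have [V0 [oV0 V00 CV0]] := common_smooth (I := ('I_n.+1 * 'I_n.+1)%type)
  (f := fun ij y => cmx L' y ij.1 ij.2) (fun ij => (Mr ij.1 ij.2).1).
have CL' : smooth V0 L'.
  move=> k; apply: Ck_matrix => // i j; have [h _] := CV0 (i, j) k.
  by apply: Ck_eq h => // y _; rewrite !mxE.
have n1 : \forall y \near x0, cmx L y *m cmx L' y = cmx L' y *m cmx L y.
  by apply: mrep_near (mrepM Lr Mr) _; rewrite LM; exact: mrepM.
have n2 j : \forall y \near x0, csymop (cmx L) (cmx L') j y = 0.
  apply: mrep_near (mrep_symop j Lr Mr) _; rewrite DM; exact: mrep0.
have nn2 : \forall y \near x0, forall j, csymop (cmx L) (cmx L') j y = 0 by exact: filter_forall n2.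
pose p := char_poly (cmx L x0).
have evL : map_mx (@ev R n x0) (gm x0 L) = cmx L x0 by exact: ev_gm oU Ux0 CL.
have n3 : \forall y \near x0, horner_mx (cmx L' y) p = 0.
  apply: mrep_near (mrep_horner p Mr) _.
  have -> : horner_mx M (map_poly (cst x0) p) = 0; last exact: mrep0.
  have -> : p = map_poly (@ev R n x0) (char_poly (gm x0 L)) by rewrite /p -evL map_char_poly.
  exact: chiM.
have /nbhs_ballP[e /= e0 eP] : nbhs x0 (U `&` V0 `&`
   ([set y | cmx L y *m cmx L' y = cmx L' y *m cmx L y] `&`
    ([set y | forall j, csymop (cmx L) (cmx L') j y = 0] `&` [set y | horner_mx (cmx L' y) p = 0]))).
  apply: filterI; first by apply: filterI; exact: open_nbhs_nbhs.
  by apply: filterI => //; exact: filterI.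
exists (ball x0 e), L'; split; [exact: ball_open | exact: ballxx | by move=> y /eP[[]] |].
split.
- by move=> k; apply: Ck_sub (CL' k) => y /eP[[]].
- by apply: cmx_inj; rewrite -[RHS]/(cmx L x0) -evL -evM (mrep_ev Mr).
- by move=> y /eP[_ [h _]]; apply: cmx_inj; rewrite !map_mxM.
- by move=> y j /eP[_ [_ [h _]]]; exact: h.
move=> y /eP[_ [_ [_ h]]]; apply: cmx_inj.
rewrite map_horner_mx map_mx0 map_char_poly.
exact: h.
Qed.

End FlatFunction.

(** * Pointwise algebra of the Killing tensors *)

Section Pairing.
Context {R : realType} {n : nat} (g : 'M[R]_n.+1).
Implicit Types p q : 'rV[R]_n.+1.

Lemma pairingDl p p' q : pairing g (p + p') q = pairing g p q + pairing g p' q.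
Proof. by rewrite /pairing !mulmxDl mxE. Qed.

Lemma pairingDr p q q' : pairing g p (q + q') = pairing g p q + pairing g p q'.
Proof. by rewrite /pairing linearD /= mulmxDr mxE. Qed.

Lemma pairingZl c p q : pairing g (c *: p) q = c * pairing g p q.
Proof. by rewrite /pairing -!scalemxAl mxE. Qed.

Lemma pairing_suml (I : Type) (r : seq I) (f : I -> 'rV[R]_n.+1) q :
  pairing g (\sum_(i <- r) f i) q = \sum_(i <- r) pairing g (f i) q.
Proof. by rewrite /pairing !mulmx_suml summxE. Qed.

Lemma pairingC p q : g^T = g -> pairing g p q = pairing g q p.
Proof.
move=> gT; rewrite /pairing.
have -> : p *m g *m q^T = (q *m g *m p^T)^T by rewrite !trmx_mul trmxK gT mulmxA.
by rewrite mxE.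
Qed.

Lemma pairing_eq0 p : g \in unitmx -> (forall q, pairing g p q = 0) -> p = 0.
Proof.
move=> gU pq; suff pg : p *m g = 0 by rewrite -[p](mulmxK gU) pg mul0mx.
apply/rowP => j; have := pq (delta_mx 0 j); rewrite /pairing trmx_delta -colE.
by rewrite !mxE.
Qed.

Lemma pairing_inj p p' : g \in unitmx -> (forall q, pairing g p q = pairing g p' q) -> p = p'.
Proof.
move=> gU pq; apply/eqP; rewrite -subr_eq0; apply/eqP; apply: pairing_eq0 => // q.
by rewrite pairingDl pq -scaleN1r pairingZl mulN1r subrr.
Qed.

End Pairing.

Section KillingAlgebra.
Context {R : realType} {n : nat} (a : 'rV[R]_n.+1) (L g : 'M[R]_n.+1).
Context (M K : 'I_n.+1 -> 'M[R]_n.+1).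
Hypothesis aL : krylov a L \in unitmx.
Hypothesis gT : g^T = g.
Hypothesis gU : g \in unitmx.
Hypothesis LM : forall i, L *m M i = M i *m L.
Hypothesis Mfree : forall c : 'I_n.+1 -> R, \sum_i c i *: M i = 0 -> forall i, c i = 0.
Hypothesis Ksa : forall i p q, pairing g (p *m K i) q = pairing g p (q *m K i).
Hypothesis K0q : forall p, pairing g (p *m K 0) p = pairing g p p.
Hypothesis quad : forall X, L *m X = X *m L ->
  \sum_i (2^-1 * pairing g (a *m X *m K i) (a *m X)) *: M i = X *m X.
Implicit Types X Y Z W : 'M[R]_n.+1.

Local Notation comm X := (L *m X = X *m L).

Lemma commM X Y : comm X -> comm Y -> comm (X *m Y).
Proof. by move=> cX cY; rewrite mulmxA cX -!mulmxA cY. Qed.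

Lemma commD X Y : comm X -> comm Y -> comm (X + Y).
Proof. by move=> cX cY; rewrite mulmxDl mulmxDr cX cY. Qed.

Lemma comm1 : comm 1%:M. Proof. by rewrite mulmx1 mul1mx. Qed.

Lemma commLL : comm L. Proof. by []. Qed.

Lemma Mfree_eq (c c' : 'I_n.+1 -> R) : \sum_i c i *: M i = \sum_i c' i *: M i -> c =1 c'.
Proof.
move=> cc i; apply/eqP; rewrite -subr_eq0; apply/eqP.
apply: (Mfree (c := fun i => c i - c' i)).
by under eq_bigr do rewrite scalerBl; rewrite sumrB cc subrr.
Qed.

(** The data constrain [K 0] through a quadratic form; polarisation, self-adjointness and
    non-degeneracy recover the operator. *)
Lemma Killing_id : K 0 = 1%:M.
Proof.
suff h (p : 'rV_n.+1) : p *m K 0 = p.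
  by apply/row_matrixP => i; rewrite !rowE h mulmx1.
apply: (pairing_inj gU) => q; have := K0q (p + q).
rewrite mulmxDl !(pairingDl, pairingDr) !K0q.
have -> : pairing g (q *m K 0) p = pairing g (p *m K 0) q by rewrite Ksa pairingC.
rewrite [pairing g q p]pairingC //.
move: (pairing g (p *m K 0) q) (pairing g p q) (pairing g p p) (pairing g q q) => u v s t; lra.
Qed.

(** Polarisation of [quad] at [X + Y]: the cross terms coincide because [K i] is self-adjoint and
    because [X] and [Y], both commuting with the cyclic [L], commute with each other. *)
Lemma bilinear X Y : comm X -> comm Y ->
  \sum_i (2^-1 * pairing g (a *m X *m K i) (a *m Y)) *: M i = X *m Y.
Proof.
move=> cX cY; have cXY : Y *m X = X *m Y by exact: comm_cyclic aL cY cX.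
have := quad (commD cX cY).
rewrite mulmxDr [in RHS]mulmxDl !mulmxDr -(quad cX) -(quad cY) cXY.
have -> : \sum_i (2^-1 * pairing g ((a *m X + a *m Y) *m K i) (a *m X + a *m Y)) *: M i =
  \sum_i (2^-1 * pairing g (a *m X *m K i) (a *m X)) *: M i +
  (\sum_i (2^-1 * pairing g (a *m X *m K i) (a *m Y)) *: M i +
   \sum_i (2^-1 * pairing g (a *m X *m K i) (a *m Y)) *: M i) +
  \sum_i (2^-1 * pairing g (a *m Y *m K i) (a *m Y)) *: M i.
  rewrite -!big_split; apply: eq_bigr => i _.
  rewrite /= mulmxDl !(pairingDl, pairingDr).
  have -> : pairing g (a *m Y *m K i) (a *m X) = pairing g (a *m X *m K i) (a *m Y).
    by rewrite Ksa pairingC.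
  by rewrite !mulrDr !scalerDl !addrA.
have half (A B D W : 'M[R]_n.+1) : A + (B + B) + D = A + W + (W + D) -> B = W.
  by move=> /matrixP e; apply/matrixP => i j; have := e i j; rewrite !mxE; lra.
exact: half.
Qed.

(** By [bilinear] and the independence of the [M i], the pairing depends only on the product, so a
    commuting operator can be moved from one argument to the other. *)
Lemma pairing_prod i X Y X' Y' : comm X -> comm Y -> comm X' -> comm Y' ->
  X *m Y = X' *m Y' ->
  pairing g (a *m X *m K i) (a *m Y) = pairing g (a *m X' *m K i) (a *m Y').
Proof.
move=> cX cY cX' cY' e; have := bilinear cX cY; rewrite e -(bilinear cX' cY') => /Mfree_eq/(_ i).
by apply: mulfI; rewrite invr_eq0 pnatr_eq0.
Qed.

Lemma row_comm (p : 'rV[R]_n.+1) : exists2 X, comm X & p = a *m X.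
Proof.
exists (horner_mx L (\sum_(k < n.+1) (p *m invmx (krylov a L)) 0 k *: 'X^k)).
  exact: comm_mx_horner.
rewrite -[LHS](mulmxKV aL) mulmx_sum_row raddf_sum mulmx_sumr; apply: eq_bigr => k _.
by rewrite rowK /= linearZ /= rmorphXn /= horner_mx_X -scalemxAr.
Qed.

(** [L] is self-adjoint for [g], because [(Z L) W = Z (W L)]. The pairing twisted by [K j] also
    depends on the product only; comparing the two facts moves [L] past [K j]. *)
Lemma Killing_comm j : comm (K j).
Proof.
suff h (p : 'rV_n.+1) : p *m (L *m K j) = p *m (K j *m L).
  by apply/row_matrixP => i; rewrite !rowE h.
apply: (pairing_inj gU) => q.
have [X cX ->] := row_comm p; have [Y cY ->] := row_comm q.
have sa (p' q' : 'rV_n.+1) : pairing g (p' *m L) q' = pairing g p' (q' *m L).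
  have [Z cZ ->] := row_comm p'; have [W cW ->] := row_comm q'.
  have cLW := comm_cyclic aL commLL cW.
  have := @pairing_prod 0 (Z *m L) W Z (W *m L) (commM cZ commLL) cW cZ (commM cW commLL).
  by rewrite Killing_id !mulmx1 -!mulmxA cLW; apply.
rewrite mulmxA -(mulmxA a) (@pairing_prod j (X *m L) Y X (Y *m L)) //.
- by rewrite !mulmxA sa.
- exact: commM.
- exact: commM.
by rewrite -mulmxA cY.
Qed.

(** The coordinate of [Z] along [M j], which is [bilinear] with [Y = 1]. *)
Definition coord j Z : R := 2^-1 * pairing g (a *m Z *m K j) a.

Lemma coordE Z : comm Z -> Z = \sum_j coord j Z *: M j.
Proof. by move=> cZ; have := bilinear cZ comm1; rewrite !mulmx1 => /esym. Qed.

Lemma coord_Killing j Z : comm Z -> coord j Z = coord 0 (K j *m Z).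
Proof.
move=> cZ; rewrite /coord Killing_id mulmx1; congr (_ * pairing g _ a).
by rewrite -mulmxA (comm_cyclic aL cZ (Killing_comm j)).
Qed.

(* [v |-> \sum_j tau_j(v) M_j] commutes with [K_j], a polynomial in [L], and the coordinate of [Z]
   along [M_j] is that of [K_j Z] along [M_0]. *)
Lemma equivariant_Killing (tau : 'I_n.+1 -> 'rV[R]_n.+1) :
  (forall k, \sum_j (tau j *m L) 0 k *: M j = L *m \sum_j tau j 0 k *: M j) ->
  forall j, tau j = tau 0 *m K j.
Proof.
move=> tauL j; pose T (v : 'cV[R]_n.+1) := \sum_j (tau j *m v) 0 0 *: M j.
have cT v : comm (T v).
  rewrite mulmx_sumr mulmx_suml; apply: eq_bigr => i _.
  by rewrite -scalemxAr -scalemxAl LM.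
have Tsum v : T v = \sum_k v k 0 *: \sum_j tau j 0 k *: M j.
  rewrite /T; under [RHS]eq_bigr do rewrite scaler_sumr.
  rewrite exchange_big; apply: eq_bigr => i _; rewrite mxE scaler_suml; apply: eq_bigr => k _.
  by rewrite scalerA mulrC.
have TL v : T (L *m v) = L *m T v.
  rewrite [in RHS]Tsum mulmx_sumr.
  under [RHS]eq_bigr do rewrite -scalemxAr -tauL scaler_sumr.
  rewrite exchange_big /T; apply: eq_bigr => i _.
  rewrite mulmxA mxE scaler_suml; apply: eq_bigr => k _.
  by rewrite scalerA mulrC.
have TD v w : T (v + w) = T v + T w.
  by rewrite /T -big_split; apply: eq_bigr => i _; rewrite mulmxDr mxE scalerDl.
have TZ c v : T (c *: v) = c *: T v.
  by rewrite /T scaler_sumr; apply: eq_bigr => i _; rewrite -scalemxAr mxE scalerA.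
have [q KE] := comm_horner_mx_ex aL (Killing_comm j).
have TK v : T (K j *m v) = K j *m T v.
  rewrite KE; elim/poly_ind: q {KE} => [|q c IHq].
    by rewrite rmorph0 !mul0mx -(scale0r 0) TZ !scale0r.
  rewrite rmorphD rmorphM /= horner_mx_X horner_mx_C !mulmxDl TD !mul_scalar_mx TZ.
  congr (_ + _); have cq : L *m horner_mx L q = horner_mx L q *m L by exact: comm_mx_horner.
  by rewrite -mulmxE -cq -!mulmxA TL IHq.
have Tc i v : coord i (T v) = (tau i *m v) 0 0.
  by have := coordE (cT v); rewrite {1}/T => /Mfree_eq/(_ i).
apply/rowP => k; have := coord_Killing j (cT (delta_mx k 0)).
by rewrite -TK !Tc mulmxA -!colE !mxE.
Qed.

Context (N : 'M[R]_n.+1) (p0 : {poly R}).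
Hypothesis cN : comm N.
Hypothesis aN : krylov a N \in unitmx.
Hypothesis p0_monic : p0 \is monic.
Hypothesis p0_size : size p0 = n.+2.
Hypothesis Np0 : horner_mx N p0 = 0.

(** The matrix [C = (c^i_j)] at a point. Row 0 holds the top power [N^n], so that [Rop 0] is dual to
    it, as Horner's scheme demands. *)
Definition recip_mx : 'M[R]_n.+1 := \matrix_(i, j) coord j (N ^+ (n - i)).

Definition form X Y : R := 2^-1 * pairing g (a *m X) (a *m Y).

Lemma commN k : comm (N ^+ k).
Proof. by have /= := commrX k cN; rewrite /GRing.comm -!mulmxE. Qed.

Lemma form_prod X Y X' Y' : comm X -> comm Y -> comm X' -> comm Y' ->
  X *m Y = X' *m Y' -> form X Y = form X' Y'.
Proof.
move=> cX cY cX' cY' e; have := pairing_prod 0 cX cY cX' cY' e.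
by rewrite Killing_id !mulmx1 /form => ->.
Qed.

Lemma formDl X Y Z : form (X + Y) Z = form X Z + form Y Z.
Proof. by rewrite /form mulmxDr pairingDl mulrDr. Qed.

Lemma formZl c X Z : form (c *: X) Z = c * form X Z.
Proof. by rewrite /form -scalemxAr pairingZl mulrCA. Qed.

Lemma formC X Y : form X Y = form Y X.
Proof. by rewrite /form pairingC. Qed.

Lemma form_suml (I : Type) (r : seq I) (F : I -> 'M[R]_n.+1) Z :
  form (\sum_(i <- r) F i) Z = \sum_(i <- r) form (F i) Z.
Proof. by rewrite /form mulmx_sumr pairing_suml mulr_sumr. Qed.

Lemma krylov_rev_ind (v : 'I_n.+1 -> R) : \sum_i v i *: (a *m N ^+ (n - i)) = 0 ->
  forall i, v i = 0.
Proof.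
move=> v0 i; have e : (\row_k v (rev_ord k)) *m krylov a N = 0.
  rewrite mulmx_sum_row -[RHS]v0 (reindex_inj rev_ord_inj); apply: eq_bigr => k _.
  by rewrite rowK mxE rev_ordK.
have /rowP/(_ (rev_ord i)) : \row_k v (rev_ord k) = 0 by rewrite -[LHS](mulmxK aN) e mul0mx.
by rewrite !mxE rev_ordK.
Qed.

Lemma form_nondeg X Y : comm X -> comm Y ->
  (forall l : 'I_n.+1, form X (N ^+ (n - l)) = form Y (N ^+ (n - l))) -> X = Y.
Proof.
move=> cX cY XY.
apply: (krylov_inj aL); rewrite -?mulmxE; [exact/esym | exact/esym |].
have kq (k : 'I_n.+1) : pairing g (a *m X) (row k (krylov a N)) = pairing g (a *m Y) (row k (krylov a N)).
  have := XY (rev_ord k); rewrite /form rowK /= ?subSS subKn; last by rewrite -ltnS.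
  by apply: mulfI; rewrite invr_eq0 pnatr_eq0.
apply: (pairing_inj gU) => q; pose c := q *m invmx (krylov a N).
have -> : q = \sum_k c 0 k *: row k (krylov a N) by rewrite -mulmx_sum_row mulmxKV.
rewrite (pairingC (a *m X) _ gT) (pairingC (a *m Y) _ gT) !pairing_suml.
apply: eq_bigr => k _; rewrite !pairingZl.
by rewrite (pairingC (row k _) (a *m X) gT) (pairingC (row k _) (a *m Y) gT) kq.
Qed.

Lemma recip_mx_unit : recip_mx \in unitmx.
Proof.
rewrite -row_free_unit -kermx_eq0; apply/eqP/row_matrixP => r; rewrite row0.
set v := row r _; have vC : v *m recip_mx = 0 by rewrite -row_mul mulmx_ker row0.
apply/rowP => i; rewrite [RHS]mxE; apply: (krylov_rev_ind (v := fun i => v 0 i)).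
have e k : N ^+ k = \sum_j coord j (N ^+ k) *: M j := coordE (commN k).
have s0 : \sum_i v 0 i *: N ^+ (n - i) = 0.
  under eq_bigr do rewrite e scaler_sumr.
  rewrite exchange_big big1 // => j _.
  under eq_bigr do rewrite scalerA; rewrite -scaler_suml.
  suff -> : \sum_i v 0 i * coord j (N ^+ (n - i)) = 0 by rewrite scale0r.
  transitivity ((v *m recip_mx) 0 j); last by rewrite vC mxE.
  by rewrite [RHS]mxE; apply: eq_bigr => k _; congr (_ * _); rewrite mxE.
rewrite -[RHS](mulmx0 _ a) -s0 mulmx_sumr; apply: eq_bigr => k _.
by rewrite -scalemxAr.
Qed.

Definition Rop (i : 'I_n.+1) : 'M[R]_n.+1 := \sum_j (invmx recip_mx) j i *: K j.

Lemma Rop_comm i : comm (Rop i).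
Proof.
rewrite mulmx_sumr mulmx_suml; apply: eq_bigr => j _.
by rewrite -scalemxAr -scalemxAl Killing_comm.
Qed.

(** The form of [K j] with a power of [N] is the [j]-th coordinate of that power, so the pairings
    are the entries of [C C^-1]. *)
Lemma Rop_dual i (l : 'I_n.+1) : form (Rop i) (N ^+ (n - l)) = (l == i)%:R.
Proof.
have := mulmxV recip_mx_unit => /matrixP/(_ l i); rewrite [RHS]mxE => <-.
rewrite form_suml mxE; apply: eq_bigr => j _; rewrite formZl mulrC !mxE; congr (_ * _).
by rewrite /form /coord pairingC // Ksa.
Qed.

(** Both sides are tested against the powers of [N]. Moving [N] across the form raises the power by
    one and so shifts the index, except for [l = 0]. There [N^(n+1)] is expanded by [p0]; the
    coefficient produced is cancelled by the term in [Rop 0], which only [l = 0] sees. *)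
Lemma Rop_rec (i i' : 'I_n.+1) : i' = i.+1 :> nat ->
  Rop i' = N *m Rop i + p0`_(n - i) *: Rop 0.
Proof.
move=> ii'; apply: form_nondeg.
- exact: Rop_comm.
- by apply: commD; [exact: commM (Rop_comm i) | rewrite -scalemxAr -scalemxAl Rop_comm].
move=> l; rewrite formDl formZl !Rop_dual.
have cR := Rop_comm i.
have -> : form (N *m Rop i) (N ^+ (n - l)) = form (Rop i) (N ^+ (n - l).+1).
  apply: form_prod; [exact: commM | exact: commN | exact: Rop_comm | exact: commN |].
  by rewrite (comm_cyclic aL cN cR) -mulmxA mulmxE -exprS.
have [l0|lpos] := posnP l.
  rewrite l0 subn0; have -> : (l == 0) by apply/eqP/val_inj.
  have -> : (l == i') = false by apply/negbTE; rewrite -val_eqE /= l0 ii'.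
  have pE : N ^+ n.+1 = - \sum_(k < n.+1) p0`_k *: N ^+ k.
    have := Np0; rewrite -{1}[p0](coefK p0) p0_size poly_def raddf_sum big_ord_recr /=.
    have -> : p0`_n.+1 = 1 by have /monicP := p0_monic; rewrite lead_coefE p0_size.
    rewrite scale1r rmorphXn /= horner_mx_X addrC => /eqP; rewrite addr_eq0 => /eqP ->.
    by congr (- _); apply: eq_bigr => k _; rewrite linearZ /= rmorphXn /= horner_mx_X.
  rewrite pE formC -scaleN1r formZl form_suml mulN1r mulr1.
  rewrite (bigD1 (rev_ord i)) //= big1 => [|k ki].
    rewrite formZl formC /= ?subSS.
    by rewrite Rop_dual eqxx mulr1 addr0 addNr.
  rewrite formZl formC -[k in N ^+ k](subKn (m := k) (n := n)); last by rewrite -ltnS.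
  have -> : (n - k)%N = rev_ord k by rewrite /= ?subSS.
  rewrite Rop_dual; case: eqP => [e|_]; last by rewrite mulr0.
  by case/eqP: ki; rewrite -e rev_ordK.
have l1 : (l.-1 < n.+1)%N by rewrite (leq_ltn_trans (leq_pred _)).
have -> : (n - l).+1 = (n - Ordinal l1)%N by rewrite /= -subSn ?prednK -1?ltnS //; case: (l : nat) lpos.
rewrite Rop_dual -!val_eqE /= ii'.
have -> : (nat_of_ord l == 0%N) = false by rewrite gtn_eqF.
by rewrite mulr0 addr0 -[in LHS](prednK lpos) eqSS.
Qed.

(* The polynomials of Horner's scheme for [p0]. *)
Fixpoint horner_tail k : {poly R} :=
  if k is k'.+1 then 'X * horner_tail k' + (p0`_(n - k'))%:P else 1.

Lemma Rop_horner i : Rop i = horner_mx N (horner_tail i) *m Rop 0.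
Proof.
case: i => i; elim: i => [|i IHi] lti.
  by rewrite /= rmorph1 mul1mx; congr Rop; exact: val_inj.
have lti' : (i < n.+1)%N by exact: ltnW.
rewrite (@Rop_rec (Ordinal lti') (Ordinal lti)) //= IHi /=.
by rewrite rmorphD rmorphM /= horner_mx_X horner_mx_C mulmxDl -mulmxE mulmxA mul_scalar_mx.
Qed.

(** The identity is a combination of the dual basis, all of whose members are left multiples of
    [Rop 0]. *)
Lemma Rop0_unit : Rop 0 \in unitmx.
Proof.
have e : 1%:M = \sum_(i < n.+1) form 1%:M (N ^+ (n - i)) *: Rop i.
  apply: form_nondeg.
  - exact: comm1.
  - rewrite mulmx_sumr mulmx_suml; apply: eq_bigr => j _.
    by rewrite -scalemxAr -scalemxAl Rop_comm.
  move=> l; rewrite form_suml (bigD1 l) //= big1 => [|i il].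
    by rewrite formZl Rop_dual eqxx mulr1 addr0.
  by rewrite formZl Rop_dual eq_sym (negbTE il) mulr0.
have {}e : (\sum_(i < n.+1) form 1%:M (N ^+ (n - i)) *: horner_mx N (horner_tail i)) *m Rop 0 = 1%:M.
  rewrite [RHS]e mulmx_suml; apply: eq_bigr => i _.
  by rewrite -scalemxAl -Rop_horner.
by have [] := mulmx1_unit e.
Qed.

Lemma Rop_quot i : Rop i *m invmx (Rop 0) = horner_mx N (horner_tail i).
Proof. by rewrite Rop_horner mulmxK // Rop0_unit. Qed.

(** [N] sends each Krylov row [a N^k] to the next one; the last row of this matrix expresses
    [a N^(n+1)] through [p0(N) = 0]. *)
Definition companion : 'M[R]_n.+1 :=
  \matrix_(i, j) if (i < n)%N then (j == i.+1 :> nat)%:R else - p0`_j.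

Lemma krylov_companion : krylov a N *m N = companion *m krylov a N.
Proof.
apply/row_matrixP => k; rewrite !row_mul rowK [RHS]mulmx_sum_row.
under [RHS]eq_bigr do rewrite rowK !mxE.
rewrite -mulmxA mulmxE -exprSr.
have [kn|kn] := ltnP k n.
  have kn' : (k.+1 < n.+1)%N by [].
  rewrite (bigD1 (Ordinal kn')) //= eqxx scale1r big1 ?addr0 // => j jk.
  have -> : (nat_of_ord j == k.+1) = false by apply: contraNF jk => /eqP e; apply/eqP/val_inj.
  by rewrite scale0r.
have -> : nat_of_ord k = n by apply/eqP; rewrite eqn_leq kn -ltnS ltn_ord.
have := Np0; rewrite -{1}[p0](coefK p0) p0_size poly_def raddf_sum big_ord_recr /=.
have -> : p0`_n.+1 = 1 by have /monicP := p0_monic; rewrite lead_coefE p0_size.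
rewrite scale1r rmorphXn /= horner_mx_X addrC => /eqP; rewrite addr_eq0 => /eqP ->.
rewrite mulmxN mulmx_sumr -sumrN; apply: eq_bigr => j _.
by rewrite linearZ /= rmorphXn /= horner_mx_X -scalemxAr scaleNr.
Qed.

Lemma krylov_conj (q : {poly R}) :
  krylov a N *m horner_mx N q *m invmx (krylov a N) = horner_mx companion q.
Proof.
suff -> : krylov a N *m horner_mx N q = horner_mx companion q *m krylov a N by rewrite mulmxK.
elim/poly_ind: q => [|q c IHq]; first by rewrite !rmorph0 mulmx0 mul0mx.
rewrite !rmorphD !rmorphM /= !horner_mx_X !horner_mx_C mulmxDr mulmxDl.
by rewrite -!mulmxE mulmxA IHq -!mulmxA krylov_companion scalar_mxC.
Qed.

End KillingAlgebra.

(** * Assembly *)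

Section Assembly.
Context {R : realType} {n : nat}.
Local Notation C := R[i].
Local Notation V := 'cV[R]_n.+1.
Implicit Types (U W : set V) (x y : V).

Lemma free_lin (vT : vectType R) (F : 'I_n.+1 -> vT) : free [tuple F i | i < n.+1] ->
  forall c : 'I_n.+1 -> R, \sum_i c i *: F i = 0 -> forall i, c i = 0.
Proof.
move=> /freeP h c c0; apply: h; rewrite -[RHS]c0; apply: eq_bigr => i _.
by rewrite -tnth_nth tnth_mktuple.
Qed.

Lemma free_krylov (al : 'rV[R]_n.+1) (A : 'M[R]_n.+1) :
  free [tuple al *m A ^+ k | k < n.+1] -> krylov al A \in unitmx.
Proof.
move=> fr; rewrite -row_free_unit -kermx_eq0; apply/eqP/row_matrixP => r; rewrite row0.
set v := row r _; have vC : v *m krylov al A = 0 by rewrite -row_mul mulmx_ker row0.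
apply/rowP => i; rewrite [RHS]mxE; apply: (free_lin fr (c := fun i => v 0 i)).
by rewrite -[RHS]vC [RHS]mulmx_sum_row; apply: eq_bigr => k _; rewrite rowK.
Qed.

Lemma smooth_d0 U (f : V -> R) : open U -> smooth U f -> smooth U (d0 f).
Proof.
move=> oU Cf k; apply: Ck_matrix => // i j.
have [_ h] := Cf k.+1; apply: Ck_eq (h (delta_mx j 0)) => // x _.
by rewrite mxE.
Qed.

Lemma closed_d0 U (f : V -> R) : open U -> smooth U f -> closed_form U (d0 f).
Proof.
move=> oU Cf x Ux v w; have Cd := smooth_d0 oU Cf.
have E v' w' : ('D_v' (d0 f) x *m w') 0 0 = 'D_w' ('D_v' f) x.
  have dd : differentiable (d0 f) x by have [h _] := Cd 1; exact: h.
  have dv : differentiable ('D_v' f) x by have [_ /(_ v')[h _]] := Cf 2; exact: h.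
  rewrite mxE (derive_coord w' dv); apply: eq_bigr => j _; rewrite mulrC; congr (_ * _).
  rewrite (derive_entry _ _ _ dd).
  have -> : (fun y => d0 f y 0 j) = 'D_(delta_mx j 0) f by apply/funext => y; rewrite mxE.
  exact: schwarz oU Ux (Cf 2).
have -> : d1 (d0 f) x v w = ('D_v (d0 f) x *m w) 0 0 - ('D_w (d0 f) x *m v) 0 0.
  by rewrite /d1 mxE [X in _ + X]mxE.
by rewrite !E (schwarz v w oU Ux (Cf 2)) subrr.
Qed.

Lemma closed_form_eq U (al be : form1) : open U -> (forall x, U x -> al x = be x) ->
  closed_form U al -> closed_form U be.
Proof.
move=> oU ab ca x Ux v w; rewrite -[RHS](ca x Ux v w) /d1.
have D z : 'D_z al x = 'D_z be x by apply: near_eq_derive; exact: near_open Ux ab.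
by rewrite !D.
Qed.

(** Take for the momenta [p_k] the Krylov coordinates of [a X]. Then the polynomial in [L] with
    these coefficients is [X], as both send [a] to the same covector, and the defining identity of
    the [h_i] becomes a statement about [X *m X]. *)
Lemma Killing_point W (L g : opfield R n) M K f u h x : Killing_data W L M K f u h g -> W x ->
  [/\ krylov (d0 f x) (L x) \in unitmx, (g x)^T = g x, g x \in unitmx,
      forall i p q, pairing (g x) (p *m K i x) q = pairing (g x) p (q *m K i x) &
      [/\ forall p, pairing (g x) (p *m K 0 x) p = pairing (g x) p p &
      forall X, L x *m X = X *m L x ->
        \sum_i (2^-1 * pairing (g x) (d0 f x *m X *m K i x) (d0 f x *m X)) *: M i x = X *m X]].
Proof.
move=> [[_ reg] [_ du] hE [[_ gT gU] h0] hK] Wx.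
have ak := free_krylov (reg x Wx); have two : 2^-1 != 0 :> R by rewrite invr_eq0 pnatr_eq0.
split; [exact: ak | exact: gT | exact: gU | by move=> i p q; have [_] := hK i x Wx; apply |].
split=> [p|X cX].
  have [hp _] := hK ord0 x Wx; apply: (mulfI two).
  by rewrite -h0 // hp.
pose c := d0 f x *m X *m invmx (krylov (d0 f x) (L x)).
have aX : d0 f x *m X = \sum_k c 0 k *: d0 (fun y => u y k 0) x.
  rewrite -[LHS](mulmxKV ak) mulmx_sum_row; apply: eq_bigr => k _.
  by rewrite rowK du.
have XE : X = \sum_(k < n.+1) c 0 k *: L x ^+ k.
  apply: (krylov_inj ak); first by rewrite -!mulmxE.
    rewrite -!mulmxE mulmx_sumr mulmx_suml; apply: eq_bigr => k _.
    by rewrite -scalemxAr -scalemxAl !mulmxE -exprSr -exprS.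
  rewrite aX mulmx_sumr; apply: eq_bigr => k _.
  by rewrite du // -scalemxAr.
have := hE x Wx (fun k => c 0 k); rewrite -aX -XE expr2 -mulmxE => <-.
apply: eq_bigr => i _; congr (_ *: _).
by have [-> _] := hK i x Wx.
Qed.

(** [a L'^k] is closed because the powers of [L'] have zero bracket with [L]. Its potentials are
    obtained as germs at [x0], whence the smaller neighbourhood. *)
Lemma flat_potentials U (L L' : opfield R n) (a : form1) x0 : open U -> U x0 ->
  smooth U L -> smooth U L' -> smooth U a ->
  (forall x j, U x -> csymop (cmx L) (cmx L) j x = 0) ->
  (forall x j, U x -> csymop (cmx L) (cmx L') j x = 0) ->
  (forall x, U x -> L x *m L' x = L' x *m L x) ->
  closed_form U a -> closed_form U (fun x => a x *m L x) ->
  krylov (a x0) (L x0) \in unitmx ->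
  exists W (phi : V -> V), [/\ open W, W x0, W `<=` U, smooth W phi &
    forall x, W x -> jac phi x = krylov (a x) (L' x)].
Proof.
move=> oU Ux0 CL CL' Ca DL DL' LL' cla claL uk.
have CaL : smooth U (fun x => a x *m L x) by move=> k; exact: Ck_mulmx.
have gDL j : symop (@dg R n x0) (gm x0 L) j (gm x0 L) = 0.
  by apply: (germ_symop0 oU Ux0) => // y; exact: DL.
have gDL' j : symop (@dg R n x0) (gm x0 L) j (gm x0 L') = 0.
  by apply: (germ_symop0 oU Ux0) => // y; exact: DL'.
have guk := gm_krylov oU Ux0 Ca CL uk.
have gLL' : gm x0 L *m gm x0 L' = gm x0 L' *m gm x0 L.
  rewrite -(gm_mul oU Ux0 CL CL') -(gm_mul oU Ux0 CL' CL).
  apply: (mrep_eq (mrep_real oU Ux0 _) (mrep_real oU Ux0 _)).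
  - by move=> k; exact: Ck_mulmx.
  - by move=> k; exact: Ck_mulmx.
  by apply: (near_open oU Ux0) => y Uy; rewrite /cmx LL'.
have gca := germ_closed oU Ux0 Ca cla.
have gcaL : closed (@dg R n x0) (gm x0 a *m gm x0 L).
  by rewrite -(gm_mul oU Ux0 Ca CL); exact: germ_closed oU Ux0 CaL claL.
have dM := @dgM R n x0.
have CX k : smooth U (fun x => L' x ^+ k) by move=> m; exact: Ck_mxX.
have CaX k : smooth U (fun x => a x *m L' x ^+ k).
  by move=> m; exact: (Ck_mulmx oU (Ca m) (CX k m)).
have gX k : gm x0 (fun x => L' x ^+ k) = gm x0 L' ^+ k.
  apply: (mrep_eq (mrep_real oU Ux0 (CX k)) (mrep_exp k (mrep_real oU Ux0 CL'))).
  by apply: (near_open oU Ux0) => y Uy; rewrite /cmx rmorphXn.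
have natU k : k.+1%:R \is a @GRing.unit (germ x0).
  by rewrite germ_unitE rmorph_nat pnatr_eq0.
have cl k : closed (@dg R n x0) (gm x0 (fun x => a x *m L' x ^+ k)).
  rewrite (gm_mul oU Ux0 Ca (CX k)) gX.
  have cX : gm x0 L *m gm x0 L' ^+ k = gm x0 L' ^+ k *m gm x0 L by exact: comm_pow gLL'.
  apply: (closed_lawop0 dM natU guk) => j.
  by rewrite (lawopM dM) // (lawop0 dM gca gcaL) mul0mx add0r (symopX0 dM) ?mulmx0.
have ch k : exists w : germ x0, forall j, dg j w = gm x0 (fun x => a x *m L' x ^+ k) 0 j.
  have [w [_ wE]] := @germ_poincare R n x0 (fun i => gm x0 (fun x => a x *m L' x ^+ k) 0 i) (fun i j => cl k j i).
  by exists w.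
have {ch}[w wE] := choice ch.
pose phi y : V := \col_(k < n.+1) complex.Re (germ_fun (w k) y).
have [W0 [oW0 W00 CW0]] := common_smooth (fun k : 'I_n.+1 => germ_smooth (w k)).
have nE (kj : 'I_n.+1 * 'I_n.+1) : \forall y \near x0,
    cD (delta_mx kj.2 0) (germ_fun (w kj.1)) y = cmx (fun x => a x *m L' x ^+ kj.1) y 0 kj.2.
  have r1 : rep (germ_fun (w kj.1)) (w kj.1) by split; [exact: germ_smooth | rewrite germK].
  have := rep_d kj.2 r1; rewrite wE => r2.
  exact: rep_near r2 (mrep_real oU Ux0 (CaX kj.1) 0 kj.2).
have nnE : \forall y \near x0, forall kj : 'I_n.+1 * 'I_n.+1,
    cD (delta_mx kj.2 0) (germ_fun (w kj.1)) y = cmx (fun x => a x *m L' x ^+ kj.1) y 0 kj.2.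
  exact: filter_forall nE.
have /nbhs_ballP[e /= e0 eP] : nbhs x0 (U `&` W0 `&` [set y | forall kj : 'I_n.+1 * 'I_n.+1,
    cD (delta_mx kj.2 0) (germ_fun (w kj.1)) y = cmx (fun x => a x *m L' x ^+ kj.1) y 0 kj.2]).
  by apply: filterI => //; apply: filterI; exact: open_nbhs_nbhs.
have oB : open (ball x0 e) by exact: ball_open.
exists (ball x0 e), phi; split; [exact: oB | exact: ballxx | by move=> y /eP[[]] | |].
  move=> k; apply: Ck_matrix => // i j; have [h _] := CW0 i k.
  apply: (Ck_eq (f := fun y => complex.Re (germ_fun (w i) y)) oB); first by move=> y _; rewrite mxE.
  by apply: Ck_sub h => y /eP[[]].
move=> x /eP[_ xE]; apply/matrixP => k j; rewrite !mxE.
have := congr1 (@complex.Re R) (xE (k, j)); rewrite /= !mxE /= => <-.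
by congr ('D_ _ _ x); apply/funext => y; rewrite mxE.
Qed.

(** In the bracket of [L] with [\sum_j c_j M_j] the terms containing derivatives of [M_j] vanish.
    What remains is [\sum_j (dc_j L) M_j = L \sum_j dc_j M_j], component by component, the
    hypothesis of [equivariant_Killing]. Germs are taken at each point [x] of [W] in turn. *)
Lemma Killing_reciprocal W (L L' g : opfield R n) (M K : 'I_n.+1 -> opfield R n) f u h :
  open W -> smooth W L -> smooth W L' -> (forall i, smooth W (K i)) ->
  (forall i, smooth W (M i)) -> (forall i x, W x -> L x *m M i x = M i x *m L x) ->
  (forall i x j, W x -> csymop (cmx L) (cmx (M i)) j x = 0) ->
  (forall x, W x -> free [tuple M i x | i < n.+1]) ->
  Killing_data W L M K f u h g ->
  (forall x j, W x -> csymop (cmx L) (cmx L') j x = 0) ->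
  (forall x, W x -> L x *m L' x = L' x *m L x) ->
  let c i j x := coord (d0 f x) (g x) (K^~ x) j (L' x ^+ (n - i)) in
  (forall i j, smooth W (c i j)) /\
  (forall (i j : 'I_n.+1) x, W x -> d0 (c i j) x = d0 (c i 0) x *m K j x).
Proof.
move=> oW CL CL' CK CM LM DM Mfr KD DL' LL' c.
have [[[Cf _] _] _ _ [[Cg _ _] _] _] := KD.
have Ca : smooth W (d0 f) by exact: smooth_d0.
have CX k : smooth W (fun x => L' x ^+ k) by move=> m; exact: Ck_mxX.
have Cc i j : smooth W (c i j).
  move=> k.
  have C1 := Ck_mulmx oW (Ck_mulmx oW (Ca k) (CX (n - i)%N k)) (CK j k).
  have C2 := Ck_mulmx oW C1 (Cg k).
  have CT : Ck k W (fun x => (d0 f x)^T).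
    apply: Ck_matrix => // p q; apply: (Ck_eq (f := fun x => d0 f x q p) oW).
      by move=> x _; rewrite [RHS]mxE.
    exact: Ck_entry.
  have C3 := Ck_entry 0 0 oW (Ck_mulmx oW C2 CT).
  apply: (Ck_eq oW _ (CkM oW (@Ck_cst R V R k W 2^-1) C3)) => x _.
  by [].
split=> // i j x Wx.
have [ak gT gU Ksa [K0q quad]] := Killing_point KD Wx.
have LMx k : L x *m M k x = M k x *m L x by exact: LM.
apply: (equivariant_Killing ak gT gU LMx (free_lin (Mfr x Wx)) Ksa K0q quad
  (tau := fun j => d0 (c i j) x)) => k.
pose gc j := mk x (fun y => (c i j y)%:C%C).
have rc j' : rep (fun y => (c i j' y)%:C%C) (gc j').
  by split=> //; apply: (smooth_at_real oW Wx); exact: Cc.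
have gF : gm x (fun y => L' y ^+ (n - i)) = \sum_j gc j *: gm x (M j).
  apply: (mrep_eq (mrep_real oW Wx (CX _)) (mrep_sum _ (fun j => mrepZ (rc j) (mrep_real oW Wx (CM j))))).
  apply: (near_open oW Wx) => y Wy.
  have [ak' gT' gU' Ksa' [K0q' quad']] := Killing_point KD Wy.
  have LMy l : L y *m M l y = M l y *m L y by exact: LM.
  have cX : L y *m L' y ^+ (n - i) = L' y ^+ (n - i) *m L y by exact: comm_pow (LL' y Wy).
  rewrite /cmx {1}(coordE ak' gT' Ksa' quad' cX) raddf_sum; apply: eq_bigr => l _.
  by rewrite /= map_mxZ.
have gL := mrep_real oW Wx CL.
have gLL' : gm x L *m gm x L' = gm x L' *m gm x L.
  rewrite -(gm_mul oW Wx CL CL') -(gm_mul oW Wx CL' CL).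
  apply: (mrep_eq (mrep_real oW Wx _) (mrep_real oW Wx _)).
  - by move=> m; exact: Ck_mulmx.
  - by move=> m; exact: Ck_mulmx.
  by apply: (near_open oW Wx) => y Wy; rewrite /cmx LL'.
have dM := @dgM R n x.
have gX : gm x (fun y => L' y ^+ (n - i)) = gm x L' ^+ (n - i).
  apply: (mrep_eq (mrep_real oW Wx (CX _)) (mrep_exp _ (mrep_real oW Wx CL'))).
  by apply: (near_open oW Wx) => y Wy; rewrite /cmx rmorphXn.
have DF : symop (@dg R n x) (gm x L) k (\sum_j gc j *: gm x (M j)) = 0.
  rewrite -gF gX; apply: (symopX0 dM) => //.
  by apply: (germ_symop0 oW Wx) => // y; exact: DL'.
have gDM j' : symop (@dg R n x) (gm x L) k (gm x (M j')) = 0.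
  by apply: (germ_symop0 oW Wx CL (CM j')) => y Wy; exact: DM.
have Dsum (s : seq 'I_n.+1) : symop (@dg R n x) (gm x L) k (\sum_(j <- s) gc j *: gm x (M j)) =
    \sum_(j <- s) ((grad (@dg R n x) (gc j) *m gm x L) 0 k *: gm x (M j)
      - dg k (gc j) *: (gm x L *m gm x (M j))).
  elim: s => [|j' s IHs]; first by rewrite !big_nil symop0.
  by rewrite !big_cons symopD IHs (symop_scale dM) gDM scaler0 add0r.
have := congr1 (map_mx (@ev R n x)) (etrans (esym (Dsum _)) DF).
rewrite map_mx0 raddf_sum => ev0.
have evd j' l : ev (dg l (gc j')) = (d0 (c i j') x 0 l)%:C%C.
  by rewrite (rep_ev (rep_d l (rc j'))) cD_real mxE.
have evM j' : map_mx (@ev R n x) (gm x (M j')) = cmx (M j') x by exact: ev_gm oW Wx (CM j').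
have evL : map_mx (@ev R n x) (gm x L) = cmx L x by exact: ev_gm oW Wx CL.
have evg j' : ev ((grad (@dg R n x) (gc j') *m gm x L) 0 k) = ((d0 (c i j') x *m L x) 0 k)%:C%C.
  have gE : (grad (@dg R n x) (gc j') *m gm x L) 0 k = \sum_l dg l (gc j') * gm x L l k.
    by rewrite mxE; apply: eq_bigr => l _; rewrite mxE.
  rewrite gE mxE !rmorph_sum; apply: eq_bigr => l _; rewrite !rmorphM.
  by congr (_ * _); [exact: evd | have /matrixP/(_ l k) := evL; rewrite !mxE].
have e : \sum_j ((d0 (c i j) x *m L x) 0 k)%:C%C *: cmx (M j) x =
    \sum_j (d0 (c i j) x 0 k)%:C%C *: (cmx L x *m cmx (M j) x).
  apply/eqP; rewrite -subr_eq0 -sumrB; apply/eqP; rewrite -[RHS]ev0; apply: eq_bigr => l _.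
  rewrite -[RHS]/(map_mx (@ev R n x) _) map_mxB !map_mxZ map_mxM evM evL.
  by congr (_ *: _ - _ *: _); [exact/esym/evg | exact/esym/evd].
apply: cmx_inj.
have -> : map_mx (real_complex R) (\sum_j (d0 (c i j) x *m L x) 0 k *: M j x) =
    \sum_j ((d0 (c i j) x *m L x) 0 k)%:C%C *: cmx (M j) x.
  by rewrite raddf_sum; apply: eq_bigr => l _; exact: map_mxZ.
rewrite e mulmx_sumr raddf_sum; apply: eq_bigr => l _.
by rewrite -scalemxAr /= map_mxZ map_mxM.
Qed.

Lemma smooth_sub U W (T : normedModType R) (F : V -> T) : U `<=` W -> smooth W F -> smooth U F.
Proof. by move=> UW CF k; exact: Ck_sub UW (CF k). Qed.

Lemma Killing_data_sub U W (L g : opfield R n) M K f u h : U `<=` W ->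
  Killing_data W L M K f u h g -> Killing_data U L M K f u h g.
Proof.
move=> UW [[[Cf cfL] reg] [[Cu uI uJ] du] hE [[Cg gT gU] h0] hK].
split; [| | by move=> x /UW; exact: hE | | by move=> i x /UW; exact: hK].
- split; last by move=> x /UW; exact: reg.
  by split; [exact: smooth_sub Cf | move=> x /UW; exact: cfL].
- split; last by move=> k x /UW; exact: du.
  split; [exact: smooth_sub Cu | | by move=> x /UW; exact: uJ].
  by move=> x y /set_mem/UW/mem_set xW /set_mem/UW/mem_set yW; exact: uI.
- split; last by move=> x /UW; exact: h0.
  by split; [exact: smooth_sub Cg | move=> x /UW; exact: gT | move=> x /UW; exact: gU].
Qed.

End Assembly.

Theorem corollary6p2 (R : realType) (n : nat) (U : set 'cV[R]_n.+1)
    (L : opfield R n) (M K : 'I_n.+1 -> opfield R n)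
    (U_open : open U)
    (L_smooth : smooth U L)
    (L_nijenhuis : nijenhuis U L)
    (L_regular : gl_regular U L)
    (L_generic : algebraically_generic U L)
    (M_basis : Sym_basis U L M)
    (K_killing : Killing_tensors U L M K)
    (x0 : 'cV[R]_n.+1) (x0_in : U x0) :
  exists (V : set 'cV[R]_n.+1) (Kt : 'I_n.+1 -> opfield R n)
         (phi : 'cV[R]_n.+1 -> 'cV[R]_n.+1) (A : 'I_n.+1 -> 'M[R]_n.+1),
    [/\ open V, V x0 & V `<=` U] /\
    [/\ reciprocal_transform V K Kt,
        coordinates V phi
      & forall i x, V x -> in_coordinates phi (Kt i) x = A i].
Proof.
have [CK0 Kloc] := K_killing; have [W [oW W0 WU] [f [u [h [g KD]]]]] := Kloc x0 x0_in.
have [SM Mfr] := M_basis.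
have LS := nijenhuis_in_Sym L_smooth L_nijenhuis.
have DL x j : W x -> csymop (cmx L) (cmx L) j x = 0.
  by move=> /WU Ux; exact: Sym_csymop U_open L_smooth LS Ux.
have DM i x j : W x -> csymop (cmx L) (cmx (M i)) j x = 0.
  by move=> /WU Ux; exact: Sym_csymop U_open L_smooth (SM i) Ux.
have CL : smooth W L by exact: smooth_sub WU L_smooth.
have gen : algebraically_generic W L.
  case: L_generic => s [m [lam [m0 lamP]]]; exists s, m, lam; split=> // x /WU.
  exact: lamP.
have [[[Cf cfL] _] _ _ _ _] := KD.
have Ca := smooth_d0 oW Cf; have cla := closed_d0 oW Cf.
have [ak0 _ _ _ _] := Killing_point KD W0.
have [W1 [L' [oW1 W10 W1W [CL' L'0 LL' DL' chi]]]] :=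
  flat_function oW W0 CL DL gen Ca cla cfL ak0.
have [W2 [phi [oW2 W20 W21 Cphi jacE]]] := flat_potentials oW1 W10 (smooth_sub W1W CL) CL'
  (smooth_sub W1W Ca) (fun x j W1x => DL x j (W1W x W1x)) DL' LL'
  (fun x W1x => cla x (W1W x W1x)) (fun x W1x => cfL x (W1W x W1x)) ak0.
(* At [x0] the Jacobian is the Krylov matrix of [L] itself, because [L'] and [L] agree there; this
   is where the regularity of [f] gives coordinates. *)
have uJ0 : jac phi x0 \in unitmx by rewrite jacE // L'0.
have [V [oV V0 V2 Vphi]] := local_coordinates oW2 W20 Cphi uJ0.
have V1 : V `<=` W1 by move=> x /V2/W21.
have VW : V `<=` W by move=> x /V1/W1W.
have VU : V `<=` U by move=> x /VW/WU.
have CM i : smooth V (M i) by have [CMi _ _] := SM i; exact: smooth_sub VU CMi.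
have LM i x : V x -> L x *m M i x = M i x *m L x.
  by move=> /VU Ux; have [_ LMi _] := SM i; exact: LMi.
have CK i : smooth V (K i) by exact: smooth_sub VU (CK0 i).
have KDV := Killing_data_sub VW KD.
have Mf x : V x -> free [tuple M i x | i < n.+1] by move=> /VU; exact: Mfr.
have [Cc dc] := Killing_reciprocal oV (smooth_sub VW CL) (smooth_sub V1 CL') CK CM LM
  (fun i x j Vx => DM i x j (VW x Vx)) Mf KDV (fun x j Vx => DL' x j (V1 x Vx))
  (fun x Vx => LL' x (V1 x Vx)).
pose C x := recip_mx (d0 f x) (g x) (K^~ x) (L' x).
pose p0 := char_poly (L x0).
have aN x : V x -> krylov (d0 f x) (L' x) \in unitmx.
  by move=> Vx; rewrite -jacE; [have [_ _ uJ] := Vphi; exact: uJ | exact: V2].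
have alg i x : V x -> [/\ K ord0 x = 1%:M, C x \in unitmx,
    reciprocal_ops K C ord0 x \in unitmx &
    reciprocal_ops K C i x *m invmx (reciprocal_ops K C ord0 x) =
    horner_mx (L' x) (@horner_tail R n p0 i)].
  move=> Vx; have [ak gT gU Ksa [K0q quad]] := Killing_point KDV Vx.
  have Mfree := free_lin (Mf x Vx).
  have cN := LL' x (V1 x Vx).
  have pm : p0 \is monic by exact: char_poly_monic.
  have ps : size p0 = n.+2 by exact: size_char_poly.
  have Np0 : horner_mx (L' x) p0 = 0 by exact: chi (V1 x Vx).
  have LMx k := LM k x Vx.
  split.
  - exact: Killing_id gT gU Ksa K0q.
  - exact: (@recip_mx_unit R n (d0 f x) (L x) (g x) (M^~ x) (K^~ x) ak gT Ksa quad (L' x) cN (aN x Vx)).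
  - exact: (@Rop0_unit R n (d0 f x) (L x) (g x) (M^~ x) (K^~ x) ak gT gU Mfree Ksa K0q quad (L' x) p0 cN (aN x Vx) pm ps Np0).
  exact: (@Rop_quot R n (d0 f x) (L x) (g x) (M^~ x) (K^~ x) ak gT gU Mfree Ksa K0q quad (L' x) p0 cN (aN x Vx) pm ps Np0 i).
exists V, (fun i x => reciprocal_ops K C i x *m invmx (reciprocal_ops K C ord0 x)), phi,
  (fun i => horner_mx (@companion R n p0) (@horner_tail R n p0 i)).
split; [by split | split; [split | exact: Vphi |]].
- exact: CK.
- by move=> x Vx; have [] := alg ord0 x Vx.
(* As [K_1 = Id], the conservation laws can be read off as the first column of [C]. *)
- exists (fun i x => C x i ord0), C.
  have CE i j : (fun x => C x i j) = (fun x => coord (d0 f x) (g x) (K^~ x) j (L' x ^+ (n - i))).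
    by apply/funext => x; rewrite mxE.
  have dC (i j : 'I_n.+1) x : V x -> d0 (fun y => C y i ord0) x *m K j x = d0 (fun y => C y i j) x.
    by move=> Vx; rewrite !CE; apply: esym; exact: (dc i j x Vx).
  split.
  + move=> i j; have Ci k : smooth V (fun x => C x i k) by rewrite CE; exact: Cc.
    split; first exact: Ci.
    by apply: (closed_form_eq oV _ (closed_d0 oV (Ci j))) => x Vx; rewrite dC.
  + split; last by move=> i j x Vx; exact: dC.
    by move=> k; apply: Ck_matrix => // i j; rewrite CE; exact: Cc.
  + by move=> x Vx; have [] := alg ord0 x Vx.
  + by move=> x Vx; have [] := alg ord0 x Vx.
  + by [].
move=> i x Vx; have [_ _ _ KtE] := alg i x Vx.
rewrite /in_coordinates KtE (jacE x (V2 x Vx)).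
apply: krylov_conj; [exact: aN | exact: char_poly_monic | exact: size_char_poly |].
exact: chi (V1 x Vx).
Qed.
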